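(* Under the hypotheses of the setup (types $A$–$D$ with arbitrary simple system, or distinguished $F(3|1)$, $G(3)$; arbitrary total order on $I$), let $\mathbf i,\mathbf j\in\mathsf L^+$ with $\mathbf i<\mathbf j$. Then $$\mathrm E_{\mathbf j}\star\mathrm E_{\mathbf i}=\sum_{\mathbf k\in\mathsf W^+,\ \mathbf i\mathbf j\le\mathbf k\le\mathbf j\mathbf i}c^{\mathbf k}_{\mathbf i,\mathbf j}\,\mathrm E_{\mathbf k}\qquad(c^{\mathbf k}_{\mathbf i,\mathbf j}\in\mathbb Q(q)).$$
   Context: Let $\mathfrak g$ be a basic Lie superalgebra of type $A(m,n)$, $B(m,n+1)$, $C(n+1)$ or $D(m,n+1)$ with an arbitrary simple system, or of type $F(3|1)$ (distinguished simple system: nodes $1,2,3$ even, $4$ isotropic odd, bonds $1$–$2$ single, $2$–$3$ double, $3$–$4$ single) or $G(3)$ (distinguished: $1$ isotropic odd, $2,3$ even, $1$–$2$ single, $2$–$3$ triple), with simple system $\Pi=\{\alpha_i\mid i\in I\}$, parity $p(i)$, $Q^+=\bigoplus\mathbb Z_{\ge0}\alpha_i$, parity $p(\sum c_i\alpha_i)=\sum c_ip(i)\bmod2$, $(\cdot,\cdot)$ the symmetric form with $(\alpha_i,\alpha_j)=d_ia_{ij}$. $\Phi^+$: positive roots of the reduced root system; an odd root $\beta$ is isotropic if $(\beta,\beta)=0$. $\pi:=-1$, $q$ an indeterminate; $U_q$ the positive half of the quantum supergroup. $\mathsf F$: free $\mathbb Q(q)$-algebra on $I$ with basis the words, weight $|\mathbf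 i|=\sum\alpha_{i_s}$, parity $\sum p(i_s)$. $\diamond_v$: $x\diamond_v\emptyset=\emptyset\diamond_vx=x$, $(xi)\diamond_v(yj)=(x\diamond_v(yj))i+\pi^{(p(x)+p(i))p(j)}v^{-(|x|+\alpha_i,\alpha_j)}((xi)\diamond_vy)j$; $\star:=\diamond_q$, $x\star_{q,q^{-1}}y:=x\diamond_qy-x\diamond_{q^{-1}}y$. $\Psi:U_q\to(\mathsf F,\star)$ injective algebra map with $\Psi(e_i)=i$, $\mathsf U=\Psi(U_q)$. Fix a total order on $I$; lexicographic order on words ($\mathbf i<\mathbf j$ if proper prefix, or smaller at first difference). Dominant: $\max(u)$ for some $u\in\mathsf U$ ($\mathsf W^+$); Lyndon: smaller than all proper right factors; $\mathsf L^+$ dominant Lyndon. Co-standard factorization of Lyndon $\mathbf i$: $\mathbf i=\mathbf i_1\mathbf i_2$ with $\mathbf i_1$ Lyndon of maximal length. Canonical factorization $\mathbf i=\mathbf i_1^{n_1}\cdots\mathbf i_d^{n_d}$, $\mathbf i_1>\cdots>\mathbf i_d$ Lyndon. Lyndon vectors: $r_i=i$, $r_{\mathbf i}=r_{\mathbf i_1}\star_{q,q^{-1}}r_{\mathbf i_2}$ ($\mathbf i\in\mathsf L^+$). Bar: $\mathbb Q$-linear, $\bar q=\pi q^{-1}$ in type $B(0,n+1)$ and $q^{-1}$ otherwise, $\overline{(i_1,\dots,i_d)}=\pi^{\sum_{s<t}p(i_s)p(i_t)}q^{-\sum_{s<t}(\alpha_{i_s},\alpha_{i_t})}(i_d,\dots,i_1)$;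 $\tau$ = word reversal; $\sigma(x)=\overline{\tau(x)}$. $q_i=q^{d_i}$; $[n]_i=\frac{q_i^n-q_i^{-n}}{q_i-q_i^{-1}}$ ($i$ even or isotropic), $[n]_i=\frac{\pi^nq_i^n-q_i^{-n}}{\pi q_i-q_i^{-1}}$ ($i$ odd non-isotropic), $\{n\}_i=\frac{\pi^nq_i^n-q_i^{-n}}{\pi q_i-q_i^{-1}}$; for $\beta\in\Phi^+$ with $(\beta,\beta)=(\alpha_i,\alpha_i)$: $[n]_\beta=[n]_i$ if $\beta$ even or isotropic odd, $\{n\}_i$ if odd non-isotropic; $[n]_\beta!=\prod_{k\le n}[k]_\beta$. $\kappa_i=1$ for letters; for $\mathbf i=\mathbf i_1\mathbf i_2$ co-standard, $\beta_k=|\mathbf i_k|$, $\kappa_{\mathbf i}=[p_{\mathbf i}+1]_{\beta_r}\kappa_{\mathbf i_1}\kappa_{\mathbf i_2}$ with $p_{\mathbf i}=\max\{p\ge0\mid\beta_1-p\beta_2\in\Phi^+\}$ and $\beta_r$ the one of $\beta_1,\beta_2$ with smaller $(\beta,\beta)$. $\mathrm E_{\mathbf i}=\kappa_{\mathbf i}^{-1}\sigma(r_{\mathbf i})$ ($\mathbf i\in\mathsf L^+$); $\mathrm E^{(n)}_{\mathbf j}=\mathrm E_{\mathbf j}^{\star n}/[n]_{|\mathbf j|}!$; for $\mathbf i\in\mathsf W^+$ with canonical factorization $\mathbf i_1^{n_1}\cdots\mathbf i_d^{n_d}$, $\mathrm E_{\mathbf i}=\mathrm E_{\mathbf i_d}^{(n_d)}\star\cdots\star\mathrm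 E_{\mathbf i_1}^{(n_1)}$. These $\mathrm E_{\mathbf i}$, $\mathbf i\in\mathsf W^+$, form a basis of $\mathsf U$. *)

(* Defs.v *)
From HB Require Import structures.
From mathcomp Require Import all_boot all_order all_algebra all_fingroup.
From Stdlib Require Import ClassicalEpsilon.
Set Implicit Arguments. Unset Strict Implicit. Unset Printing Implicit Defensive.
Import GRing.Theory.
Local Open Scope ring_scope.

Record sdatum := SDatum {
  amb : nat;
  rank : nat;
  gram : 'M[rat]_amb;
  sroot : 'I_rank -> 'rV[rat]_amb;
  roots : seq ('rV[rat]_amb * bool);      (* all roots of the REDUCED root
                                             system, with parity (true = odd) *)
  diso : int;                             (* d_i of isotropic simple roots *)
  barneg : bool                           (* true iff type B(0,n+1) *)
}.

Definition ev N (k : 'I_N) : 'rV[rat]_N := delta_mx 0 k.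
Definition pm : seq rat := [:: 1; -1].

Definition diag_gram N (isd : 'I_N -> bool) (g : rat) : 'M[rat]_N :=
  \matrix_(i, j) (if i == j then (if isd i then - g else g) else 0).

Definition rootsA N (isd : 'I_N -> bool) : seq ('rV[rat]_N * bool) :=
  flatten [seq [seq (ev i - ev j, isd i != isd j) | j <- [seq j : 'I_N <- enum 'I_N | j != i]]
          | i <- enum 'I_N].

Definition rootsBCD N (isd : 'I_N -> bool) (short long : bool)
  : seq ('rV[rat]_N * bool) :=
  flatten (flatten
    [seq [seq [seq (s *: ev i + u *: ev j, isd i != isd j) | s <- pm, u <- pm]
         | j <- [seq j : 'I_N <- enum 'I_N | (i < j)%N]] | i <- enum 'I_N])
  ++ (if short then [seq (s *: ev i, isd i) | i <- enum 'I_N, s <- pm] else [::])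
  ++ (if long then [seq ((2 * s) *: ev i, false) | i <- [seq i : 'I_N <- enum 'I_N | isd i], s <- pm]
      else [::]).

Definition sdiff N (s : 'S_N.+1) (a : nat) : 'rV[rat]_N.+1 :=
  ev (s (inord a)) - ev (s (inord a.+1)).

Inductive stype :=
| TA (m n : nat) of 'S_((m + n).+2)      (* A(m,n) = gl(m+1|n+1) *)
| TB (m n : nat) of 'S_((m + n).+1)        (* B(m,n+1) = osp(2m+1|2n+2) *)
| TC (n : nat) of 'S_(n.+1)              (* C(n+1) = osp(2|2n) *)
| TD (m n : nat) of 'S_((m + n).+1)        (* D(m,n+1) = osp(2m|2n+2) *)
| TF                                     (* F(3|1), distinguished *)
| TG.                                    (* G(3), distinguished *)

Definition valid (T : stype) : Prop :=
  match T with
  | TC n _ => (1 <= n)%N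
  | TD m _ _ => (2 <= m)%N
  | _ => True
  end.

(* A(m,n): coordinates 0..m are epsilons (form +1), m+1..m+n+1 deltas (-1) *)
Definition datumA (m n : nat) (s : 'S_((m + n).+2)) : sdatum :=
  let isd := fun k : 'I_((m + n).+2) => (m < k)%N in
  @SDatum ((m + n).+2) ((m + n).+1) (diag_gram isd 1)
    (fun a => sdiff s a) (rootsA isd) 1 false.

(* B(m,n+1): coordinates 0..m-1 epsilons (form +2), m..m+n deltas (-2);
   form scaled by 2 so that all d_i are integers *)
Definition datumB (m n : nat) (s : 'S_((m + n).+1)) : sdatum :=
  let N := (m + n).+1 in
  let isd := fun k : 'I_N => (m <= k)%N in
  @SDatum N N (diag_gram isd 2)
    (fun a => if (a.+1 < N)%N then sdiff s a else ev (s (inord a)))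
    (rootsBCD isd true false) 2 (m == 0)%N.

Definition lastCD N (isd : 'I_N.+1 -> bool) (s : 'S_N.+1) (a : nat) : 'rV[rat]_N.+1 :=
  if isd (s (inord a)) then 2 *: ev (s (inord a))
  else ev (s (inord a.-1)) + ev (s (inord a)).

Definition datumC (n : nat) (s : 'S_(n.+1)) : sdatum :=
  let isd := fun k : 'I_(n.+1) => (0 < k)%N in
  @SDatum n.+1 n.+1 (diag_gram isd 1)
    (fun a => if (a.+1 < n.+1)%N then sdiff s a else lastCD isd s a)
    (rootsBCD isd false true) 1 false.

Definition datumD (m n : nat) (s : 'S_((m + n).+1)) : sdatum :=
  let N := (m + n).+1 in
  let isd := fun k : 'I_N => (m <= k)%N in
  @SDatum N N (diag_gram isd 1)
    (fun a => if (a.+1 < N)%N then sdiff s a else lastCD isd s a)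
    (rootsBCD isd false true) 1 false.

(* F(3|1): ambient eps1,eps2,eps3,delta with form diag(2,2,2,-6).
   even roots +-eps_i+-eps_j, +-eps_i, +-delta;
   odd roots (+-eps1+-eps2+-eps3+-delta)/2.
   simple: a1 = eps1-eps2, a2 = eps2-eps3, a3 = eps3, a4 = (delta-eps1-eps2-eps3)/2 *)
Definition e4 (k : nat) : 'rV[rat]_4 := ev (inord k).
Definition rootsF : seq ('rV[rat]_4 * bool) :=
  flatten (flatten [seq [seq [seq (s *: e4 i + u *: e4 j, false) | s <- pm, u <- pm]
                         | j <- [seq j <- iota 0 3 | (i < j)%N]] | i <- iota 0 3])
  ++ [seq (s *: e4 i, false) | i <- iota 0 4, s <- pm]
  ++ flatten (flatten [seq [seq [seq
        (2^-1 *: (s1 *: e4 0 + s2 *: e4 1 + s3 *: e4 2 + s4 *: e4 3), true)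
        | s3 <- pm, s4 <- pm] | s2 <- pm] | s1 <- pm]).
Definition datumF : sdatum :=
  @SDatum 4 4 (\matrix_(i, j) (if i == j then (if (i == 3 :> nat) then -6 else 2) else 0))
    (fun a => nth 0 [:: e4 0 - e4 1; e4 1 - e4 2; e4 2;
                        2^-1 *: (e4 3 - e4 0 - e4 1 - e4 2)] a)
    rootsF 1 false.

(* G(3): ambient eps1, eps2, delta (eps3 = -eps1-eps2), with
   (eps_i,eps_j) = 1 - 3 delta_ij, (delta,delta) = 2.
   even roots eps_i - eps_j, +-eps_i (2 delta removed: reduced system);
   odd roots +-eps_i +-delta, +-delta.
   simple: a1 = delta + eps1, a2 = eps2, a3 = eps3 - eps2. *)
Definition e3 (k : nat) : 'rV[rat]_3 := ev (inord k).
Definition epsG : seq 'rV[rat]_3 := [:: e3 0; e3 1; - e3 0 - e3 1].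
Definition rootsG : seq ('rV[rat]_3 * bool) :=
  flatten [seq [seq (x - y, false) | y <- [seq y <- epsG | y != x]] | x <- epsG]
  ++ [seq (s *: x, false) | x <- epsG, s <- pm]
  ++ flatten [seq [seq (s *: x + u *: e3 2, true) | s <- pm, u <- pm] | x <- epsG]
  ++ [seq (s *: e3 2, true) | s <- pm].
Definition datumG : sdatum :=
  @SDatum 3 3
    (\matrix_(i, j) nth 0 (nth [::] [:: [:: -2; 1; 0]; [:: 1; -2; 0]; [:: 0; 0; 2]] i) j)
    (fun a => nth 0 [:: e3 2 + e3 0; e3 1; - e3 0 - e3 1 - e3 1] a)
    rootsG 1 false.

Definition datum_of (T : stype) : sdatum :=
  match T with
  | TA m n s => datumA s
  | TB m n s => datumB s
  | TC n s => datumC s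
  | TD m n s => datumD s
  | TF => datumF
  | TG => datumG
  end.

Definition bil (D : sdatum) (u v : 'rV[rat]_(amb D)) : rat :=
  (u *m gram D *m v^T) 0 0.
(* integer value of the form (all values used are integers) *)
Definition ip (D : sdatum) (u v : 'rV[rat]_(amb D)) : int := numq (bil u v).

Definition letter (D : sdatum) := 'I_(rank D).
Definition word (D : sdatum) := seq (letter D).

Definition par (D : sdatum) (i : letter D) : bool := (@sroot D i, true) \in roots D.
Definition wpar (D : sdatum) (w : word D) : bool := odd (count (@par D) w).
Definition wt (D : sdatum) (w : word D) : 'rV[rat]_(amb D) := \sum_(i <- w) @sroot D i.

Definition K := {fraction {poly rat}}.
Definition tof : {poly rat} -> K := @FracField.tofrac _.
Definition q : K := tof 'X.

(* elements of F: finite formal Q(q)-linear combinations of words *)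
Definition F (D : sdatum) := seq (word D * K).
Definition coefF (D : sdatum) (x : F D) (w : word D) : K :=
  \sum_(p <- x | p.1 == w) p.2.
Definition scaleF (D : sdatum) (c : K) (x : F D) : F D := [seq (p.1, c * p.2) | p <- x].
Definition unitF (D : sdatum) : F D := [:: ([::], 1)].
Definition eqF (D : sdatum) (x y : F D) : Prop := forall w, coefF x w = coefF y w.

(* x <>_v y on words, computed on reversed words xr = rev x, yr = rev y:
   (x i) <> (y j) = (x <> (y j)) i + pi^{(p(x)+p(i))p(j)} v^{-(|x|+a_i,a_j)} ((x i) <> y) j *)
Fixpoint shr (D : sdatum) (v : K) (xr yr : word D) {struct xr} : F D :=
  let fix shr2 (yr : word D) : F D :=
    match xr, yr with
    | [::], _ => [:: (rev yr, 1)]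
    | _, [::] => [:: (rev xr, 1)]
    | i :: xr', j :: yr' =>
        [seq (rcons p.1 i, p.2) | p <- shr v xr' yr]
        ++ [seq (rcons p.1 j,
                 (-1) ^+ ((wpar (rev xr') (+) par i) && par j)
                 * v ^ (- ip (wt (rev xr') + @sroot D i) (@sroot D j)) * p.2)
           | p <- shr2 yr']
    end
  in shr2 yr.

Definition shuffle (D : sdatum) (v : K) (x y : word D) : F D := shr v (rev x) (rev y).

Definition mulF (D : sdatum) (v : K) (a b : F D) : F D :=
  flatten [seq [seq (r.1, a1.2 * b1.2 * r.2) | r <- shuffle v a1.1 b1.1]
          | a1 <- a, b1 <- b].

Definition star (D : sdatum) (a b : F D) : F D := mulF q a b.
Definition starqq (D : sdatum) (a b : F D) : F D :=
  mulF q a b ++ scaleF (-1) (mulF q^-1 a b).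

(* U = Psi(U_q): the star-subalgebra of F generated by the letters *)
Inductive inU (D : sdatum) : F D -> Prop :=
| inU1 : inU (unitF D)
| inUl (i : letter D) : inU [:: ([:: i], 1)]
| inUadd a b : inU a -> inU b -> inU (a ++ b)
| inUscale (c : K) a : inU a -> inU (scaleF c a)
| inUmul a b : inU a -> inU b -> inU (star a b)
| inUeq a b : inU a -> eqF a b -> inU b.

(* total order on I given by a ranking permutation rho: i < j iff rho i < rho j *)
Fixpoint lexlt n (rho : 'S_n) (x y : seq 'I_n) : bool :=
  match x, y with
  | [::], [::] => false
  | [::], _ :: _ => true
  | _ :: _, [::] => false
  | a :: x', b :: y' => if a == b then lexlt rho x' y' else (rho a < rho b)%N
  end.
Definition lexle n (rho : 'S_n) (x y : seq 'I_n) : bool := (x == y) || lexlt rho x y.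

Definition dominant (D : sdatum) (rho : 'S_(rank D)) (w : word D) : Prop :=
  exists u : F D, inU u /\ coefF u w != 0 /\
    (forall w' : word D, lexlt rho w w' -> coefF u w' = 0).

Definition lyndon n (rho : 'S_n) (w : seq 'I_n) : bool :=
  (w != [::]) && [forall k : 'I_(size w), (0 < k)%N ==> lexlt rho w (drop k w)].

Definition Lplus (D : sdatum) (rho : 'S_(rank D)) (w : word D) : Prop :=
  lyndon rho w /\ dominant rho w.

(* length of the first factor of the co-standard factorization *)
Definition cst n (rho : 'S_n) (w : seq 'I_n) : nat :=
  (\max_(k < size w | (0 < k)%N && lyndon rho (take k w)) k)%N.

Fixpoint rvec (D : sdatum) (rho : 'S_(rank D)) (f : nat) (w : word D) : F D :=
  match f with
  | 0 => [::]
  | f'.+1 =>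
      if (size w <= 1)%N then [:: (w, 1)]
      else starqq (rvec rho f' (take (cst rho w) w)) (rvec rho f' (drop (cst rho w) w))
  end.
Definition rv (D : sdatum) (rho : 'S_(rank D)) (w : word D) : F D := rvec rho (size w) w.

Definition barK (D : sdatum) (f : K) : K :=
  let r := generic_quotient.repr f in
  let t : K := if barneg D then - q^-1 else q^-1 in
  (map_poly (@ratr K) (\n_r : {poly rat})).[t] / (map_poly (@ratr K) (\d_r : {poly rat})).[t].

Fixpoint pairsum (D : sdatum) (g : letter D -> letter D -> int) (w : word D) : int :=
  match w with
  | [::] => 0
  | a :: w' => \sum_(b <- w') g a b + pairsum g w'
  end.

Definition barword (D : sdatum) (w : word D) : K :=
  (-1) ^ pairsum (fun a b => ((par a && par b : bool) : nat)%:Z) w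
  * q ^ (- pairsum (fun a b => ip (@sroot D a) (@sroot D b)) w).

Definition barF (D : sdatum) (x : F D) : F D :=
  [seq (rev p.1, barK D p.2 * barword p.1) | p <- x].
Definition tauF (D : sdatum) (x : F D) : F D := [seq (rev p.1, p.2) | p <- x].
Definition sigmaF (D : sdatum) (x : F D) : F D := barF (tauF x).

Definition isroot (D : sdatum) (v : 'rV[rat]_(amb D)) : bool :=
  ((v, true) \in roots D) || ((v, false) \in roots D).
Definition inQplus (D : sdatum) (v : 'rV[rat]_(amb D)) : Prop :=
  exists c : 'I_(rank D) -> nat, v = \sum_i (c i)%:R *: @sroot D i.
Definition posroot (D : sdatum) (v : 'rV[rat]_(amb D)) : Prop :=
  isroot v /\ inQplus v.

Definition pmax (D : sdatum) (b1 b2 : 'rV[rat]_(amb D)) : nat :=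
  epsilon (inhabits 0%N) (fun p : nat =>
    posroot (b1 - p%:R *: b2) /\
    forall p' : nat, posroot (b1 - p'%:R *: b2) -> (p' <= p)%N).

Definition qint (v : K) (n : nat) : K := (v ^+ n - v ^- n) / (v - v^-1).
Definition qintpi (v : K) (n : nat) : K := ((-1) ^+ n * v ^+ n - v ^- n) / (- v - v^-1).

Definition dR (D : sdatum) (b : 'rV[rat]_(amb D)) : int :=
  if bil b b == 0 then diso D else numq (bil b b / 2).

Definition qnum (D : sdatum) (b : 'rV[rat]_(amb D)) (n : nat) : K :=
  if ((b, true) \in roots D) && (bil b b != 0)
  then qintpi (q ^ dR b) n else qint (q ^ dR b) n.
Definition qfact (D : sdatum) (b : 'rV[rat]_(amb D)) (n : nat) : K :=
  \prod_(k < n) qnum b k.+1.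

Fixpoint kapf (D : sdatum) (rho : 'S_(rank D)) (f : nat) (w : word D) : K :=
  match f with
  | 0 => 1
  | f'.+1 =>
      if (size w <= 1)%N then 1
      else
        let w1 := take (cst rho w) w in
        let w2 := drop (cst rho w) w in
        let b1 := wt w1 in let b2 := wt w2 in
        let br := if bil b1 b1 < bil b2 b2 then b1 else b2 in
        qnum br (pmax b1 b2).+1 * kapf rho f' w1 * kapf rho f' w2
  end.
Definition kappa (D : sdatum) (rho : 'S_(rank D)) (w : word D) : K := kapf rho (size w) w.

Definition EL (D : sdatum) (rho : 'S_(rank D)) (w : word D) : F D :=
  scaleF (kappa rho w)^-1 (sigmaF (rv rho w)).

Definition Epow (D : sdatum) (rho : 'S_(rank D)) (w : word D) (m : nat) : F D :=
  scaleF (qfact (wt w) m)^-1 (iter m (star (EL rho w)) (unitF D)).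

Definition is_canfact n (rho : 'S_n) (w : seq 'I_n) (fs : seq (seq 'I_n)) : Prop :=
  all (lyndon rho) fs /\ flatten fs = w /\ sorted (fun a b => lexle rho b a) fs.
Definition canfact n (rho : 'S_n) (w : seq 'I_n) : seq (seq 'I_n) :=
  epsilon (inhabits [::]) (is_canfact rho w).

Fixpoint runs n (fs : seq (seq 'I_n)) : seq (seq 'I_n * nat) :=
  match fs with
  | [::] => [::]
  | l :: fs' =>
      match runs fs' with
      | (l', m) :: rs => if l == l' then (l, m.+1) :: rs else (l, 1%N) :: (l', m) :: rs
      | [::] => [:: (l, 1%N)]
      end
  end.

Definition Ew (D : sdatum) (rho : 'S_(rank D)) (w : word D) : F D :=
  foldl (fun acc lm => star (Epow rho lm.1 lm.2) acc) (unitF D) (runs (canfact rho w)).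

(* Main.v *)
(** Up to nonzero scalars [E_w] is the image of the Lyndon vector [r_w] under the antiautomorphism
    [sigma], so the claim is that [r_i r_j] is a combination of products [r_k] with
    [ij <= k <= ji].  Following Kharchenko, every product of Lyndon vectors straightens into
    nonincreasing products of Lyndon vectors, which gives [ij <= k].  For the upper bound, call a
    Lyndon word [h] hard if [r_h] is not in the algebra [A] generated by the [r_l] with [l > h].
    The key fact is that [A] then has no element of weight [|h|].  Indeed [A] is a left-coideal
    subalgebra; as long as it contains a letter [x_p] one can reflect it at [p] by a braid
    operator, which decreases the number of positive roots in its support, and at the end
    [|h|] is a simple root of a simple system whose negative cone contains the support of [A].
    Hence [r_h] is orthogonal to all words above [h] for the pairing of the free algebra with the
    shuffle algebra, its maximal word is [h], and the hard words are the dominant Lyndon words.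
    The argument only needs a class of simple systems that is stable under reflections. *)

Require Import Defs.
From HB Require Import structures.
From mathcomp Require Import all_boot all_order all_algebra all_fingroup.
From Stdlib Require Import ClassicalEpsilon.
From mathcomp Require Import boolp ring lra zify.
Set Implicit Arguments. Unset Strict Implicit. Unset Printing Implicit Defensive.

(** * Lyndon words *)

(** Neither root multiplicities of $U_q$ nor a PBW theorem enter. The obstacle is that a reflection
    at an isotropic odd root changes parities and the Dynkin diagram, so no fixed braid group acts
    on one algebra. Hence one bicharacter on the root lattice is fixed and only the family
    [a : I -> V] of simple roots moves. A reflection at p is governed by the least $M_i$ at which
    the coefficient of $x_ix_p^m \mapsto x_ix_p^{m+1}$ vanishes; this treats even, odd and isotropic
    letters alike, including $x_p^2=0$. To iterate, it is not enough that the derivatives of $r_h$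
    lie in $A$: over the reflected system the derivation at p becomes the skew commutator with
    $x_p$. So stability of $A$ under the skew commutator with $r_h$ is carried through the
    induction; straightening provides it. The pairing is a symmetric form on the shuffle algebra
    generated by the letters, in which the coefficient of z at a word w is the pairing of z with the
    product of the letters of w. Dominant words then become the words whose product of letters is
    not a combination of such products over larger words of the same length. *)

Section Words.
Variables (n : nat) (rho : 'S_n).
Notation wd := (seq 'I_n).
Implicit Types (u v w x y z l : wd).
Notation "x <w y" := (lexlt rho x y) (at level 70).
Notation "x <=w y" := (lexle rho x y) (at level 70).
Notation lyn := (lyndon rho).

Lemma rho_inj (a b : 'I_n) : (rho a = rho b :> nat) -> a = b.
Proof. by move=> /val_inj/perm_inj. Qed.

Lemma lt_irr x : x <w x = false.
Proof. by elim: x => //= a x IH; rewrite eqxx. Qed.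

Lemma lt_trans y x z : x <w y -> y <w z -> x <w z.
Proof.
elim: x y z => [|a x IH] [|b y] [|c z] //=.
have [<-|ne] := eqVneq a b.
  by have [_|_] := eqVneq a c; first exact: IH.
have [<-|_] := eqVneq b c; first by rewrite (negPf ne).
by have [->|_] := eqVneq a c => ab bc; [have := ltn_trans ab bc; rewrite ltnn | apply: ltn_trans bc].
Qed.

Lemma lt_total x y : [\/ x = y, x <w y | y <w x].
Proof.
elim: x y => [|a x IH] [|b y] /=; first by constructor.
- by constructor 2.
- by constructor 3.
have [<-|ne] := eqVneq a b.
  by case: (IH y) => [->|h|h]; [constructor 1|constructor 2|constructor 3].
have [h|h|/rho_inj h] := ltngtP (rho a) (rho b); [by constructor 2|by constructor 3|].
by rewrite h eqxx in ne.
Qed.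

Lemma le_refl x : x <=w x. Proof. by rewrite /lexle eqxx. Qed.
Lemma ltW x y : x <w y -> x <=w y. Proof. by rewrite /lexle => ->; rewrite orbT. Qed.
Lemma le_eqVlt x y : x <=w y -> x = y \/ x <w y.
Proof. by case/orP => [/eqP|]; [left | right]. Qed.
Lemma le_lt_trans y x z : x <=w y -> y <w z -> x <w z.
Proof. by move=> /le_eqVlt[->//|]; apply: lt_trans. Qed.
Lemma lt_le_trans y x z : x <w y -> y <=w z -> x <w z.
Proof. by move=> h /le_eqVlt[<-//|]; apply: lt_trans. Qed.
Lemma le_trans y x z : x <=w y -> y <=w z -> x <=w z.
Proof. by move=> /le_eqVlt[->//|h] h'; apply/ltW/(lt_le_trans h). Qed.
Lemma lt_leN x y : x <w y -> y <=w x -> False.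
Proof. by move=> h /(lt_le_trans h); rewrite lt_irr. Qed.
Lemma leNgt x y : ~ (y <w x) -> x <=w y.
Proof. by case: (lt_total x y) => [->|/ltW|] // _; apply: le_refl. Qed.
Lemma le_total x y : (x <=w y) || (y <=w x).
Proof. by case: (lt_total x y) => [->|/ltW ->|/ltW ->]; rewrite ?le_refl ?orbT. Qed.
Lemma le_anti x y : x <=w y -> y <=w x -> x = y.
Proof. by move=> /le_eqVlt[//|h] /(lt_leN h). Qed.

Lemma lt_catl p x y : (p ++ x <w p ++ y) = (x <w y).
Proof. by elim: p => //= a p ->; rewrite eqxx. Qed.
Lemma le_catl p x y : (p ++ x <=w p ++ y) = (x <=w y).
Proof. by rewrite /lexle lt_catl eqseq_cat // eqxx. Qed.
Lemma le_cons c x y : (c :: x <=w c :: y) = (x <=w y).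
Proof. exact: (le_catl [:: c]). Qed.
Lemma lt_nil x : x != [::] -> [::] <w x.
Proof. by case: x. Qed.
Lemma lt_neq0 x y : x <w y -> y != [::].
Proof. by case: y => //; case: x. Qed.
Lemma lt_prefix x z : z != [::] -> x <w x ++ z.
Proof. by move=> z0; rewrite -{1}(cats0 x) lt_catl lt_nil. Qed.
Lemma le_prefix x z : x <=w x ++ z.
Proof. by case: z => [|c z]; [rewrite cats0 le_refl | apply/ltW/lt_prefix]. Qed.

(* [dlt x y]: x and y differ at some position and x is smaller there, so that
   the comparison survives appending arbitrary words *)
Fixpoint dlt x y : bool :=
  match x, y with
  | a :: x', b :: y' => if a == b then dlt x' y' else (rho a < rho b)%N
  | _, _ => false
  end.

Lemma dlt_lt x y u v : dlt x y -> x ++ u <w y ++ v.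
Proof. by elim: x y => [|a x IH] [|b y] //=; case: ifP => // _; apply: IH. Qed.
Lemma dltP x y : x <w y -> dlt x y \/ exists2 z, z != [::] & y = x ++ z.
Proof.
elim: x y => [|a x IH] [|b y] //=; first by right; exists (b :: y).
have [<-|_] := eqVneq a b; last by left.
by case/IH => [h|[z z0 ->]]; [left | right; exists z].
Qed.
Lemma lt_dlt x y : x <w y -> size y <= size x -> dlt x y.
Proof.
move=> /dltP[//|[z z0 ->]]; rewrite size_cat -{2}(addn0 (size x)) leq_add2l.
by case: z z0.
Qed.
Lemma lt_cat_inv s u y : s ++ u <w y -> dlt s y \/ exists2 y', y = s ++ y' & u <w y'.
Proof.
elim: s y => [|a s IH] y; first by right; exists y.
case: y => [|b y] //=; have [<-|_] := eqVneq a b; last by left.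
by case/IH => [h|[y' -> h]]; [left | right; exists y'].
Qed.
Lemma lt_cat2 x y u v : size x = size y -> x <w y -> x ++ u <w y ++ v.
Proof. by move=> e h; apply: dlt_lt; apply: lt_dlt => //; rewrite e. Qed.

Lemma lyndonP w : reflect (w != [::] /\ forall u v, w = u ++ v -> u != [::] -> v != [::] -> w <w v)
  (lyn w).
Proof.
apply: (iffP andP) => [[w0 /forallP h]|[w0 h]]; split=> //.
  move=> u v e u0 v0.
  have lt : size u < size w by rewrite e size_cat -{1}(addn0 (size u)) ltn_add2l; case: v v0 {e}.
  have /implyP /= := h (Ordinal lt).
  have -> : drop (size u) w = v by rewrite e drop_size_cat.
  by apply; case: u u0 {e lt}.
apply/forallP => k; apply/implyP => k0.
apply: (h (take k w)); first by rewrite cat_take_drop.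
  by rewrite -size_eq0 size_take ltn_ord -lt0n.
by rewrite -size_eq0 size_drop subn_eq0 -ltnNge.
Qed.

Lemma lyndon_neq0 w : lyn w -> w != [::]. Proof. by case/lyndonP. Qed.
Lemma lyndon_suffix u v : lyn (u ++ v) -> u != [::] -> v != [::] -> u ++ v <w v.
Proof. by move=> /lyndonP[_ h]; apply: h. Qed.
Lemma lyndon_suffix_dlt u v : lyn (u ++ v) -> u != [::] -> v != [::] -> dlt (u ++ v) v.
Proof.
by move=> h u0 v0; apply: lt_dlt; [apply: lyndon_suffix | rewrite size_cat leq_addl].
Qed.
Lemma lyndon1 a : lyn [:: a].
Proof. by apply/lyndonP; split=> // -[|b u] [|d v] // [_]; case: u. Qed.

Lemma lyndon_cat_lt u v : lyn u -> lyn v -> u <w v -> u ++ v <w v.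
Proof.
move=> lu lv /dltP[h|[z z0 e]]; first by rewrite -{2}(cats0 v); apply: dlt_lt.
by rewrite {2}e lt_catl {1}e; apply: lyndon_suffix; rewrite -?e // lyndon_neq0.
Qed.

Lemma cat_eq_split u v s t : u ++ v = s ++ t -> (size u <= size s)%N ->
  exists d, s = u ++ d /\ v = d ++ t.
Proof.
elim: u s => [|a u IH] [|b s] //=; first by move=> ->; exists [::].
  by move=> ->; exists (b :: s).
by move=> [-> /IH h] /h[d [-> ->]]; exists d.
Qed.

Lemma lyndon_cat u v : lyn u -> lyn v -> u <w v -> lyn (u ++ v).
Proof.
move=> lu lv uv; have uvv := lyndon_cat_lt lu lv uv.
apply/lyndonP; split; first by case: u lu {uv uvv}.
move=> s t e s0 t0.
have [le|/ltnW le] := leqP (size u) (size s).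
  have [d [es ev]] := cat_eq_split e le.
  case: (eqVneq d [::]) ev => [-> /= <-//|d0 ev].
  by apply: lt_trans uvv _; rewrite {1}ev; apply: lyndon_suffix; rewrite -?ev.
have [d [eu et]] := cat_eq_split (esym e) le.
case: (eqVneq d [::]) eu et => [-> eu et|d0 eu et]; first by rewrite et.
by rewrite et; apply: dlt_lt; rewrite {1}eu; apply: lyndon_suffix_dlt; rewrite -?eu.
Qed.

Definition geW : rel wd := fun a b => b <=w a.
Lemma geW_trans : transitive geW. Proof. by move=> y x z h1 h2; apply: le_trans h1. Qed.
Lemma geW_anti : antisymmetric geW.
Proof. by move=> x y /andP[h1 h2]; apply: le_anti. Qed.
Lemma geW_total : total geW. Proof. by move=> x y; apply: le_total. Qed.

Definition canf w fs := [/\ all lyn fs, flatten fs = w & sorted geW fs].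

Lemma canfP w fs : is_canfact rho w fs <-> canf w fs.
Proof. by split=> [[h1 [h2 h3]]|[h1 h2 h3]]. Qed.

(** A Lyndon word put in front of a nonincreasing list is merged with the head as long as it is
    smaller than the head; each merge is again Lyndon. *)
Lemma canf_ex w : exists fs, canf w fs.
Proof.
suff ins l fs : lyn l -> all lyn fs -> sorted geW fs -> exists fs', canf (l ++ flatten fs) fs'.
  elim: w => [|a w [fs [h1 <- h3]]]; first by exists [::].
  exact: (ins [:: a] fs (lyndon1 a) h1 h3).
elim: fs l => [|f fs IH] l hl; first by exists [:: l]; split; rewrite //= hl.
move=> /= /andP[hf hfs] hp; have [lt|ge] := boolP (l <w f).
  by have := IH _ (lyndon_cat hl hf lt) hfs (path_sorted hp); rewrite catA.
exists [:: l, f & fs]; split; rewrite //= ?hl ?hf ?hp ?andbT //.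
by apply: leNgt => h; rewrite h in ge.
Qed.

Lemma sorted_geW_cons f fs : sorted geW (f :: fs) -> forall g, g \in fs -> g <=w f.
Proof. by move=> /(order_path_min geW_trans)/allP h g /h. Qed.

Lemma canf_last f fs : all lyn (rcons fs f) -> sorted geW (rcons fs f) ->
  forall g, g \in rcons fs f -> f <=w g.
Proof.
elim: fs => [|h fs IH] /=.
  by move=> _ _ g; rewrite inE => /eqP ->; apply: le_refl.
move=> /andP[_ ha] hp g; rewrite inE => /predU1P[->|]; last by apply: IH (path_sorted hp) _.
by apply: (sorted_geW_cons hp); rewrite mem_rcons mem_head.
Qed.

(** The last factor is the smallest one and is itself a proper suffix of the Lyndon word. *)
Lemma canf_suffix_gt u t ss : lyn (u ++ t) -> u != [::] -> canf t ss ->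
  forall s, s \in ss -> u ++ t <w s.
Proof.
move=> hl u0 [ha ht hs] s sin.
case: (lastP ss) ha ht hs sin => // ss' f ha ht hs sin.
apply: lt_le_trans (canf_last ha hs sin).
have f0 : f != [::] by apply: lyndon_neq0; apply: (allP ha); rewrite mem_rcons mem_head.
rewrite -ht flatten_rcons catA; apply: lyndon_suffix => //.
  by rewrite -catA -flatten_rcons ht.
by case: (u) u0.
Qed.

Lemma lyndon_suffixes_gt u t : lyn (u ++ t) -> u != [::] ->
  forall a b, t = a ++ b -> b != [::] -> u ++ t <w b.
Proof.
move=> hl u0 a b e b0; rewrite e catA; apply: lyndon_suffix => //.
  by rewrite -catA -e.
by case: (u) u0.
Qed.

(** * Upper bound for the shuffles of two words *)

Lemma fl_core m0 y ms X : y != [::] -> (forall a b, y = a ++ b -> b != [::] -> m0 <w b) ->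
  (forall m, m \in ms -> m <=w m0) -> flatten ms <w y ++ X.
Proof.
elim: ms y => [|m ms IH] y y0 hy hm; first by apply: lt_nil; case: (y) y0.
have my : m <w y by apply: le_lt_trans (hm m (mem_head _ _)) (hy [::] y _ y0).
case: (dltP my) => [h|[y' y'0 e]]; first exact: dlt_lt.
rewrite e /= -catA lt_catl; apply: IH => //.
  by move=> a b e' b0; apply: (hy (m ++ a) b) => //; rewrite e e' catA.
by move=> m' hm'; apply: hm; rewrite inE hm' orbT.
Qed.

Lemma sort_cons s L : (forall m, m \in L -> m <=w s) ->
  sort geW (s :: L) = s :: sort geW L.
Proof.
move=> h; apply: (sorted_eq geW_trans geW_anti).
- exact: sort_sorted geW_total _.
- rewrite /= path_min_sorted ?(sort_sorted geW_total) //.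
  by apply/allP => m; rewrite mem_sort => /h.
- by rewrite perm_sort perm_cons perm_sym perm_sort.
Qed.

Lemma sort_cat_ge ss R m : sorted geW ss -> (forall s, s \in ss -> m <=w s) ->
  (forall r, r \in R -> r <=w m) -> sort geW (ss ++ R) = ss ++ sort geW R.
Proof.
move=> hs h1 h2; elim: ss hs h1 => //= s ss IH hp h1.
rewrite sort_cons ?IH ?(path_sorted hp) // => [|r].
  by move=> t ht; apply: h1; rewrite inE ht orbT.
rewrite mem_cat => /orP[/(sorted_geW_cons hp)//|/h2 hr].
by apply: le_trans hr (h1 _ (mem_head _ _)).
Qed.

(** Factors of [ss] above [T1] stay in front after sorting and are matched against [a] one at a
    time. Once the head is at most [T1], all remaining factors lie below every suffix of [a], and
    [fl_core] applies. *)
Lemma merge_lt T1 ss R a X : sorted geW ss -> flatten ss <w a ->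
  (forall u v, a = u ++ v -> v != [::] -> T1 <w v) -> (forall r, r \in R -> r <=w T1) ->
  flatten (sort geW (ss ++ R)) <w a ++ X.
Proof.
elim: ss a => [|s ss IH] a hs lt ha hR.
  by apply: (fl_core (m0 := T1)) => //; [apply: lt_neq0 lt | move=> m; rewrite mem_sort; apply: hR].
have [sT|Ts] := boolP (s <=w T1).
  apply: (fl_core (m0 := T1)) => //; first exact: lt_neq0 lt.
  move=> m; rewrite mem_sort mem_cat inE -orbA => /or3P[/eqP->//|/(sorted_geW_cons hs) h|/hR//].
  exact: le_trans h sT.
rewrite cat_cons sort_cons; last first.
  move=> m; rewrite mem_cat => /orP[/(sorted_geW_cons hs)//|/hR h].
  by apply: le_trans h _; have := le_total s T1; rewrite (negPf Ts).
case: (lt_cat_inv (lt : s ++ flatten ss <w a)) => [h|[a' e lt']]; first exact: dlt_lt.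
rewrite e /= -catA lt_catl; apply: IH => //; first exact: path_sorted hs.
by move=> u v e' v0; apply: (ha (s ++ u) v) => //; rewrite e e' catA.
Qed.

Inductive shuf : wd -> wd -> wd -> Prop :=
| shuf_nil : shuf [::] [::] [::]
| shuf_l c z x y : shuf z x y -> shuf (c :: z) (c :: x) y
| shuf_r c z x y : shuf z x y -> shuf (c :: z) x (c :: y).

Lemma shuf_sym z x y : shuf z x y -> shuf z y x.
Proof. by elim=> *; constructor. Qed.

Lemma shuf_cat x y : shuf (x ++ y) x y.
Proof.
elim: x => [|a x IH] /=; last by constructor.
by elim: y => [|b y IH]; constructor.
Qed.

(** If no factor of the second word exceeds the leading factor [c :: t'], that factor stays in front
    and both sides agree. Otherwise the greatest factor comes from the second word; if it also
    starts with c, this letter is cancelled and [merge_lt] compares the rest. *)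
Lemma shuf_le_step c x ts fy t' ss : lyn (c :: t') -> canf t' ss ->
  sorted geW ((c :: t') :: ts) -> all lyn fy -> x = flatten (sort geW (ss ++ ts ++ fy)) ->
  c :: x <=w flatten (sort geW (((c :: t') :: ts) ++ fy)).
Proof.
move=> hl hss hts hfy ->.
have gt s : s \in ss -> c :: t' <w s := canf_suffix_gt (u := [:: c]) hl isT hss (s := s).
have hts' := sorted_geW_cons hts.
have [hfx|] := boolP (all (fun f => f <=w c :: t') fy).
  have hR r : r \in ts ++ fy -> r <=w c :: t'.
    by rewrite mem_cat => /orP[/hts'//|/(allP hfx)].
  case: hss => _ et hs'.
  rewrite cat_cons sort_cons // (sort_cat_ge hs' (m := c :: t')) //.
    by rewrite flatten_cat /= et le_refl.
  by move=> s /gt/ltW.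
rewrite -has_predC => /hasP[f ffy /= nf].
set L := ((c :: t') :: ts) ++ fy.
have sL := sort_sorted geW_total L.
case e : (sort geW L) => [|T1 rest].
  by have := size_sort geW L; rewrite e /L.
have TL m : m \in L -> m <=w T1.
  rewrite -(mem_sort geW) e inE => /predU1P[->|]; first exact: le_refl.
  by apply: sorted_geW_cons; rewrite -e.
have T1L : T1 \in L by rewrite -(mem_sort geW) e mem_head.
have lt1 : c :: t' <w T1.
  apply: (@lt_le_trans f); last by apply: TL; rewrite mem_cat ffy orbT.
  have [h|h|//] := lt_total f (c :: t'); first by rewrite h le_refl in nf.
  by rewrite (ltW h) in nf.
have T1fy : T1 \in fy.
  move: T1L; rewrite mem_cat inE -orbA => /or3P[/eqP h|/hts' h|//].
    by rewrite h lt_irr in lt1.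
  by case: (lt_leN lt1 h).
have hT1 := allP hfy _ T1fy.
case: T1 => [|d a] // in e TL T1L lt1 T1fy hT1 *.
apply: ltW; move: lt1 => /=; case: eqVneq => // ed lt1; rewrite -{d}ed in hT1 T1fy T1L TL e *.
apply: (@merge_lt (c :: a)) => //.
- by case: hss.
- by case: hss => _ -> _.
- by move=> u v ea v0; apply: (@lyndon_suffixes_gt [:: c] a hT1 isT u v).
- by move=> r hr; apply: TL; rewrite inE hr orbT.
Qed.

Lemma canf_split c x fx : canf (c :: x) fx -> exists t' ts, fx = (c :: t') :: ts /\ x = t' ++ flatten ts.
Proof.
case: fx => [|t ts] [] //= /andP[/lyndon_neq0 t0 _]; case: t t0 => // d t' _ /= [-> <-] _.
by exists t', ts.
Qed.

(** Removing the first letter of the greatest factor breaks it into factors that exceed all the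
    others, so the two lists just concatenate. *)
Lemma canf_tail t ts ss c : lyn (c :: t) -> all lyn ts -> sorted geW ((c :: t) :: ts) ->
  canf t ss -> canf (t ++ flatten ts) (ss ++ ts).
Proof.
move=> hl hts hs [h1 h2 h3]; split.
- by rewrite all_cat h1.
- by rewrite flatten_cat h2.
have gt s : s \in ss -> c :: t <w s := canf_suffix_gt (u := [:: c]) hl isT (And3 h1 h2 h3) (s := s).
suff <- : sort geW (ss ++ ts) = ss ++ ts by apply: sort_sorted geW_total _.
rewrite (sort_cat_ge (m := c :: t)) //.
- congr (_ ++ _); apply: sorted_sort; [exact: geW_trans | exact: path_sorted hs].
- by move=> s /gt/ltW.
- exact: sorted_geW_cons.
Qed.

Lemma shuf_le_l c z x y fx fy :
  (forall fx', canf x fx' -> z <=w flatten (sort geW (fx' ++ fy))) ->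
  canf (c :: x) fx -> canf y fy -> c :: z <=w flatten (sort geW (fx ++ fy)).
Proof.
move=> IH hx hy; have [t' [ts [ef ex]]] := canf_split hx; subst fx.
case: hx => /= /andP[hl hts] _ hs; have [ss hss] := canf_ex t'.
have := canf_tail hl hts hs hss; rewrite -ex => /IH h.
case: hy => hfy _ _.
apply: le_trans (shuf_le_step hl hss hs hfy erefl).
by rewrite le_cons catA.
Qed.

(** All Lyndon factors of both words, sorted together, bound every shuffle. The first letter of the
    shuffle is taken off the word it came from, [canf_tail] factors what is left of that word, and
    [shuf_le_step] puts the letter back. *)
Lemma shuf_le z x y fx fy : shuf z x y -> canf x fx -> canf y fy ->
  z <=w flatten (sort geW (fx ++ fy)).
Proof.
move=> h; elim: h fx fy => {z x y} [|c z x y _ IH|c z x y _ IH] fx fy hx hy.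
- exact: (le_prefix [::]).
- by apply: (shuf_le_l _ hx hy) => fx1 hx1; apply: IH.
have sw s t : sort geW (s ++ t) = sort geW (t ++ s).
  by apply/(perm_sortP geW_total geW_trans geW_anti); rewrite perm_catC.
by rewrite sw; apply: (shuf_le_l _ hy hx) => fy1 hy1; rewrite sw; apply: IH.
Qed.

(** The new shuffle follows the old one up to the first place where the letters differ. There it is
    already larger, so it may be completed arbitrarily, for instance by concatenation. *)
Lemma shuf_mono z x y x' y' : shuf z x y -> x <=w x' -> y <=w y' ->
  size x = size x' -> size y = size y' -> exists2 z', shuf z' x' y' & z <=w z'.
Proof.
have one c d (u u' : wd) : c :: u <=w d :: u' -> size u = size u' ->
    c = d /\ u <=w u' \/ (rho c < rho d)%N.
  move=> /le_eqVlt[[-> ->] _|/=]; first by left; split=> //; apply: le_refl.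
  by case: eqVneq => [->|_] h _; [left; split=> //; apply: ltW | right].
move=> h; elim: h x' y' => {z x y} [|c z x y _ IH|c z x y _ IH] x' y' hx hy.
- by move=> /esym/size0nil -> /esym/size0nil ->; exists [::]; constructor.
- case: x' hx => // d x' hx /= [sx] sy.
  case: (one _ _ _ _ hx sx) => [[<- hx']|lt].
    have [z' h1 h2] := IH _ _ hx' hy sx sy.
    by exists (c :: z'); [constructor | rewrite le_cons].
  exists (d :: x' ++ y'); first by constructor; apply: shuf_cat.
  by apply: ltW => /=; case: eqVneq lt => [->|//]; rewrite ltnn.
- case: y' hy => // d y' hy sx /= [sy].
  case: (one _ _ _ _ hy sy) => [[<- hy']|lt].
    have [z' h1 h2] := IH _ _ hx hy' sx sy.
    by exists (c :: z'); [constructor | rewrite le_cons].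
  exists (d :: x' ++ y'); first by constructor; apply: shuf_cat.
  by apply: ltW => /=; case: eqVneq lt => [->|//]; rewrite ltnn.
Qed.

Lemma shuf_le_lyndon l B fB z a b : lyn l -> canf B fB -> (forall f, f \in fB -> f <=w l) ->
  shuf z a b -> a <=w l -> b <=w B -> size a = size l -> size b = size B -> z <=w l ++ B.
Proof.
move=> hl hB hf hs ha hb sa sb; have [z' h1 h2] := shuf_mono hs ha hb sa sb.
apply: le_trans h2 _.
have hl' : canf l [:: l] by split; rewrite /= ?hl ?cats0.
have := shuf_le h1 hl' hB; rewrite cat_cons sort_cons //.
have [_ eB sB] := hB.
by rewrite (sorted_sort geW_trans sB) /= eB.
Qed.

(** * The co-standard factorization *)

Section Costandard.
Variable w : wd.
Hypotheses (lw : lyn w) (sw : (1 < size w)%N).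
Notation k := (cst rho w).

Lemma cst_spec : [/\ (0 < k)%N, (k < size w)%N, lyn (take k w) &
  forall k', (0 < k')%N -> (k' < size w)%N -> lyn (take k' w) -> (k' <= k)%N].
Proof.
have h1 : (0 < Ordinal sw)%N && lyn (take (Ordinal sw) w).
  by rewrite /=; case: (w) sw => // a s _; rewrite /= take0 lyndon1.
rewrite /cst (bigmax_eq_arg (Ordinal sw)) //; case: arg_maxnP => // i /andP[i0 li] hmax.
split=> // k' k0 lt lk.
by apply: (hmax (Ordinal lt)); rewrite /= k0.
Qed.

(** If the rest had several canonical factors, the first of them would exceed the Lyndon prefix and
    could be appended to it, against maximality. *)
Lemma cst_drop_lyndon : lyn (drop k w).
Proof.
have [k0 ks lk kmax] := cst_spec.
have [[|l1 fs] [h1 h2 h3]] := canf_ex (drop k w).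
  by have := size_drop k w; rewrite -h2 /= => /esym/eqP; rewrite subn_eq0 leqNgt ks.
case: fs => [|f fs] in h1 h2 h3 *; first by rewrite -h2 /= cats0; case/andP: h1.
have lw1 : lyn (take k w ++ drop k w) by rewrite cat_take_drop.
have t0 : take k w != [::] by rewrite lyndon_neq0.
have gt := canf_suffix_gt lw1 t0 (And3 h1 h2 h3) (mem_head _ _).
have lt : take k w <w l1.
  by apply: le_lt_trans gt; apply: le_prefix.
have [hl1 hf] : lyn l1 /\ lyn f by case/and3P: h1.
have ll := lyndon_cat lk hl1 lt.
have e : w = (take k w ++ l1) ++ (f ++ flatten fs) by rewrite -catA (h2 : l1 ++ (f ++ flatten fs) = _) cat_take_drop.
have sl : (0 < size l1)%N by case: (l1) hl1.
have sf : (0 < size f)%N by case: (f) hf.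
have st : size (take k w) = k by rewrite size_takel // ltnW.
have : (size (take k w ++ l1) <= k)%N.
  have es := congr1 size e; rewrite !size_cat in es.
  have et : take (size (take k w ++ l1)) w = take k w ++ l1.
    by move: e; set t := take k w => e; rewrite e take_size_cat.
  apply: kmax; rewrite ?et //.
    by rewrite size_cat addn_gt0 sl orbT.
  by rewrite size_cat [X in (_ < X)%N]es -[X in (X < _)%N]addn0 ltn_add2l addn_gt0 sf.
by rewrite size_cat st -{2}(addn0 k) leq_add2l leqNgt sl.
Qed.

Lemma cst_lt : take k w <w drop k w.
Proof.
have [k0 ks lk _] := cst_spec.
apply: (@lt_trans w).
  by rewrite -[X in _ <w X](cat_take_drop k w); apply: lt_prefix; apply/lyndon_neq0/cst_drop_lyndon.
rewrite -[X in X <w _](cat_take_drop k w); apply: lyndon_suffix; rewrite ?cat_take_drop //.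
  exact: lyndon_neq0.
exact/lyndon_neq0/cst_drop_lyndon.
Qed.

End Costandard.

(** A longer Lyndon prefix would be h x with x a proper prefix of k. The first canonical factor of x
    exceeds h x, yet it is a Lyndon prefix of k, hence a prefix of the left factor of k, which is at
    most h. *)
Lemma cst_cat h k : lyn h -> lyn k -> h <w k ->
  ((1 < size k)%N -> take (cst rho k) k <=w h) -> cst rho (h ++ k) = size h.
Proof.
move=> lh lk hk hle; have lhk := lyndon_cat lh lk hk.
have sh : (0 < size h)%N by case: (h) lh.
have sk : (0 < size k)%N by case: (k) lk.
have shk : (1 < size (h ++ k))%N by rewrite size_cat; lia.
have [c0 cs lc cmax] := cst_spec shk.
set c := cst rho (h ++ k) in c0 cs lc cmax *.
have le1 : (size h <= c)%N.
  by apply: cmax; rewrite ?take_size_cat // size_cat; lia.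
apply/eqP; rewrite eqn_leq le1 andbT leqNgt; apply/negP => lt.
pose x := take (c - size h) k.
have ex : take c (h ++ k) = h ++ x by rewrite take_cat ltnNge le1.
have sx : (0 < size x < size k)%N.
  have clt : (c - size h < size k)%N by move: cs; rewrite size_cat; lia.
  by rewrite size_take clt clt andbT subn_gt0.
have [xs0 xsk] := andP sx.
have sk1 : (1 < size k)%N by lia.
have [k0 ks lk1 kmax] := cst_spec sk1.
rewrite ex in lc.
have [xs hxs] := canf_ex x.
have h0 : h != [::] by rewrite lyndon_neq0.
have gt := canf_suffix_gt lc h0 hxs.
case: xs hxs gt => [|x1 xs] [a1 a2 a3] gt; first by rewrite -a2 in xs0.
have lx1 : lyn x1 by case/andP: a1.
have ek : k = x1 ++ (flatten xs ++ drop (c - size h) k).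
  by rewrite catA (a2 : x1 ++ flatten xs = x) /x cat_take_drop.
have sx1 : (0 < size x1 <= size x)%N.
  by rewrite -a2 /= size_cat leq_addr andbT; case: (x1) lx1.
have [x10 x1x] := andP sx1.
have le2 : (size x1 <= cst rho k)%N.
  by apply: kmax => //; [lia | rewrite ek take_size_cat].
have : x1 <=w h.
  apply: le_trans (hle sk1).
  move: (cst rho k) le2 => kk le2; rewrite ek take_cat ltnNge le2 /=.
  exact: le_prefix.
apply: lt_leN; apply: lt_trans (gt _ (mem_head _ _)).
by apply: lt_prefix; case: (x) xs0.
Qed.

End Words.

Import GRing.Theory.
Local Open Scope ring_scope.

(** * Quantum shuffle algebra of a bicharacter *)

Record bichar (K : fieldType) (V : zmodType) := Bichar {
  bch :> V -> V -> K;
  bchC : forall u v, bch u v = bch v u;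
  bchDl : forall u v w, bch (u + v) w = bch u w * bch v w;
  bch_neq0 : forall u v, bch u v != 0 }.

Section Bichar.
Variables (K : fieldType) (V : zmodType) (chi : bichar K V).
Implicit Types u v w : V.

Lemma bchDr u v w : chi u (v + w) = chi u v * chi u w.
Proof. by rewrite ![chi u _]bchC bchDl. Qed.

Lemma bch0l v : chi 0 v = 1.
Proof.
have := bchDl chi 0 0 v; rewrite addr0 => /eqP.
by rewrite -{1}[chi 0 v]mulr1 (inj_eq (mulfI (bch_neq0 chi 0 v))) eq_sym => /eqP.
Qed.

Lemma bch0r v : chi v 0 = 1. Proof. by rewrite bchC bch0l. Qed.

Lemma bchNl u v : chi (- u) v = (chi u v)^-1.
Proof.
apply: (mulfI (bch_neq0 chi u v)).
by rewrite divff ?bch_neq0 // -bchDl subrr bch0l.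
Qed.

Lemma bchNr u v : chi u (- v) = (chi u v)^-1.
Proof. by rewrite bchC bchNl bchC. Qed.

Lemma bchMnl u v n : chi (u *+ n) v = chi u v ^+ n.
Proof. by elim: n => [|n IH]; rewrite ?bch0l // mulrS bchDl IH exprS. Qed.

Lemma bchMnr u v n : chi u (v *+ n) = chi u v ^+ n.
Proof. by rewrite bchC bchMnl bchC. Qed.

End Bichar.

Section Weights.
Variables (V : zmodType) (I : Type) (a : I -> V).

Definition wgt (w : seq I) : V := \sum_(i <- w) a i.

Lemma wgt_nil : wgt [::] = 0. Proof. exact: big_nil. Qed.
Lemma wgt_cons i w : wgt (i :: w) = a i + wgt w. Proof. exact: big_cons. Qed.
Lemma wgt_cat v w : wgt (v ++ w) = wgt v + wgt w. Proof. exact: big_cat. Qed.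
Lemma wgt_nseq n i : wgt (nseq n i) = a i *+ n.
Proof. by elim: n => [|n IH] /=; rewrite ?wgt_nil // wgt_cons IH mulrS. Qed.

End Weights.

(* A function on words stands for a possibly infinite combination of words;
   the shuffle product is computed from the first letters. *)
Definition sha (K : fieldType) (V : zmodType) (chi : bichar K V) (I : finType)
  (a : I -> V) := seq I -> K.

Section Shuffle.
Variables (K : fieldType) (V : zmodType) (chi : bichar K V) (I : finType) (a : I -> V).
Notation S := (sha chi a).

HB.instance Definition _ := gen_eqMixin S.
HB.instance Definition _ := gen_choiceMixin S.

Lemma shaP (x y : S) : (forall w, x w = y w) -> x = y.
Proof. by move=> h; apply: functional_extensionality_dep. Qed.

Definition sha_zero : S := fun _ => 0.
Definition sha_add (x y : S) : S := fun w => x w + y w.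
Definition sha_opp (x : S) : S := fun w => - x w.

Fact sha_addA : associative sha_add.
Proof. by move=> x y z; apply: shaP => w; rewrite /sha_add addrA. Qed.
Fact sha_addC : commutative sha_add.
Proof. by move=> x y; apply: shaP => w; rewrite /sha_add addrC. Qed.
Fact sha_add0 : left_id sha_zero sha_add.
Proof. by move=> x; apply: shaP => w; rewrite /sha_add add0r. Qed.
Fact sha_addN : left_inverse sha_zero sha_opp sha_add.
Proof. by move=> x; apply: shaP => w; rewrite /sha_add addNr. Qed.

HB.instance Definition _ := GRing.isZmodule.Build S sha_addA sha_addC sha_add0 sha_addN.

Definition sha_scale (c : K) (x : S) : S := fun w => c * x w.
Fact sha_scaleA c d x : sha_scale c (sha_scale d x) = sha_scale (c * d) x.
Proof. by apply: shaP => w; rewrite /sha_scale mulrA. Qed.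
Fact sha_scale1 : left_id 1 sha_scale.
Proof. by move=> x; apply: shaP => w; rewrite /sha_scale mul1r. Qed.
Fact sha_scaleDr : right_distributive sha_scale +%R.
Proof. by move=> c x y; apply: shaP => w; rewrite /sha_scale mulrDr. Qed.
Fact sha_scaleDl x : {morph sha_scale^~ x : c d / c + d}.
Proof. by move=> c d; apply: shaP => w; rewrite /sha_scale mulrDl. Qed.

HB.instance Definition _ := GRing.Zmodule_isLmodule.Build K S
  sha_scaleA sha_scale1 sha_scaleDr sha_scaleDl.

Lemma shaDE (x y : S) w : (x + y) w = x w + y w. Proof. by []. Qed.
Lemma shaNE (x : S) w : (- x) w = - x w. Proof. by []. Qed.
Lemma shaZE c (x : S) w : (c *: x) w = c * x w. Proof. by []. Qed.
Lemma sha0E w : (0 : S) w = 0. Proof. by []. Qed.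

Definition Lop (i : I) (x : S) : S := fun w => x (i :: w).
Definition tw (v : V) (x : S) : S := fun w => chi v (wgt a w) * x w.
Definition prj (g : V) (x : S) : S := fun w => if wgt a w == g then x w else 0.

Fact Lop_lin i : linear (Lop i). Proof. by []. Qed.
HB.instance Definition _ i := GRing.isLinear.Build K S S _ (Lop i) (Lop_lin i).
Lemma LopD i (x y : S) : Lop i (x + y) = Lop i x + Lop i y. Proof. by []. Qed.
Lemma LopZ i c (x : S) : Lop i (c *: x) = c *: Lop i x. Proof. by []. Qed.
Lemma LopB i (x y : S) : Lop i (x - y) = Lop i x - Lop i y. Proof. by []. Qed.
Fact tw_lin v : linear (tw v).
Proof.
move=> c x y; apply: shaP => w.
by rewrite /tw !(shaDE, shaZE) mulrDr mulrCA.
Qed.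
HB.instance Definition _ v := GRing.isLinear.Build K S S _ (tw v) (tw_lin v).
Fact prj_lin g : linear (prj g).
Proof.
move=> c x y; apply: shaP => w.
by rewrite !(shaDE, shaZE) /prj; case: eqP => _ //; rewrite mulr0 addr0.
Qed.
HB.instance Definition _ g := GRing.isLinear.Build K S S _ (prj g) (prj_lin g).

Lemma tw0 x : tw 0 x = x.
Proof. by apply: shaP => w; rewrite /tw bch0l mul1r. Qed.
Lemma twD u v x : tw (u + v) x = tw u (tw v x).
Proof. by apply: shaP => w; rewrite /tw bchDl mulrA. Qed.
Lemma twNK v x : tw v (tw (- v) x) = x.
Proof. by rewrite -twD subrr tw0. Qed.
Lemma twKN v x : tw (- v) (tw v x) = x.
Proof. by rewrite -twD addNr tw0. Qed.
Lemma twC u v x : tw u (tw v x) = tw v (tw u x).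
Proof. by rewrite -!twD addrC. Qed.

Lemma Lop_tw i v x : Lop i (tw v x) = chi v (a i) *: tw v (Lop i x).
Proof. by apply: shaP => w; rewrite shaZE /Lop /tw wgt_cons bchDr mulrA. Qed.

Lemma Lop_prj i g x : Lop i (prj g x) = prj (g - a i) (Lop i x).
Proof.
apply: shaP => w; rewrite /Lop /prj wgt_cons.
by rewrite [wgt a w == _]eq_sym subr_eq eq_sym addrC.
Qed.

Fixpoint sha_mul_rec (w : seq I) (x y : S) : K :=
  if w is i :: w' then sha_mul_rec w' (Lop i x) (tw (a i) y) + sha_mul_rec w' x (Lop i y)
  else x [::] * y [::].
Definition sha_mul (x y : S) : S := fun w => sha_mul_rec w x y.
Definition sha_one : S := fun w => (w == [::])%:R.

Lemma sha_mul_nil x y : sha_mul x y [::] = x [::] * y [::]. Proof. by []. Qed.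
Lemma sha_mul_cons x y i w :
  sha_mul x y (i :: w) = sha_mul (Lop i x) (tw (a i) y) w + sha_mul x (Lop i y) w.
Proof. by []. Qed.

Lemma Lop_sha_mul i x y :
  Lop i (sha_mul x y) = sha_mul (Lop i x) (tw (a i) y) + sha_mul x (Lop i y).
Proof. by []. Qed.

Fact sha_mulDl : left_distributive sha_mul +%R.
Proof.
move=> x y z; apply: shaP => w; elim: w x y z => [|i w IH] x y z.
  by rewrite !shaDE !sha_mul_nil mulrDl.
rewrite shaDE !sha_mul_cons raddfD !IH !shaDE; ring.
Qed.
Fact sha_mulDr : right_distributive sha_mul +%R.
Proof.
move=> x y z; apply: shaP => w; elim: w x y z => [|i w IH] x y z.
  by rewrite !shaDE !sha_mul_nil mulrDr.
rewrite shaDE !sha_mul_cons !raddfD !IH !shaDE; ring.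
Qed.
Lemma sha_mulZl c x y : sha_mul (c *: x) y = c *: sha_mul x y.
Proof.
apply: shaP => w; elim: w x y => [|i w IH] x y.
  by rewrite !shaZE !sha_mul_nil mulrA.
by rewrite shaZE !sha_mul_cons linearZ !IH !shaZE mulrDr.
Qed.
Lemma sha_mulZr c x y : sha_mul x (c *: y) = c *: sha_mul x y.
Proof.
apply: shaP => w; elim: w x y => [|i w IH] x y.
  by rewrite !shaZE !sha_mul_nil mulrCA.
by rewrite shaZE !sha_mul_cons !linearZ !IH !shaZE mulrDr.
Qed.
(** The twist is an algebra automorphism; this is exactly what associativity needs, because the
    Leibniz rule of a first-letter derivation twists the right factor. *)
Lemma tw_sha_mul v x y : tw v (sha_mul x y) = sha_mul (tw v x) (tw v y).
Proof.
apply: shaP => w; elim: w x y v => [|i w IH] x y v.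
  by rewrite /tw !sha_mul_nil wgt_nil bch0r !mul1r.
rewrite sha_mul_cons !Lop_tw sha_mulZl sha_mulZr !shaZE [tw (a i) (tw v y)]twC -!IH.
by rewrite /tw sha_mul_cons wgt_cons bchDr; ring.
Qed.
Fact sha_mulA : associative sha_mul.
Proof.
move=> x y z; apply: shaP => w; elim: w x y z => [|i w IH] x y z.
  by rewrite !sha_mul_nil mulrA.
rewrite !sha_mul_cons Lop_sha_mul tw_sha_mul sha_mulDr sha_mulDl !shaDE !IH.
by rewrite addrA.
Qed.
Fact sha_mul1l : left_id sha_one sha_mul.
Proof.
move=> x; apply: shaP => w; elim: w x => [|i w IH] x.
  by rewrite sha_mul_nil mul1r.
rewrite sha_mul_cons IH.
have -> : Lop i sha_one = 0 by [].
by rewrite -[0](scale0r 0) sha_mulZl shaZE mul0r add0r.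
Qed.
Fact sha_mul1r : right_id sha_one sha_mul.
Proof.
move=> x; apply: shaP => w; elim: w x => [|i w IH] x.
  by rewrite sha_mul_nil mulr1.
rewrite sha_mul_cons.
have -> : Lop i sha_one = 0 by [].
have -> : tw (a i) sha_one = sha_one.
  apply: shaP => -[|j v]; rewrite /tw /sha_one ?wgt_nil ?bch0r ?mul1r //=.
  by rewrite mulr0.
by rewrite IH -[0](scale0r 0) sha_mulZr shaZE mul0r addr0.
Qed.
Fact sha_one_neq0 : sha_one != 0.
Proof.
apply/eqP => /(congr1 (fun x : S => x [::])) /eqP.
by rewrite sha0E /sha_one eqxx oner_eq0.
Qed.

HB.instance Definition _ := GRing.Zmodule_isNzRing.Build S
  sha_mulA sha_mul1l sha_mul1r sha_mulDl sha_mulDr sha_one_neq0.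
HB.instance Definition _ := GRing.Lmodule_isLalgebra.Build K S
  (fun c x y => esym (sha_mulZl c x y)).
HB.instance Definition _ := GRing.Lalgebra_isAlgebra.Build K S
  (fun c x y => esym (sha_mulZr c x y)).

Implicit Types x y z : S.

Lemma shaM_nil x y : (x * y) [::] = x [::] * y [::]. Proof. by []. Qed.
Lemma LopM i x y : Lop i (x * y) = Lop i x * tw (a i) y + x * Lop i y.
Proof. by []. Qed.
Lemma twM v x y : tw v (x * y) = tw v x * tw v y.
Proof. exact: tw_sha_mul. Qed.
Lemma sha1_nil : (1 : S) [::] = 1. Proof. by []. Qed.
Lemma Lop1 i : Lop i 1 = 0. Proof. by []. Qed.
Lemma tw1 v : tw v 1 = 1.
Proof.
apply: shaP => -[|j w]; rewrite /tw ?wgt_nil ?bch0r ?mul1r //.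
exact: mulr0.
Qed.

Lemma sha_ext x y : x [::] = y [::] -> (forall i, Lop i x = Lop i y) -> x = y.
Proof.
move=> h0 h; apply: shaP => -[|i w] //.
by have := congr1 (fun z : S => z w) (h i).
Qed.

Definition dl (v : seq I) : S := fun w => (w == v)%:R.

Lemma dl_nil : dl [::] = 1. Proof. by []. Qed.
Lemma dlE v w : dl v w = (w == v)%:R. Proof. by []. Qed.
Lemma Lop_dl i j v : Lop i (dl (j :: v)) = (i == j)%:R *: dl v.
Proof.
apply: shaP => w; rewrite shaZE /Lop !dlE eqseq_cons.
by case: eqP; rewrite ?mul1r ?mul0r.
Qed.
Lemma tw_dl v w : tw v (dl w) = chi v (wgt a w) *: dl w.
Proof.
apply: shaP => u; rewrite shaZE /tw dlE.
by case: eqP => [->|]; rewrite ?mulr1 ?mulr0.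
Qed.

Definition hom (g : V) x := forall w, x w != 0 -> wgt a w = g.

Lemma hom0 g : hom g 0. Proof. by move=> w; rewrite sha0E eqxx. Qed.
Lemma hom1 : hom 0 1.
Proof. by move=> [|j w]; [rewrite wgt_nil | rewrite eqxx]. Qed.
Lemma homZ g c x : hom g x -> hom g (c *: x).
Proof. by move=> h w; rewrite shaZE mulf_eq0 negb_or => /andP[_ /h]. Qed.
Lemma homD g x y : hom g x -> hom g y -> hom g (x + y).
Proof.
move=> hx hy w; rewrite shaDE.
have [x0|/hx//] := eqVneq (x w) 0.
by rewrite x0 add0r => /hy.
Qed.
Lemma homN g x : hom g x -> hom g (- x).
Proof. by move=> h; rewrite -scaleN1r; apply: homZ. Qed.
Lemma homB g x y : hom g x -> hom g y -> hom g (x - y).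
Proof. by move=> hx hy; apply: homD (homN hy). Qed.
Lemma hom_tw g v x : hom g x -> tw v x = chi v g *: x.
Proof.
move=> h; apply: shaP => w; rewrite shaZE /tw.
by have [->|/h ->] := eqVneq (x w) 0; rewrite ?mulr0.
Qed.
Lemma hom_Lop g i x : hom g x -> hom (g - a i) (Lop i x).
Proof. by move=> h w /h; rewrite wgt_cons => <-; rewrite addrC addKr. Qed.
Arguments hom_Lop [g] i [x].
Lemma hom_dl w : hom (wgt a w) (dl w).
Proof. by move=> u; rewrite dlE; have [->|_] := eqVneq u w; rewrite // eqxx. Qed.
Lemma hom_prj g x : hom g (prj g x).
Proof. by move=> w; rewrite /prj; have [->|_] := eqVneq (wgt a w) g; rewrite // eqxx. Qed.
Lemma hom_prjE g x : hom g x -> prj g x = x.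
Proof.
move=> h; apply: shaP => w; rewrite /prj; case: eqP => // ne.
by have [->|/h] := eqVneq (x w) 0.
Qed.
Lemma hom_prj0 g g' x : hom g x -> g != g' -> prj g' x = 0.
Proof.
move=> h ne; apply: shaP => w; rewrite /prj; case: eqP => // e.
by have [->|/h e'] := eqVneq (x w) 0; rewrite // -e -e' eqxx in ne.
Qed.
Lemma homE0 g x w : hom g x -> wgt a w != g -> x w = 0.
Proof. by move=> h; apply: contra_neq_eq => /h. Qed.

Lemma homM g g' x y : hom g x -> hom g' y -> hom (g + g') (x * y).
Proof.
move=> hx hy w; elim: w g g' x y hx hy => [|i w IH] g g' x y hx hy.
  by rewrite shaM_nil mulf_eq0 negb_or => /andP[/hx <- /hy <-]; rewrite wgt_nil addr0.
rewrite wgt_cons -[(x * y) (i :: w)]/(Lop i (x * y) w) LopM (hom_tw _ hy) shaDE.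
rewrite -scalerAr shaZE.
have [e0|ne0] := eqVneq ((Lop i x * y) w) 0.
  rewrite e0 mulr0 add0r => /(IH _ _ _ _ hx (hom_Lop i hy)) ->.
  by rewrite addrCA [a i + _]addrC subrK.
move=> _; rewrite (IH _ _ _ _ (hom_Lop i hx) hy ne0).
by rewrite addrA [a i + _]addrC subrK.
Qed.

(** Only the left factor has to be homogeneous, so generators can be pulled out of a projection
    although y may have infinitely many weights. *)
Lemma prjM g h x y : hom g x -> prj h (x * y) = x * prj (h - g) y.
Proof.
move=> hx; apply: shaP => w; elim: w g h x y hx => [|i w IH] g h x y hx.
  have [x0|x0] := eqVneq (x [::]) 0.
    by rewrite /prj !shaM_nil x0 !mul0r; case: ifP.
  rewrite /prj !shaM_nil -(hx _ x0) wgt_nil subr0.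
  by case: ifP => // _; rewrite mulr0.
have Lc z : z (i :: w) = Lop i z w by [].
rewrite !Lc Lop_prj !LopM [prj _ (_ + _)]raddfD /= !shaDE Lop_prj.
rewrite (IH _ _ _ _ (hom_Lop i hx)) (IH _ _ _ _ hx) opprB addrA subrK.
rewrite [h - a i - g]addrAC; congr (_ + _).
suff -> : prj (h - g) (tw (a i) y) = tw (a i) (prj (h - g) y) by [].
apply: shaP => u.
by rewrite /prj /tw /prj; case: eqP => //; rewrite mulr0.
Qed.

Definition Lw (w : seq I) x : S := fun u => x (w ++ u).
Fact Lw_lin w : linear (Lw w). Proof. by []. Qed.
HB.instance Definition _ w := GRing.isLinear.Build K S S _ (Lw w) (Lw_lin w).
Lemma Lw_nil x : Lw [::] x = x. Proof. by []. Qed.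
Lemma Lw_cons i w x : Lw (i :: w) x = Lw w (Lop i x). Proof. by []. Qed.
Lemma Lw_cat v w x : Lw (v ++ w) x = Lw w (Lw v x).
Proof. by apply: shaP => u; rewrite /Lw catA. Qed.

End Shuffle.

(** * Generated subalgebras and left-coideal subalgebras *)

Section Generated.
Variables (K : fieldType) (V : zmodType) (chi : bichar K V) (I : finType) (a : I -> V).
Notation S := (sha chi a).
Implicit Types (x y g : S) (P : S -> Prop).

(** Closure under left multiplication by generators only, so that an induction meets one generator
    at a time; [agenM] recovers arbitrary products. *)
Inductive agen P : S -> Prop :=
| agen1 : agen P 1
| agenD x y : agen P x -> agen P y -> agen P (x + y)
| agenZ c x : agen P x -> agen P (c *: x)
| agenMl g x : P g -> agen P x -> agen P (g * x).

Lemma agen0 P : agen P 0.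
Proof. by rewrite -(scale0r 1); apply/agenZ/agen1. Qed.
Lemma agenN P x : agen P x -> agen P (- x).
Proof. by rewrite -scaleN1r; apply: agenZ. Qed.
Lemma agenB P x y : agen P x -> agen P y -> agen P (x - y).
Proof. by move=> hx /agenN; apply: agenD. Qed.
Lemma agen_gen P g : P g -> agen P g.
Proof. by move=> h; rewrite -(mulr1 g); apply: agenMl => //; apply: agen1. Qed.
Lemma agenM P x y : agen P x -> agen P y -> agen P (x * y).
Proof.
move=> hx hy; elim: hx => [|u v _ hu _ hv|c u _ hu|g u hg _ hu].
- by rewrite mul1r.
- by rewrite mulrDl; apply: agenD.
- by rewrite -scalerAl; apply: agenZ.
- by rewrite -mulrA; apply: agenMl.
Qed.
Lemma agen_sub P Q x : (forall g, P g -> agen Q g) -> agen P x -> agen Q x.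
Proof.
move=> h; elim=> [|u v _ hu _ hv|c u _ hu|g u hg _ hu].
- exact: agen1.
- exact: agenD.
- exact: agenZ.
- by apply: agenM => //; apply: h.
Qed.

Definition homgen P := forall g, P g -> exists v, hom v g.

Lemma agen_tw P v x : homgen P -> agen P x -> agen P (tw v x).
Proof.
move=> hP; elim=> [|u w _ hu _ hw|c u _ hu|g u hg _ hu].
- by rewrite tw1; apply: agen1.
- by rewrite raddfD /=; apply: agenD.
- by rewrite linearZ /=; apply: agenZ.
- have [h hh] := hP _ hg; rewrite twM (hom_tw _ hh) -scalerAl.
  by apply: agenZ; apply: agenMl.
Qed.

Lemma agen_prj P v x : homgen P -> agen P x -> agen P (prj v x).
Proof.
move=> hP hx; elim: hx v => [|u w _ hu _ hw|c u _ hu|g u hg _ hu] v.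
- have [<-|ne] := eqVneq 0 v; first by rewrite (hom_prjE (@hom1 _ _ _ _ _)); apply: agen1.
  by rewrite (hom_prj0 (@hom1 _ _ _ _ _) ne); apply: agen0.
- by rewrite raddfD /=; apply: agenD.
- by rewrite linearZ /=; apply: agenZ.
- by have [h hh] := hP _ hg; rewrite (prjM _ _ hh); apply: agenMl.
Qed.

(** The Leibniz rule twists the right factor, and homogeneity of the generators keeps this twist
    inside the subalgebra; so it suffices to differentiate generators. *)
Lemma agen_Lop P i x : homgen P -> (forall g, P g -> agen P (Lop i g)) ->
  agen P x -> agen P (Lop i x).
Proof.
move=> hP hL; elim=> [|u w _ hu _ hw|c u _ hu|g u hg hgu hu].
- by rewrite Lop1; apply: agen0.
- by rewrite raddfD /=; apply: agenD.
- by rewrite linearZ /=; apply: agenZ.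
- rewrite LopM; apply: agenD; last exact: agenMl.
  by apply: agenM; [apply: hL | apply: agen_tw].
Qed.

Definition letter1 : S -> Prop := fun g => exists i, g = dl chi a [:: i].
Definition U := agen letter1.

Lemma letter1_hom : homgen letter1.
Proof. by move=> _ [i ->]; exists (wgt a [:: i]); apply: hom_dl. Qed.

Lemma U_letter i : U (dl chi a [:: i]).
Proof. by apply: agen_gen; exists i. Qed.

(* left-coideal subalgebras, graded by weight *)
Record coideal (E : S -> Prop) : Prop := Coideal {
  co1 : E 1;
  coD : forall x y, E x -> E y -> E (x + y);
  coZ : forall c x, E x -> E (c *: x);
  coM : forall x y, E x -> E y -> E (x * y);
  cotw : forall v x, E x -> E (tw v x);
  coprj : forall v x, E x -> E (prj v x);
  coL : forall i x, E x -> E (Lop i x) }.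

Lemma co0 E : coideal E -> E 0.
Proof. by move=> h; rewrite -(scale0r 1); apply/(coZ h)/(co1 h). Qed.
Lemma coB E x y : coideal E -> E x -> E y -> E (x - y).
Proof. by move=> h hx hy; rewrite -scaleN1r; apply: (coD h) => //; apply: coZ. Qed.
Lemma coLw E w x : coideal E -> E x -> E (Lw w x).
Proof. by move=> h; elim: w x => // i w IH x hx; rewrite Lw_cons; apply: IH; apply: coL. Qed.

Lemma agen_coideal P : homgen P -> (forall i g, P g -> agen P (Lop i g)) ->
  coideal (agen P).
Proof.
move=> hP hL; split.
- exact: agen1.
- exact: agenD.
- exact: agenZ.
- exact: agenM.
- by move=> *; apply: agen_tw.
- by move=> *; apply: agen_prj.
- by move=> i x; apply: agen_Lop => // g; apply: hL.
Qed.

Lemma U_coideal : coideal U.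
Proof.
apply: agen_coideal letter1_hom _ => i _ [j ->].
by rewrite Lop_dl; apply/agenZ/agen1.
Qed.

End Generated.

(** * Reflections of left-coideal subalgebras *)

Definition qn (K : fieldType) (c : K) (n : nat) : K := \sum_(k < n) c ^+ k.

Lemma qn0 (K : fieldType) (c : K) : qn c 0 = 0. Proof. exact: big_ord0. Qed.
Lemma qnS (K : fieldType) (c : K) n : qn c n.+1 = 1 + c * qn c n.
Proof.
rewrite /qn big_ord_recl expr0 mulr_sumr; congr (_ + _).
by apply: eq_bigr => i _; rewrite -exprS.
Qed.
Lemma qnSr (K : fieldType) (c : K) n : qn c n.+1 = qn c n + c ^+ n.
Proof. exact: big_ord_recr. Qed.

Section Reflection.
Variables (K : fieldType) (V : zmodType) (chi : bichar K V) (I : finType) (a : I -> V).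
Variables (p : I) (M : I -> nat).
Notation S := (sha chi a).
Implicit Types (x y : S).

(** Up to a unit, the factor with which [skew_comm] sends the block $x_ix_p^m$ to $x_ix_p^{m+1}$
    (see [Aop_blk]). Its first zero is the multiple of $a_p$ that the reflection adds to $a_i$. *)
Definition serre_coef (i : I) (m : nat) : K :=
  qn (chi (a p) (a p)) m.+1 * (chi (a p) (a p) ^+ m * chi (a p) (a i) ^+ 2 - 1).

Definition refl_base (i : I) : V := if i == p then - a p else a i + a p *+ M i.

Hypothesis lam_neq0 : forall i m, i != p -> (m < M i)%N -> serre_coef i m != 0.
Hypothesis lam_eq0 : forall i, i != p -> serre_coef i (M i) = 0.

Let c := chi (a p) (a p).
Let xp : S := dl chi a [:: p].
Let c0 : c != 0. Proof. exact: bch_neq0. Qed.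

(* On the subalgebra of the blocks x_i x_p^n this is the derivation attached to the new
   simple root -a_p. *)
Definition skew_comm x : S := x * xp - xp * tw (- a p) x.

Fact Aop_lin : linear skew_comm.
Proof.
move=> k x y; rewrite /skew_comm linearP mulrDl mulrDr -scalerAl -scalerAr scalerBr.
by rewrite opprD addrACA.
Qed.
HB.instance Definition _ := GRing.isLinear.Build K S S _ skew_comm Aop_lin.

Lemma Lop_xp : Lop p xp = 1.
Proof. by rewrite Lop_dl eqxx scale1r dl_nil. Qed.
Lemma Lop_xp0 i : i != p -> Lop i xp = 0.
Proof. by move=> /negPf ne; rewrite Lop_dl ne scale0r. Qed.
Lemma tw_xp v : tw v xp = chi v (a p) *: xp.
Proof. by rewrite tw_dl wgt_cons wgt_nil addr0. Qed.

Lemma AopM x y : skew_comm (x * y) = skew_comm x * tw (- a p) y + x * skew_comm y.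
Proof.
by rewrite /skew_comm twM mulrBl mulrBr !mulrA [RHS]addrC addrA subrK.
Qed.

Lemma Lop_mxp x : Lop p (x * xp) = c *: (Lop p x * xp) + x.
Proof. by rewrite LopM Lop_xp mulr1 tw_xp -scalerAr. Qed.
Lemma Lop_xpm x : Lop p (xp * x) = tw (a p) x + xp * Lop p x.
Proof. by rewrite LopM Lop_xp mul1r. Qed.

(** Differentiating the letter p in the two products gives x twice, with opposite signs; this
    cancellation dictates the twist by $-a_p$. *)
Lemma Aop_ker x : Lop p x = 0 -> Lop p (skew_comm x) = 0.
Proof.
move=> h; rewrite /skew_comm raddfB /= Lop_mxp Lop_xpm h mul0r scaler0 add0r twNK.
by rewrite Lop_tw h !raddf0 mulr0 addr0 subrr.
Qed.

Lemma Aop_tw v x : skew_comm (tw v x) = (chi v (a p))^-1 *: tw v (skew_comm x).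
Proof.
rewrite /skew_comm raddfB /= !twM tw_xp -scalerAr -scalerAl -scalerBr scalerA.
by rewrite mulVf ?bch_neq0 // scale1r [tw v (tw _ _)]twC.
Qed.

Lemma prj_mxp g x : prj g (x * xp) = prj (g - a p) x * xp.
Proof.
apply: shaP => w; elim: w g x => [|i w IH] g x.
  by rewrite /prj !shaM_nil !mulr0 if_same.
rewrite -[LHS]/(Lop i (prj g (x * xp)) w) Lop_prj LopM Lop_dl tw_xp -scalerAr -scalerAr.
rewrite [prj _ (_ + _)]raddfD /= shaDE linearZ /= shaZE IH.
rewrite -[RHS]/(Lop i (prj (g - a p) x * xp) w) LopM tw_xp Lop_dl -!scalerAr shaDE shaZE.
rewrite Lop_prj addrAC; congr (_ + _).
rewrite linearZ /= !shaZE; case: eqP => [->|]; last by rewrite !mul0r.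
by rewrite dl_nil !mulr1.
Qed.

Lemma Aop_prj g x : skew_comm (prj g x) = prj (g + a p) (skew_comm x).
Proof.
rewrite /skew_comm [prj _ (_ - _)]raddfB /= prj_mxp addrK.
rewrite (prjM _ _ (@hom_dl _ _ chi _ a [:: p])) wgt_cons wgt_nil addr0 addrK.
congr (_ - _ * _); apply: shaP => w.
by rewrite /tw /prj /tw; case: eqP => //; rewrite mulr0.
Qed.

(** The word $p^n$ plays the role of a divided power: $x_p^n=[n]!\,p^n$, and it makes sense even
    when the factorial vanishes. *)
Definition pw n : S := dl chi a (nseq n p).

Lemma Lop_pw n : Lop p (pw n.+1) = pw n.
Proof. by rewrite /pw /= Lop_dl eqxx scale1r. Qed.
Lemma Lop_pw0 i n : i != p -> Lop i (pw n) = 0.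
Proof. by move=> ne; case: n => [|n] //; rewrite /pw /= Lop_dl (negPf ne) scale0r. Qed.
Lemma tw_pw v n : tw v (pw n) = chi v (a p) ^+ n *: pw n.
Proof. by rewrite tw_dl wgt_nseq bchMnr. Qed.

Lemma pw_xp n : pw n * xp = qn c n.+1 *: pw n.+1.
Proof.
elim: n => [|n IH].
  by rewrite /pw dl_nil mul1r qnS qn0 mulr0 addr0 scale1r.
apply: sha_ext => [|i]; first by rewrite shaM_nil shaZE /pw /xp !dlE /= !(mulr0, mul0r).
have [->|ne] := eqVneq i p.
  rewrite Lop_mxp [Lop p (_ *: _)]linearZ /= !Lop_pw IH scalerA (qnS c n.+1) scalerDl scale1r.
  by rewrite addrC.
rewrite LopM [Lop i (_ *: _)]linearZ /= !Lop_pw0 // Lop_xp0 // mul0r mulr0.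
by rewrite add0r scaler0.
Qed.

Lemma xp_pw n : xp * pw n = qn c n.+1 *: pw n.+1.
Proof.
elim: n => [|n IH].
  by rewrite /pw dl_nil mulr1 qnS qn0 mulr0 addr0 scale1r.
apply: sha_ext => [|i]; first by rewrite shaM_nil shaZE /pw /xp !dlE /= !(mulr0, mul0r).
have [->|ne] := eqVneq i p.
  rewrite Lop_xpm [Lop p (_ *: _)]linearZ /= !Lop_pw IH tw_pw (qnSr c n.+1) scalerDl.
  by rewrite addrC.
rewrite LopM [Lop i (_ *: _)]linearZ /= !Lop_pw0 // Lop_xp0 // mul0r mulr0.
by rewrite add0r scaler0.
Qed.

Lemma Aop_blk i n : i != p ->
  skew_comm (dl chi a (i :: nseq n p)) =
  (serre_coef i n / (chi (a p) (a i) * c ^+ n)) *: dl chi a (i :: nseq n.+1 p).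
Proof.
move=> ne; apply: sha_ext => [|j].
  by rewrite /skew_comm shaDE shaNE !shaM_nil !dlE /= !(mulr0, mul0r) subr0 shaZE mulr0.
have [->|nej] := eqVneq j p.
  rewrite Aop_ker ?Lop_dl; last by rewrite eq_sym (negPf ne) scale0r.
  by rewrite linearZ /= Lop_dl eq_sym (negPf ne) scale0r scaler0.
rewrite /skew_comm raddfB /= !LopM !Lop_xp0 // mulr0 mul0r addr0 add0r Lop_tw linearZ /=.
rewrite !Lop_dl; case: (eqVneq j i) => [->|_]; last first.
  by rewrite !scale0r raddf0 scaler0 mul0r mulr0 subr0 scaler0.
rewrite !scale1r tw_xp tw_dl -!scalerAr -[dl _ _ (nseq n p)]/(pw n) pw_xp xp_pw.
rewrite !scalerA -scalerBl; congr (_ *: _).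
rewrite wgt_nseq !bchNl bchMnr -/c [chi (a i) _]bchC /serre_coef -/c.
have := bch_neq0 chi (a p) (a i); have : c ^+ n != 0 by rewrite expf_neq0.
move: (chi _ _) (c ^+ n) => u v hv hu; field.
by rewrite hu hv.
Qed.

(** The subalgebra generated by these blocks is killed by $L_p$ and contains every element of [U]
    with that property ([G_ker], [U_ker]). *)
Definition blk : S -> Prop :=
  fun g => exists i n, [/\ i != p, (n <= M i)%N & g = dl chi a (i :: nseq n p)].
Notation G := (agen blk).

Lemma blk_hom : homgen blk.
Proof. by move=> _ [i [n [_ _ ->]]]; eexists; apply: hom_dl. Qed.

Lemma G_ker x : G x -> Lop p x = 0.
Proof.
elim=> [|u v _ hu _ hv|k u _ hu|g u [i [n [ne _ ->]]] _ hu].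
- exact: Lop1.
- by rewrite raddfD /= hu hv addr0.
- by rewrite linearZ /= hu scaler0.
- by rewrite LopM hu mulr0 Lop_dl eq_sym (negPf ne) scale0r mul0r addr0.
Qed.

Lemma G_Aop x : G x -> G (skew_comm x).
Proof.
elim=> [|u v _ hu _ hv|k u _ hu|g u hg hGu hu].
- by rewrite /skew_comm tw1 mul1r mulr1 subrr; apply: agen0.
- by rewrite raddfD /=; apply: agenD.
- by rewrite linearZ /=; apply: agenZ.
- rewrite AopM; apply: agenD; last exact: agenMl.
  apply: agenM; last by apply: agen_tw => //; apply: blk_hom.
  have [i [n [ne le ->]]] := hg; rewrite Aop_blk //.
  move: le; rewrite leq_eqVlt => /predU1P[->|lt].
    by rewrite lam_eq0 // mul0r scale0r; apply: agen0.
  by apply/agenZ/agen_gen; exists i, n.+1.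
Qed.

Lemma Lw_p_Ml m x y : Lop p y = 0 ->
  Lw (nseq m p) (x * y) = Lw (nseq m p) x * tw (a p *+ m) y.
Proof.
move=> hy; elim: m x y hy => [|m IH] x y hy; first by rewrite tw0.
rewrite /= !Lw_cons LopM hy mulr0 addr0 IH; last by rewrite Lop_tw hy linear0 scaler0.
by rewrite -twD mulrSr.
Qed.
Lemma Lw_p_Mr m x y : Lop p x = 0 ->
  Lw (nseq m p) (x * y) = x * Lw (nseq m p) y.
Proof.
move=> hx; elim: m x y hx => [|m IH] x y hx //.
by rewrite /= !Lw_cons LopM hx mul0r add0r IH.
Qed.

(** An iterated derivation obeys a Leibniz rule here because, after $L_i$ has acted on one of the
    factors, the operators $L_p$ can only act on that same factor, the other being killed by
    $L_p$. *)
Lemma Lw_blkM i m x y : Lop p x = 0 -> Lop p y = 0 ->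
  Lw (i :: nseq m p) (x * y) =
  Lw (i :: nseq m p) x * tw (a i + a p *+ m) y + x * Lw (i :: nseq m p) y.
Proof.
move=> hx hy; rewrite !Lw_cons LopM [Lw _ (_ + _)]raddfD /=.
rewrite Lw_p_Ml ?Lw_p_Mr //; last by rewrite Lop_tw hy linear0 scaler0.
by rewrite -twD addrC [_ *+ _ + _]addrC addrC.
Qed.

Lemma Lw_blk_dl i m j n : j != p ->
  Lw (i :: nseq m p) (dl chi a (j :: nseq n p)) =
  ((i == j) && (m <= n)%N)%:R *: pw (n - m).
Proof.
move=> ne; rewrite Lw_cons Lop_dl linearZ /=; case: eqVneq => _; last by rewrite !scale0r.
rewrite scale1r /=; elim: m n => [|m IH] n; first by rewrite subn0 scale1r.
case: n => [|n]; last by rewrite /= Lw_cons Lop_dl eqxx scale1r IH.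
rewrite scale0r Lw_cons; have -> : Lop p (dl chi a (nseq 0 p)) = 0 by [].
by rewrite linear0.
Qed.

Lemma Lw_blk_G0 i m x : G x -> (M i < m)%N -> Lw (i :: nseq m p) x = 0.
Proof.
move=> hx lt; elim: hx => [|u v _ hu _ hv|k u _ hu|g u [j [n [ne le ->]]] hu IH].
- by rewrite Lw_cons Lop1 linear0.
- by rewrite raddfD /= hu hv addr0.
- by rewrite linearZ /= hu scaler0.
- rewrite Lw_blkM ?(G_ker hu) ?Lop_dl 1?eq_sym ?(negPf ne) ?scale0r //.
  rewrite IH mulr0 addr0 Lw_blk_dl //.
  case: eqVneq => [e|_]; last by rewrite scale0r mul0r.
  by rewrite -e in le; rewrite leqNgt (leq_ltn_trans le lt) scale0r mul0r.
Qed.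

(** On a generator the operator removes the whole block $i\,p^{M_i}$ and leaves a scalar, or it asks
    for more letters p than the block has. *)
Lemma G_Lw i x : i != p -> G x -> G (Lw (i :: nseq (M i) p) x).
Proof.
move=> nei; elim=> [|u v _ hu _ hv|k u _ hu|g u hg hu IH].
- by rewrite Lw_cons Lop1 linear0; apply: agen0.
- by rewrite raddfD /=; apply: agenD.
- by rewrite linearZ /=; apply: agenZ.
have hkg := G_ker (agen_gen hg); rewrite Lw_blkM ?(G_ker hu) //.
apply: agenD; last by apply: agenMl.
apply: agenM; last by apply: agen_tw => //; apply: blk_hom.
have [j [n [ne le ->]]] := hg.
rewrite Lw_blk_dl //; case: eqVneq => [e|_]; last by rewrite scale0r; apply: agen0.
rewrite -{}e in le *; case: leqP => [ge|_]; last by rewrite scale0r; apply: agen0.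
have -> : n = M i by apply/eqP; rewrite eqn_leq le.
by rewrite subnn scale1r; apply: agen1.
Qed.

End Reflection.

(** * Blocks with the letters p in front *)

Section RightBlocks.
Variables (K : fieldType) (V : zmodType) (chi : bichar K V) (I : finType) (a : I -> V).
Variables (p i : I).
Hypothesis ne : i != p.
Notation S := (sha chi a).
Let c := chi (a p) (a p).
Let d := chi (a p) (a i).
Let xp : S := dl chi a [:: p].
Definition rblk n : S := dl chi a (nseq n p ++ [:: i]).

Lemma tw_rblk v n : tw v (rblk n) = (chi v (a p) ^+ n * chi v (a i)) *: rblk n.
Proof. by rewrite tw_dl wgt_cat wgt_nseq wgt_cons wgt_nil addr0 bchDr bchMnr. Qed.

Lemma xp_rblk n :
  xp * rblk n = dl chi a (nseq n p ++ [:: i; p]) + (d * qn c n.+1) *: rblk n.+1.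
Proof.
have nep : (p == i) = false by rewrite eq_sym; apply: negPf.
elim: n => [|n IH]; apply: sha_ext => [|j].
- by rewrite shaM_nil shaDE shaZE !dlE /= !(mulr0, mul0r, addr0).
- rewrite LopM /rblk /xp LopD LopZ /= !Lop_dl.
  have [->|nj] := eqVneq j p.
    rewrite nep !(scale0r, mulr0) addr0 !scale1r dl_nil mul1r tw_dl add0r wgt_cons wgt_nil addr0.
    by rewrite qnS qn0 mulr0 addr0 mulr1.
  rewrite scale0r mul0r add0r scale0r scaler0 addr0.
  by case: eqP => _; rewrite ?scale1r ?scale0r ?dl_nil ?mulr1 ?mulr0.
- by rewrite shaM_nil shaDE shaZE !dlE /= !(mulr0, mul0r, addr0).
rewrite LopM /rblk /xp LopD LopZ /= !Lop_dl.
have [->|nj] := eqVneq j p; last by rewrite !(scale0r, mul0r, mulr0, scaler0).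
rewrite !scale1r dl_nil mul1r -[dl _ _ (nseq n p ++ [:: i])]/(rblk n) IH.
rewrite -[dl _ _ (p :: nseq n p ++ [:: i])]/(rblk n.+1) tw_rblk.
rewrite -/c -/d (qnSr c n.+1) mulrDr scalerDl [c ^+ _ * d]mulrC addrCA.
by congr (_ + _); rewrite addrC.
Qed.

Lemma rblk_xp n :
  rblk n * xp = (d * c ^+ n) *: dl chi a (nseq n p ++ [:: i; p]) + qn c n.+1 *: rblk n.+1.
Proof.
have nep : (p == i) = false by rewrite eq_sym; apply: negPf.
elim: n => [|n IH]; apply: sha_ext => [|j].
- by rewrite shaM_nil shaDE !shaZE !dlE /= !(mulr0, mul0r, addr0).
- rewrite LopM /rblk /xp LopD !LopZ /= !Lop_dl.
  rewrite tw_dl wgt_cons wgt_nil addr0.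
  have [->|nj] := eqVneq j p.
    rewrite nep !(scale0r, mul0r, scaler0, add0r) !scale1r dl_nil mulr1.
    by rewrite qnS qn0 mulr0 addr0 scale1r.
  rewrite !(scale0r, mulr0, scaler0, addr0).
  case: eqP => [->|_]; rewrite ?scale0r ?mul0r ?scaler0 // !scale1r dl_nil mul1r.
  by rewrite expr0 mulr1 bchC.
- by rewrite shaM_nil shaDE !shaZE !dlE /= !(mulr0, mul0r, addr0).
rewrite LopM /rblk /xp LopD !LopZ /= !Lop_dl.
have [->|nj] := eqVneq j p; last by rewrite !(scale0r, mul0r, mulr0, scaler0, addr0).
rewrite !scale1r dl_nil mulr1 -[dl _ _ (nseq n p ++ [:: i])]/(rblk n) tw_dl -scalerAr IH.
rewrite -[dl _ _ (p :: nseq n p ++ [:: i])]/(rblk n.+1).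
rewrite wgt_cons wgt_nil addr0 -/c (qnS c n.+1) scalerDl scale1r scalerDr !scalerA.
rewrite [c * (d * _)]mulrCA -exprS -addrA; congr (_ + _).
by rewrite addrC.
Qed.

(** Eliminating the word $p^n\,i\,p$ between $x_p(p^ni)$ and $(p^ni)x_p$ leaves a nonzero multiple
    of $p^{n+1}i$. *)
Lemma U_rblk m : (forall n, (n < m)%N -> qn c n.+1 * (c ^+ n * d ^+ 2 - 1) != 0) ->
  U (rblk m).
Proof.
elim: m => [|m IH] h; first exact: U_letter.
have hm : U (rblk m) by apply: IH => n lt; apply: h; apply: ltnW.
have c0 : c ^+ m != 0 by rewrite expf_neq0 // bch_neq0.
have d0 : d != 0 by apply: bch_neq0.
have e : xp * rblk m - (d * c ^+ m)^-1 *: (rblk m * xp)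
   = (qn c m.+1 * (c ^+ m * d ^+ 2 - 1) / (d * c ^+ m)) *: rblk m.+1.
  rewrite xp_rblk rblk_xp scalerDr scalerA mulVf ?mulf_neq0 // scale1r opprD addrACA subrr add0r.
  rewrite scalerA -scalerBl; congr (_ *: _); field.
  by rewrite c0 d0.
have hn : qn c m.+1 * (c ^+ m * d ^+ 2 - 1) / (d * c ^+ m) != 0.
  by rewrite mulf_neq0 ?h // invr_eq0 mulf_neq0.
rewrite -(scale1r (rblk m.+1)) -(mulVf hn) -scalerA -e; apply: agenZ.
apply: agenB; first by apply: agenM => //; apply: U_letter.
by apply: agenZ; apply: agenM => //; apply: U_letter.
Qed.

End RightBlocks.

(** * The inverse braid operator on the algebra of blocks *)

Section ReflectionMap.
Variables (K : fieldType) (V : zmodType) (chi : bichar K V) (I : finType) (a : I -> V).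
Variables (p : I) (M : I -> nat).
Notation S := (sha chi a).
Implicit Types (x y : S).
Notation lam := (serre_coef chi a p).
Notation refl := (refl_base a p M).
Notation S' := (sha chi refl).
Notation G := (agen (@blk K V chi I a p M)).
Notation Aop := (@skew_comm K V chi I a p).
Hypothesis lam_neq0 : forall i m, i != p -> (m < M i)%N -> lam i m != 0.
Hypothesis lam_eq0 : forall i, i != p -> lam i (M i) = 0.
Let c := chi (a p) (a p).
Let c0 : c != 0. Proof. exact: bch_neq0. Qed.

Lemma reflp : refl p = - a p. Proof. by rewrite /refl_base eqxx. Qed.
Lemma reflE i : i != p -> refl i = a i + a p *+ M i.
Proof. by move=> /negPf ne; rewrite /refl_base ne. Qed.

(** The derivations belonging to the reflected simple roots: they lower the weight by $-a_p$ and by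
    $a_i+M_ia_p$ respectively. *)
Definition refl_op i x : S := if i == p then Aop x else Lw (i :: nseq (M i) p) x.

Fact Dop_lin i : linear (refl_op i).
Proof. by move=> k x y; rewrite /refl_op; case: ifP => _; rewrite linearP. Qed.
HB.instance Definition _ i := GRing.isLinear.Build K S S _ (refl_op i) (Dop_lin i).

Lemma Lw_tw w v x : Lw w (tw v x) = chi v (wgt a w) *: tw v (Lw w x).
Proof.
elim: w x => [|i w IH] x; first by rewrite wgt_nil bch0r scale1r.
by rewrite !Lw_cons Lop_tw linearZ /= IH scalerA wgt_cons bchDr.
Qed.
Lemma Lw_prj w v x : Lw w (prj v x) = prj (v - wgt a w) (Lw w x).
Proof.
elim: w v x => [|i w IH] v x; first by rewrite wgt_nil subr0.
by rewrite !Lw_cons Lop_prj IH wgt_cons opprD addrA.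
Qed.

Lemma wgt_blk i : i != p -> wgt a (i :: nseq (M i) p) = refl i.
Proof. by move=> ne; rewrite wgt_cons wgt_nseq reflE. Qed.

Lemma Dop_tw i v x : refl_op i (tw v x) = chi v (refl i) *: tw v (refl_op i x).
Proof.
rewrite /refl_op; case: eqVneq => [->|ne]; last by rewrite Lw_tw wgt_blk.
by rewrite Aop_tw reflp bchNr.
Qed.

Lemma Dop_prj i v x : refl_op i (prj v x) = prj (v - refl i) (refl_op i x).
Proof.
rewrite /refl_op; case: eqVneq => [->|ne]; last by rewrite Lw_prj wgt_blk.
by rewrite Aop_prj reflp opprK.
Qed.

Lemma G_Dop i x : G x -> G (refl_op i x).
Proof. by rewrite /refl_op; case: eqVneq => [_|ne]; [apply: G_Aop | apply: G_Lw]. Qed.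

Lemma DopM i x y : G x -> G y -> refl_op i (x * y) = refl_op i x * tw (refl i) y + x * refl_op i y.
Proof.
move=> hx hy; rewrite /refl_op; case: eqVneq => [->|ne]; first by rewrite AopM reflp.
by rewrite Lw_blkM ?(G_ker hx) ?(G_ker hy) // reflE.
Qed.

(* The inverse braid operator: [Tm x] is the element over the reflected simple system whose
   derivatives are the [refl_op i x]. *)
Fixpoint Trec (w : seq I) x : K := if w is i :: w' then Trec w' (refl_op i x) else x [::].
Definition Tm x : S' := fun w => Trec w x.

Fact Tm_lin : linear Tm.
Proof.
move=> k x y; apply: shaP => w; rewrite shaDE shaZE /Tm.
by elim: w x y => [|i w IH] x y //=; rewrite linearP IH.
Qed.
HB.instance Definition _ := GRing.isLinear.Build K S S' _ Tm Tm_lin.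

Lemma Lop_Tm i x : Lop i (Tm x) = Tm (refl_op i x). Proof. by []. Qed.
Lemma Tm_nil x : Tm x [::] = x [::]. Proof. by []. Qed.

Lemma Tm_tw v x : Tm (tw v x) = tw v (Tm x).
Proof.
apply: shaP => w; elim: w x => [|i w IH] x.
  by rewrite Tm_nil /tw !wgt_nil.
rewrite -[LHS]/(Lop i (Tm (tw v x)) w) Lop_Tm Dop_tw linearZ /= shaZE IH.
by rewrite /tw wgt_cons bchDr mulrA.
Qed.

Lemma Tm_prj v x : Tm (prj v x) = prj v (Tm x).
Proof.
apply: shaP => w; elim: w v x => [|i w IH] v x.
  by rewrite Tm_nil /prj !wgt_nil.
rewrite -[LHS]/(Lop i (Tm (prj v x)) w) Lop_Tm Dop_prj IH.
by rewrite -[RHS]/(Lop i (prj v (Tm x)) w) Lop_prj.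
Qed.

Lemma Tm_hom v x : hom v x -> hom v (Tm x).
Proof. by move=> h; rewrite -(hom_prjE h) Tm_prj; apply: hom_prj. Qed.

(** On the algebra of blocks the operators [refl_op i] obey the Leibniz rule that first-letter
    derivations obey over the reflected base. *)
Lemma TmM x y : G x -> G y -> Tm (x * y) = Tm x * Tm y.
Proof.
move=> hx hy; apply: shaP => w; elim: w x y hx hy => [|i w IH] x y hx hy //.
rewrite -[LHS]/(Lop i (Tm (x * y)) w) Lop_Tm DopM // raddfD /= shaDE !IH //.
- by rewrite Tm_tw.
- exact: G_Dop.
- exact: G_Dop.
- by apply: agen_tw => //; apply: blk_hom.
Qed.

Lemma Tm1 : Tm 1 = 1.
Proof.
apply: sha_ext => // i; rewrite Lop_Tm [RHS]Lop1.
suff -> : refl_op i 1 = 0 by rewrite linear0.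
rewrite /refl_op; case: ifP => _; last by rewrite Lw_cons Lop1 linear0.
by rewrite /skew_comm tw1 mul1r mulr1 subrr.
Qed.

(** Descending induction from the full block, whose image is the letter i: [refl_op p] lengthens the
    block in the source and strips a leading p in the target. *)
Lemma Tm_blk i n m : i != p -> (n + m = M i)%N ->
  exists t, Tm (dl chi a (i :: nseq n p)) = t *: rblk chi refl p i m.
Proof.
move=> ne; elim: m n => [|m IH] n e.
  rewrite addn0 in e; rewrite {n}e.
  exists 1; rewrite scale1r; apply: sha_ext => [//|j].
  rewrite Lop_Tm /refl_op /rblk /= Lop_dl; have [->|nj] := eqVneq j p.
    rewrite Aop_blk // lam_eq0 // mul0r scale0r linear0.
    by rewrite eq_sym (negPf ne) scale0r.
  rewrite Lw_blk_dl //; case: eqVneq => [->|_] /=; last by rewrite !scale0r linear0.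
  by rewrite leqnn subnn !scale1r /pw Tm1 dl_nil.
have [t ht] := IH n.+1 (etrans (addSnnS _ _) e).
exists (lam i n / (chi (a p) (a i) * c ^+ n) * t); apply: sha_ext => [|j].
  by rewrite shaZE /rblk dlE /= mulr0.
rewrite Lop_Tm LopZ /rblk /= Lop_dl /refl_op; have [_|nj] := eqVneq j p.
  by rewrite Aop_blk // scale1r linearZ [LHS]/= ht scalerA.
rewrite Lw_blk_dl // scale0r scaler0; case: eqVneq => [->|_]; last by rewrite scale0r linear0.
by rewrite leqNgt -e -addSnnS ltnS leq_addr scale0r linear0.
Qed.

(* the reflected bicharacter has the same vanishing orders M i *)
Lemma lam_refl i n : i != p -> (n < M i)%N ->
  qn (chi (refl p) (refl p)) n.+1 *
    (chi (refl p) (refl p) ^+ n * chi (refl p) (refl i) ^+ 2 - 1) != 0.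
Proof.
move=> ne lt; rewrite reflp reflE // !(bchNl, bchNr) invrK -/c bchDr bchMnr -/c.
have := lam_neq0 ne lt; rewrite /serre_coef -/c mulf_eq0 negb_or => /andP[q0 _].
rewrite mulf_eq0 negb_or q0 /=.
set d := chi (a p) (a i); have d0 : d != 0 by apply: bch_neq0.
have cn k : c ^+ k != 0 by rewrite expf_neq0.
apply/negP => /eqP/subr0_eq e1.
have e : c ^+ n = d ^+ 2 * c ^+ M i * c ^+ M i.
  have := cn (M i); move: e1; move: (c ^+ n) (c ^+ M i) => u v e1 v0.
  rewrite -[RHS]mul1r -e1; field.
  by rewrite d0 v0.
have eM : (M i = n.+1 + (M i - n.+1))%N by rewrite subnKC.
(* The mirror index of n. If $[M_i+1]_c=0$, then $c^{M_i+1}=1$ and [e] yields $c^md^2=1$, against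
   nonvanishing at m. Otherwise $c^{M_i}d^2=1$, so $c^{m+1}=1$; as $[m+1]_c\ne0$ this forces $c=1$,
   then $d^2=1$, against nonvanishing at 0. *)
set m := (M i - n.+1)%N in eM.
have qgeo k : (1 - c) * qn c k = 1 - c ^+ k.
  elim: k => [|k IH]; first by rewrite qn0 mulr0 expr0 subrr.
  by rewrite qnSr mulrDr IH exprS; ring.
have lt' : (m < M i)%N by rewrite eM addSn ltnS leq_addl.
have := lam_eq0 ne; rewrite /serre_coef -/c -/d => /eqP; rewrite mulf_eq0 => /orP[/eqP q1|/eqP/subr0_eq e2].
  have cM : c ^+ (M i).+1 = 1.
    by have := qgeo (M i).+1; rewrite q1 mulr0 => /esym/subr0_eq.
  have := lam_neq0 ne lt'; rewrite /serre_coef -/c -/d mulf_eq0 negb_or => /andP[_ /eqP[]].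
  apply/eqP; rewrite subr_eq0; apply/eqP; rewrite -cM.
  have -> : d ^+ 2 = c ^+ n * (c ^+ 2).
    rewrite e; have -> : d ^+ 2 * c ^+ M i * c ^+ M i * c ^+ 2
      = d ^+ 2 * (c ^+ (M i).+1 * c ^+ (M i).+1) by rewrite !exprS; ring.
    by rewrite cM !mulr1.
  by rewrite -!exprD; congr (c ^+ _); rewrite eM; lia.
have cm : c ^+ m.+1 = 1.
  apply: (mulIf (cn n)); rewrite -exprD mul1r addSnnS addnC -eM e.
  by rewrite [d ^+ 2 * _]mulrC e2 mul1r.
have := lam_neq0 ne lt'; rewrite /serre_coef -/c mulf_eq0 negb_or => /andP[qm _].
have c1 : c = 1.
  have /eqP := qgeo m.+1; rewrite cm subrr mulf_eq0 (negPf qm) orbF subr_eq0.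
  by move=> /eqP.
have := lam_neq0 ne (leq_ltn_trans (leq0n n) lt).
by move: e2; rewrite /serre_coef -/c -/d c1 !expr1n !mul1r => ->; rewrite subrr mulr0 eqxx.
Qed.

End ReflectionMap.

(** * Expansion in powers of the letter p, and injectivity of the braid operator *)

Section Decomposition.
Variables (K : fieldType) (V : zmodType) (chi : bichar K V) (I : finType) (a : I -> V).
Variables (p : I) (M : I -> nat).
Notation S := (sha chi a).
Implicit Types (x y g : S).
Notation lam := (serre_coef chi a p).
Notation refl := (refl_base a p M).
Notation G := (agen (@blk K V chi I a p M)).
Notation Aop := (@skew_comm K V chi I a p).
Notation Tm := (@Tm K V chi I a p M).
Hypothesis lam_neq0 : forall i m, i != p -> (m < M i)%N -> lam i m != 0.
Hypothesis lam_eq0 : forall i, i != p -> lam i (M i) = 0.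
Let c := chi (a p) (a p).
Let c0 : c != 0. Proof. exact: bch_neq0. Qed.
Let xp : S := dl chi a [:: p].
Notation pw := (@pw K V chi I a p).

Lemma LwD w x y : Lw w (x + y) = Lw w x + Lw w y. Proof. by []. Qed.
Lemma LwZ w k x : Lw w (k *: x) = k *: Lw w x. Proof. by []. Qed.
Definition qfac n : K := \prod_(k < n) qn c k.+1.

Lemma expr_xp n : xp ^+ n = qfac n *: pw n.
Proof.
elim: n => [|n IH]; first by rewrite /qfac big_ord0 scale1r expr0.
by rewrite exprSr IH -scalerAl pw_xp scalerA /qfac big_ord_recr.
Qed.

Lemma Lw_pw n m : Lw (nseq n p) (pw m) = (n <= m)%N%:R *: pw (m - n).
Proof.
elim: n m => [|n IH] m; first by rewrite subn0 scale1r.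
case: m => [|m]; first by rewrite /= Lw_cons Lop1 linear0 scale0r.
by rewrite /= Lw_cons Lop_pw IH.
Qed.

Lemma hom_xp n : hom (a p *+ n) (xp ^+ n).
Proof. by rewrite expr_xp -wgt_nseq; apply/homZ/hom_dl. Qed.

(** Polynomials in $x_p$ of degree less than n, with left coefficients in the algebra of blocks. *)
Fixpoint Qn n x : Prop :=
  if n is m.+1 then exists g y, [/\ G g, Qn m y & x = g * xp ^+ m + y] else x = 0.

Lemma QnS n x : Qn n x -> Qn n.+1 x.
Proof. by move=> h; exists 0, x; split=> //; [apply: agen0 | rewrite mul0r add0r]. Qed.
Lemma Qn_le n m x : (n <= m)%N -> Qn n x -> Qn m x.
Proof. by move=> /subnK <-; elim: (m - n)%N => // k IH /IH; apply: QnS. Qed.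
Lemma QnD n x y : Qn n x -> Qn n y -> Qn n (x + y).
Proof.
elim: n x y => [|n IH] x y; first by move=> -> ->; rewrite /= addr0.
move=> [g [u [hg hu ->]]] [h [v [hh hv ->]]]; exists (g + h), (u + v); split.
- exact: agenD.
- exact: IH.
- by rewrite mulrDl addrACA.
Qed.
Lemma QnG n g x : G g -> Qn n x -> Qn n (g * x).
Proof.
move=> hg; elim: n x => [|n IH] x; first by move=> ->; rewrite /= mulr0.
move=> [h [u [hh hu ->]]]; exists (g * h), (g * u); split.
- exact: agenM.
- exact: IH.
- by rewrite mulrDr mulrA.
Qed.
(** A coefficient is moved to the left by $x_pg = g'x_p-\mathrm{skew\_comm}(g')$, where $g'$ is the
    twist of g by $a_p$. *)
Lemma Qn_xp n x : Qn n x -> Qn n.+1 (xp * x).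
Proof.
elim: n x => [|n IH] x; first by move=> ->; rewrite mulr0; apply: QnS.
move=> [g [u [hg hu ->]]].
have htw : G (tw (a p) g) by apply: agen_tw => //; apply: blk_hom.
exists (tw (a p) g), (- Aop (tw (a p) g) * xp ^+ n + xp * u); split => //.
  apply: QnD; last exact: IH.
  exists (- Aop (tw (a p) g)), 0; split; rewrite ?addr0 //.
    by apply/agenN/G_Aop.
  by elim: n {IH hu} => // n; apply: QnS.
rewrite mulrDr addrA; congr (_ + _).
by rewrite /skew_comm twKN opprB mulrBl exprS !mulrA addrC subrK.
Qed.

Lemma G_Qn g : G g -> Qn 1 g.
Proof. by move=> hg; exists g, 0; rewrite expr0 mulr1 addr0. Qed.

Lemma U_Qn x : U x -> exists n, Qn n x.
Proof.
elim=> [|u v _ [n hn] _ [m hm]|k u _ [n hn]|_ u [i ->] _ [n hn]].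
- by exists 1%N; apply: G_Qn; apply: agen1.
- by exists (maxn n m); apply: QnD; [apply: Qn_le hn | apply: Qn_le hm];
  rewrite ?leq_maxl ?leq_maxr.
- exists n; rewrite -(mul1r u) scalerAl; apply: QnG => //; apply/agenZ/agen1.
have [->|ne] := eqVneq i p; first by exists n.+1; apply: Qn_xp.
by exists n; apply: QnG => //; apply: agen_gen; exists i, 0%N.
Qed.

Lemma Lw_G_xp n m g : G g ->
  Lw (nseq n p) (g * xp ^+ m) = ((n <= m)%N%:R * qfac m) *: (g * pw (m - n)).
Proof.
move=> hg; rewrite Lw_p_Mr ?(G_ker hg) // expr_xp linearZ /= Lw_pw scalerA -scalerAr.
by rewrite mulrC.
Qed.

Lemma Lw_Qn n m x : Qn m x -> (m <= n)%N -> Lw (nseq n p) x = 0.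
Proof.
elim: m x => [|m IH] x; first by move=> -> _; rewrite linear0.
move=> [g [y [hg hy ->]]] lt; rewrite raddfD /= Lw_G_xp // leqNgt lt mul0r scale0r add0r.
exact: IH (ltnW lt).
Qed.

Lemma U_nilp x : U x -> exists n, Lw (nseq n p) x = 0.
Proof. by move=> /U_Qn[n hn]; exists n; apply: Lw_Qn hn _. Qed.

Lemma qfac_eq0 n m : (n <= m)%N -> qfac n = 0 -> qfac m = 0.
Proof.
move=> /subnK <- h; elim: (m - n)%N => // k IH.
by rewrite addSn /qfac big_ord_recr /= -[X in X * _]/(qfac (k + n)) IH mul0r.
Qed.

(** When $[n]!$ vanishes, so do all powers of $x_p$ from the n-th on, and every element of [U] has
    smaller degree in $x_p$. This is how letters with $x_p^2=0$ are covered. *)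
Lemma U_qfac0 n x : U x -> qfac n = 0 -> Lw (nseq n p) x = 0.
Proof.
move=> /U_Qn[m hm] q0; elim: m x hm => [|m IH] x; first by move=> ->; rewrite linear0.
move=> [g [y [hg hy ->]]]; rewrite raddfD /= Lw_G_xp // (IH _ hy) addr0.
case: leqP => [le|_]; last by rewrite mul0r scale0r.
by rewrite (qfac_eq0 le q0) mulr0 scale0r.
Qed.

(** Applying $L_p^n$ isolates $[n]!$ times the top coefficient. So either that coefficient is zero,
    or $[n]!=0$ and the top term vanishes already. *)
Lemma U_ker x : U x -> Lop p x = 0 -> G x.
Proof.
move=> /U_Qn[n]; elim: n x => [|n IH] x; first by move=> -> _; apply: agen0.
move=> [g [y [hg hy ->]]] h.
have [q0|qn0] := eqVneq (qfac n) 0.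
  by move: h; rewrite expr_xp q0 scale0r mulr0 add0r; apply: IH.
case: n => [|n] in IH hy h qn0 *.
  by rewrite hy expr0 mulr1 addr0.
have : Lw (nseq n.+1 p) (g * xp ^+ n.+1 + y) = 0 by rewrite /= Lw_cons h linear0.
rewrite LwD Lw_G_xp // (Lw_Qn (hy : Qn n.+1 y)) // addr0 leqnn subnn mul1r -[pw 0]/(1 : S) mulr1.
move/eqP; rewrite scaler_eq0 (negPf qn0) /= => /eqP g0.
by move: h; rewrite g0 mul0r add0r; apply: IH.
Qed.

Lemma iter_linear0 n : iter n Aop 0 = 0.
Proof. by elim: n => //= n ->; rewrite linear0. Qed.
Lemma iter_AopD n x y : iter n Aop (x + y) = iter n Aop x + iter n Aop y.
Proof. by elim: n => //= n ->; rewrite linearD. Qed.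
Lemma iter_AopZ n k x : iter n Aop (k *: x) = k *: iter n Aop x.
Proof. by elim: n => //= n ->; rewrite linearZ. Qed.

Lemma iter_Aop_tw n v x : exists k, iter n Aop (tw v x) = k *: tw v (iter n Aop x).
Proof.
elim: n => [|n [k IH]]; first by exists 1; rewrite scale1r.
by exists (k * (chi v (a p))^-1); rewrite /= IH linearZ /= Aop_tw scalerA.
Qed.

Lemma iter_AopM n m x y : iter n Aop x = 0 -> iter m Aop y = 0 -> iter (n + m) Aop (x * y) = 0.
Proof.
have [k lt] := ubnP (n + m); elim: k n m x y lt => // k IH [|n] m x y.
  by move=> _ /= -> _; rewrite mul0r iter_linear0.
case: m => [|m]; first by move=> _ _ y0; rewrite (y0 : y = 0) mulr0 iter_linear0.
move=> lt hx hy; rewrite addSn iterSr AopM iter_AopD.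
have -> : iter (n + m.+1) Aop (Aop x * tw (- a p) y) = 0.
  apply: IH; [lia | by rewrite -iterSr |].
  by have [l ->] := iter_Aop_tw m.+1 (- a p) y; rewrite hy linear0 scaler0.
by rewrite add0r addnS -addSn; apply: IH; [lia | | rewrite -iterSr].
Qed.

Lemma G_Aop_nilp x : G x -> exists n, iter n Aop x = 0.
Proof.
elim=> [|u v _ [n hn] _ [m hm]|k u _ [n hn]|_ u [i [n [ne le ->]]] _ [m hm]].
- by exists 1%N; rewrite /= /skew_comm tw1 mul1r mulr1 subrr.
- exists (n + m)%N; rewrite iter_AopD [in X in X + _]addnC !iterD hn hm !iter_linear0.
  by rewrite addr0.
- by exists n; rewrite iter_AopZ hn scaler0.
suff [k hk] : exists k, iter k Aop (dl chi a (i :: nseq n p)) = 0.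
  by exists (k + m)%N; apply: iter_AopM.
have [d e] : exists d, (n + d = M i)%N by exists (M i - n)%N; rewrite subnKC.
elim: d n {le} e => [|d IH] n e.
  by rewrite addn0 in e; exists 1%N; rewrite /= Aop_blk // e lam_eq0 // mul0r scale0r.
have [k hk] := IH n.+1 (etrans (addSnnS _ _) e).
by exists k.+1; rewrite iterSr Aop_blk // iter_AopZ hk scaler0.
Qed.

(** The number of letters other than p is not increased by [skew_comm] and drops under the other
    operators [refl_op i]; it is the induction measure for injectivity. *)
Definition bd k x := forall w, (k < count (predC1 p) w)%N -> x w = 0.

Lemma bd_tw k v x : bd k x -> bd k (tw v x).
Proof. by move=> h w /h e; rewrite /tw e mulr0. Qed.
Lemma bdD k x y : bd k x -> bd k y -> bd k (x + y).
Proof. by move=> hx hy w lt; rewrite shaDE hx ?hy ?addr0. Qed.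
Lemma bd_le k l x : (k <= l)%N -> bd k x -> bd l x.
Proof. by move=> le h w lt; apply: h; apply: leq_ltn_trans lt. Qed.
Lemma bdM k l x y : bd k x -> bd l y -> bd (k + l) (x * y).
Proof.
move=> hx hy w; elim: w k l x y hx hy => // i w IH k l x y hx hy.
rewrite -[(x * y) (i :: w)]/(Lop i (x * y) w) LopM shaDE /=.
have [->|ne] /= := eqVneq i p.
  rewrite add0n => lt.
  rewrite (IH k l) ?(IH k l) ?addr0 //.
  - by move=> u h; apply: hy; rewrite /= eqxx.
  - by move=> u h; apply: hx; rewrite /= eqxx.
  - exact: bd_tw.
rewrite add1n => lt.
have H k' (z : S) : bd k' z -> (k' = 0)%N /\ Lop i z = 0 \/ (0 < k')%N /\ bd k'.-1 (Lop i z).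
  case: k' => [|k'] h; [left | right]; split => //.
    by apply: shaP => u; apply: h; rewrite /= ne.
  by move=> u hu; apply: h; rewrite /= ne.
have -> : (Lop i x * tw (a i) y) w = 0.
  case: (H _ _ hx) => [[_ ->]|[k0 hk]]; first by rewrite mul0r.
  apply: (IH k.-1 l) => //; first exact: bd_tw.
  by move: lt; rewrite -{1}(prednK k0) addSn ltnS.
rewrite add0r; case: (H _ _ hy) => [[_ ->]|[k0 hk]]; first by rewrite mulr0.
by apply: (IH k l.-1) => //; move: lt; rewrite -{1}(prednK k0) addnS ltnS.
Qed.

Lemma bd_Aop k x : bd k x -> bd k (Aop x).
Proof.
have hxp : bd 0 xp.
  move=> w; rewrite /xp dlE; case: eqP => [->|//]; by rewrite /= eqxx.
move=> h; rewrite /skew_comm -scaleN1r; apply: bdD.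
  by rewrite -(addn0 k); apply: bdM.
rewrite scalerAl -(add0n k); apply: bdM; last exact: bd_tw.
by move=> w /hxp e; rewrite shaZE -/xp e mulr0.
Qed.

Lemma G_bd x : G x -> exists k, bd k x.
Proof.
elim=> [|u v _ [n hn] _ [m hm]|k u _ [n hn]|_ u [i [n [ne le ->]]] _ [m hm]].
- by exists 0%N => -[|j w].
- by exists (maxn n m); apply: bdD; [apply: bd_le hn | apply: bd_le hm];
  rewrite ?leq_maxl ?leq_maxr.
- by exists n => w /hn e; rewrite shaZE e mulr0.
exists (size (i :: nseq n p) + m)%N; apply: bdM => // w lt.
rewrite dlE; case: eqP => // e; move: lt; rewrite e ltnNge.
by rewrite count_size.
Qed.

Lemma twZ v k x : tw v (k *: x) = k *: tw v x.
Proof. exact: linearZ. Qed.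

Lemma Lw_pS n y : Lw (nseq n.+1 p) y = Lw (nseq n p) (Lop p y). Proof. by []. Qed.

Lemma Lop_Lw_p n y : Lop p (Lw (nseq n p) y) = Lw (nseq n.+1 p) y.
Proof. by rewrite -[Lop p _]/(Lw [:: p] _) -Lw_cat -addn1 nseqD. Qed.

Lemma Lw_xpm n y : Lw (nseq n.+1 p) (xp * y) =
  xp * Lw (nseq n.+1 p) y + qn c n.+1 *: tw (a p) (Lw (nseq n p) y).
Proof.
elim: n y => [|n IH] y.
  by rewrite !Lw_pS !Lw_nil Lop_xpm qnS qn0 mulr0 addr0 scale1r addrC.
rewrite Lw_pS Lop_xpm LwD IH Lw_tw wgt_nseq bchMnr -!Lw_pS.
by rewrite -/c addrCA -scalerDl addrC (qnSr c n.+1) addrC [_ + c ^+ _]addrC.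
Qed.

Lemma Lw_mxp n y : Lw (nseq n.+1 p) (y * xp) =
  c ^+ n.+1 *: (Lw (nseq n.+1 p) y * xp) + qn c n.+1 *: Lw (nseq n p) y.
Proof.
elim: n y => [|n IH] y.
  by rewrite !Lw_pS !Lw_nil Lop_mxp qnS qn0 mulr0 addr0 scale1r expr1.
rewrite Lw_pS Lop_mxp LwD LwZ IH.
rewrite scalerDr !scalerA -exprS -addrA -!Lw_pS; congr (_ + _).
by rewrite (qnS c n.+1) scalerDl scale1r addrC.
Qed.

(* If [Aop x = 0] and [L_i x <> 0], the largest [m] with [L_p^m L_i x <> 0]
   satisfies [lam i m = 0], hence equals [M i]. *)
Lemma Aop0_Lw x i : i != p -> G x -> Aop x = 0 -> Lop i x != 0 ->
  Lw (i :: nseq (M i) p) x != 0.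
Proof.
move=> ne hx hA h0.
have ex : exists m, Lw (nseq m p) (Lop i x) == 0.
  by exists (M i).+1; rewrite -Lw_cons (Lw_blk_G0 hx).
have [[|m] /eqP hm mmin] := ex_minnP ex; first by rewrite (hm : Lop i x = 0) eqxx in h0.
have nz : Lw (nseq m p) (Lop i x) != 0.
  by apply/negP => /mmin; rewrite ltnn.
have lem : (m <= M i)%N.
  by rewrite leqNgt; apply: contra nz => lt; rewrite -Lw_cons (Lw_blk_G0 hx).
suff l0 : lam i m = 0.
  have -> : M i = m; last by [].
  by apply/eqP; rewrite eqn_leq lem andbT leqNgt; apply/negP => lt;
     have := lam_neq0 ne lt; rewrite l0 eqxx.
set z := Lw (nseq m p) (Lop i x) in nz.
have := congr1 (fun t => Lw (nseq m.+1 p) (Lop i t)) hA.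
rewrite !linear0 /skew_comm LopB !LopM Lop_xp0 // mulr0 mul0r addr0 add0r Lop_tw tw_dl.
rewrite wgt_cons wgt_nil addr0 -!scalerAr -scaleN1r LwD !LwZ Lw_xpm Lw_mxp.
rewrite !Lw_tw hm !linear0 mulr0 add0r mul0r scaler0 add0r scaleN1r.
rewrite wgt_nseq twZ twNK -/z !scalerA -scalerBl => /eqP.
rewrite scaler_eq0 (negPf nz) orbF !bchNl bchMnr -/c [chi (a i) _]bchC => /eqP e.
have d0 := bch_neq0 chi (a p) (a i).
have cm0 : c ^+ m != 0 by rewrite expf_neq0.
rewrite /serre_coef -/c; move: e d0 cm0; move: (qn c m.+1) (chi _ _) (c ^+ m) => u v w e v0 w0.
have -> : u * (w * v ^+ 2 - 1) = (v * w) * (v * u - v^-1 * u / w).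
  by field; rewrite v0 w0.
by rewrite e mulr0.
Qed.

(** The last nonzero iterate y of [skew_comm] on x is killed by [skew_comm] and still lies in the
    kernel. Its constant term is zero, so some $L_iy$ is nonzero, and [Aop0_Lw] gives a nonzero
    $L_p^{M_i}L_iy$, again in the kernel but with fewer letters other than p. *)
Lemma Tm_inj0 x : G x -> Tm x = 0 -> x = 0.
Proof.
move=> hx; have [k] := G_bd hx; elim: k x hx => [|k IH] x hx hk hT.
(* The construction of y and i is common to the base case and the induction step; only the final
   contradiction differs. *)
all: apply/eqP; apply/negP => /negP x0.
all: have [n hn] := G_Aop_nilp hx.
all: have ex : exists n, iter n Aop x == 0 by exists n; rewrite hn.
all: have [[|m] /eqP hm mmin] := ex_minnP ex; first by rewrite -[x]/(iter 0 Aop x) hm eqxx in x0.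
all: have y0 : iter m Aop x != 0 by apply/negP => /mmin; rewrite ltnn.
all: have [hy hTy] : G (iter m Aop x) /\ Tm (iter m Aop x) = 0
  by elim: (m) => //= l [h1 h2]; split; [apply: G_Aop |
    have := congr1 (Lop p) h2; rewrite Lop_Tm /refl_op eqxx].
all: have hbd : forall l, bd l x -> bd l (iter m Aop x)
  by move=> l hl; elim: (m) => //= l' h; apply: bd_Aop.
all: have hA : Aop (iter m Aop x) = 0 by [].
all: move: (iter m Aop x) (hbd _ hk) y0 hy hTy hA => y hyk y0 hy hTy hA.
all: have [i [ne hi]] : exists i, i != p /\ Lop i y != 0
  by apply: contrapT => hno; case/eqP: y0; apply: sha_ext => [|i];
     [rewrite -(Tm_nil p M) hTy | apply/eqP/negP => /negP h; apply: hno; exists i; split=> //;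
      apply: contraNneq h => ->; rewrite (G_ker hy)].
  by case/eqP: hi; apply: shaP => w; apply: hyk; rewrite /= ne.
have := Aop0_Lw ne hy hA hi; case/eqP; apply: IH.
- exact: G_Lw.
- move=> w lt; apply: hyk; rewrite /= ne count_cat add1n ltnS; apply: leq_trans lt (leq_addl _ _).
by have := congr1 (Lop i) hTy; rewrite Lop_Tm /refl_op (negPf ne).
Qed.

(** Blocks go to multiples of $p^mi$, and [U_rblk] applies over the reflected base because
    [lam_refl] keeps the needed coefficients nonzero. *)
Lemma Tm_U x : G x -> U (Tm x).
Proof.
elim=> [|u v _ hu _ hv|k u _ hu|_ u [i [n [ne le ->]]] hGu hu].
- by rewrite Tm1; apply: agen1.
- by rewrite raddfD; apply: agenD.
- by rewrite linearZ /=; apply: agenZ.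
rewrite TmM //; last by apply: agen_gen; exists i, n.
apply: agenM => //.
have [t ->] := Tm_blk lam_eq0 ne (subnKC le).
apply: agenZ; apply: U_rblk => // m lt.
by apply: lam_refl => //; apply: leq_trans lt (leq_subr _ _).
Qed.

End Decomposition.

(** * Simple systems of a root system *)

Section Cone.
Variables (V : zmodType) (I : finType).
Implicit Types (a : I -> V) (g : V).

Definition indep a := forall f : I -> int, \sum_i a i *~ f i = 0 -> forall i, f i = 0.
Definition Qp a g := exists f : I -> nat, g = \sum_i a i *+ f i.

Lemma Qp0 a : Qp a 0.
Proof. by exists (fun _ => 0%N); rewrite big1. Qed.
Lemma QpD a g h : Qp a g -> Qp a h -> Qp a (g + h).
Proof.
move=> [f ->] [f' ->]; exists (fun i => f i + f' i)%N.
by rewrite -big_split; apply: eq_bigr => i _; rewrite mulrnDr.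
Qed.
Lemma QpMn a g n : Qp a g -> Qp a (g *+ n).
Proof. by move=> h; elim: n => [|n IH]; [apply: Qp0 | rewrite mulrS; apply: QpD]. Qed.
Lemma Qp_gen a i : Qp a (a i).
Proof.
exists (fun j => (j == i) : nat); rewrite (bigD1 i) //= eqxx big1 ?addr0 // => j /negPf ->.
by rewrite mulr0n.
Qed.

Lemma wgt_count a w : wgt a w = \sum_i a i *+ count_mem i w.
Proof.
elim: w => [|j w IH]; first by rewrite wgt_nil big1.
rewrite wgt_cons IH [RHS](eq_bigr (fun i => a i *+ (j == i) + a i *+ count_mem i w)).
  rewrite big_split /=; congr (_ + _); rewrite (bigD1 j) //= eqxx big1 ?addr0 // => i.
  by rewrite eq_sym => /negPf ->.
by move=> i _; rewrite -mulrnDr.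
Qed.

Lemma size_count (w : seq I) : size w = (\sum_i count_mem i w)%N.
Proof.
elim: w => [|j w IH]; first by rewrite big1.
rewrite /= IH big_split /= -add1n; congr (_ + _)%N.
by rewrite (bigD1 j) //= eqxx big1 // => i; rewrite eq_sym => /negPf ->.
Qed.

Lemma indep_inj a (f f' : I -> nat) : indep a ->
  \sum_i a i *+ f i = \sum_i a i *+ f' i -> f =1 f'.
Proof.
move=> ha e i; have := ha (fun j => (f j)%:Z - (f' j)%:Z).
rewrite (eq_bigr (fun j => a j *+ f j - a j *+ f' j)); last by move=> j _; rewrite mulrzBr.
by rewrite sumrB e subrr => /(_ erefl i) /eqP; rewrite subr_eq0 => /eqP[].
Qed.

Lemma wgt_count_eq a w w' : indep a -> wgt a w = wgt a w' ->
  forall i, count_mem i w = count_mem i w'.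
Proof. by move=> ha; rewrite !wgt_count => /(indep_inj ha). Qed.

Lemma wgt_size a w w' : indep a -> wgt a w = wgt a w' -> size w = size w'.
Proof.
by move=> ha /(wgt_count_eq ha) e; rewrite !size_count; apply: eq_bigr => i _; apply: e.
Qed.

Lemma wgt_eq0 a w : indep a -> wgt a w = 0 -> w = [::].
Proof. by move=> ha; rewrite -(wgt_nil a) => /(wgt_size ha) /size0nil. Qed.

Lemma wgt_eq1 a w i : indep a -> wgt a w = a i -> w = [:: i].
Proof.
move=> ha e; have e' : wgt a w = wgt a [:: i] by rewrite e wgt_cons wgt_nil addr0.
have := wgt_size ha e'; case: w e' {e} => [|j [|]] //= e' _.
by have := wgt_count_eq ha e' i; rewrite /= eqxx addn0; case: eqP => // ->.
Qed.

Lemma Qp_anti a g : indep a -> Qp a g -> Qp a (- g) -> g = 0.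
Proof.
move=> ha [f ->] [f' e].
have /(indep_inj ha) h : \sum_i a i *+ (f i + f' i)%N = \sum_i a i *+ 0%N.
  rewrite [RHS]big1 // (eq_bigr (fun i => a i *+ f i + a i *+ f' i)).
    by rewrite big_split /= -e subrr.
  by move=> i _; rewrite mulrnDr.
rewrite big1 // => i _; have /eqP := h i; rewrite addn_eq0 => /andP[/eqP -> _].
by rewrite mulr0n.
Qed.

End Cone.

Lemma count_lt (T : eqType) (P Q : pred T) s x :
  x \in s -> subpred P Q -> Q x -> ~~ P x -> (count P s < count Q s)%N.
Proof.
move=> xs sub qx px; elim: s xs => //= y s IH; rewrite inE => /predU1P[<-|xs].
  by rewrite qx (negPf px) add0n add1n ltnS sub_count.
by rewrite -addnS leq_add ?IH //; case: (boolP (P y)) => // /sub ->.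
Qed.

(** * Induction along reflections of simple systems *)

Section RootClass.
Variables (K : fieldType) (V : zmodType) (chi : bichar K V) (I : finType) (Phi : seq V).

(* A family of bases of one root system, closed under reflections whose multiplicities
   are the vanishing orders prescribed by the bicharacter. *)
Record root_class (C : (I -> V) -> Prop) : Prop := RootClass {
  rc_indep : forall a, C a -> indep a;
  rc_root : forall a i, C a -> a i \in Phi;
  rc_0 : 0 \notin Phi;
  rc_pos : forall a g, C a -> g \in Phi -> Qp a g \/ Qp a (- g);
  rc_refl : forall a p, C a -> exists M : I -> nat,
    [/\ forall i m, i != p -> (m < M i)%N -> serre_coef chi a p i m != 0,
        forall i, i != p -> serre_coef chi a p i (M i) = 0,
        C (refl_base a p M) &
        forall g, g \in Phi -> Qp a g -> g != a p -> Qp (refl_base a p M) g] }.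

Definition supp (a : I -> V) (E : sha chi a -> Prop) (g : V) :=
  exists x, [/\ E x, hom g x & x != 0].

Variable C : (I -> V) -> Prop.
Hypothesis hC : root_class C.

(** The last clause, a partial converse of the third, drives the induction: in [final_step] it shows
    that $a_p$ is negative for the final base. *)
Definition final_basis a (E : sha chi a -> Prop) (b : V) := exists af,
  [/\ C af, exists j, b = af j, forall g, supp E g -> Qp af (- g) &
      forall g, g \in Phi -> Qp a g -> Qp af (- g) -> supp E g].

Section Step.
Variables (a : I -> V) (E : sha chi a -> Prop) (r : sha chi a) (b : V).
Hypotheses (ha : C a) (hE : coideal E) (EU : forall x, E x -> U x).
Hypotheses (rU : U r) (rE : ~ E r) (rb : hom b r) (rL : forall i, E (Lop i r)).
Hypothesis rad : forall e, E e -> E (r * e - tw (- b) e * r).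

(** Stripping all letters but the last from a word with nonzero coefficient and projecting to the
    weight of that letter would put a letter into E. *)
Lemma no_letter_supp : (forall p, ~ E (dl chi a [:: p])) ->
  forall x w, E x -> w != [::] -> x w = 0.
Proof.
move=> no x w; case: (lastP w) => // w' i hx _; apply/eqP/negP => /negP xw.
apply: (no i); set y := prj (a i) (Lw w' x).
have Ey : E y by apply: (coprj hE); apply: coLw.
have e : y = x (rcons w' i) *: dl chi a [:: i].
  apply: shaP => u; rewrite shaZE dlE /y /prj; case: eqP => [|ne].
    by move=> /(wgt_eq1 (rc_indep hC ha)) ->; rewrite eqxx mulr1 /Lw cats1.
  case: eqP => [eu|]; last by rewrite mulr0.
  by case: ne; rewrite eu wgt_cons wgt_nil addr0.
by rewrite -(scale1r (dl _ _ _)) -(mulVf xw) -scalerA -e; apply: coZ.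
Qed.

(** Now E consists of scalars, so the derivatives of r are scalars and only words of length at most
    one occur in r. As r is not itself a scalar, its weight is a simple root, and the base at hand
    is final. *)
Lemma no_letter_final : (forall p, ~ E (dl chi a [:: p])) -> final_basis E b.
Proof.
move=> no; have h0 := no_letter_supp no; have hi := rc_indep hC ha.
have [i [w rw]] : exists i w, r (i :: w) != 0.
  apply: contrapT => hno; apply: rE.
  have -> : r = r [::] *: 1; last by apply: (coZ hE); apply: co1.
  apply: shaP => -[|i w]; rewrite shaZE ?mulr1 //.
  by rewrite mulr0; apply/eqP/negP => /negP h; apply: hno; exists i, w.
have w0 : w = [::].
  by apply/eqP/negP => /negP h; have /eqP := h0 _ _ (rL i) h; rewrite (negPf rw).
have h g : supp E g -> g = 0.
  move=> [x [hx hg x0]]; have [xn|/hg] := eqVneq (x [::]) 0; last by rewrite wgt_nil.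
  by case/eqP: x0; apply: shaP => -[|j v] //; apply: h0.
exists a; split => //.
- by exists i; rewrite -(rb rw) w0 wgt_cons wgt_nil addr0.
- by move=> g /h ->; rewrite oppr0; apply: Qp0.
- move=> g gP h1 h2; have e := Qp_anti hi h1 h2.
  by have := rc_0 hC; rewrite -e gP.
Qed.

Section Letter.
Variables (p : I) (M : I -> nat).
Hypothesis pE : E (dl chi a [:: p]).
Hypothesis lam_neq0 : forall i m, i != p -> (m < M i)%N -> serre_coef chi a p i m != 0.
Hypothesis lam_eq0 : forall i, i != p -> serre_coef chi a p i (M i) = 0.
Notation G := (agen (@blk K V chi I a p M)).
Notation Tm := (@Tm K V chi I a p M).
Notation a' := (refl_base a p M).

Lemma co_exp n : E (dl chi a [:: p] ^+ n).
Proof. by elim: n => [|n IH]; [apply: (co1 hE) | rewrite exprS; apply: (coM hE)]. Qed.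

Lemma hom_Lw g w (x : sha chi a) : hom g x -> hom (g - wgt a w) (Lw w x).
Proof. by move=> h u /h; rewrite wgt_cat => <-; rewrite addrC addKr. Qed.

(** Finds an antiderivative of $L_ps$ inside E. With t the top p-derivative of s, subtracting
    $t\,x_p^{n+1}/[n+1]!$ lowers the degree in p; if the factorial vanishes, the degree is already
    lower. The element t is in E because it is a derivative of $L_ps$. *)
Lemma integrate n (s : sha chi a) : U s -> hom b s -> E (Lop p s) ->
  Lw (nseq n.+1 p) s = 0 -> exists e, [/\ E e, hom b e & Lop p (s - e) = 0].
Proof.
elim: n s => [|n IH] s sU sb sL s0.
  by exists 0; split; [apply: co0 | apply: hom0 | rewrite subr0].
have [q0|q0] := eqVneq (qfac chi a p n.+1) 0.
  by apply: IH => //; apply: (U_qfac0 lam_eq0 sU q0).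
set t := Lw (nseq n.+1 p) s.
have Et : E t by exact: (coLw (nseq n p) hE sL).
have tp : Lop p t = 0.
  by rewrite Lop_Lw_p.
pose e1 := (qfac chi a p n.+1)^-1 *: (t * dl chi a [:: p] ^+ n.+1).
have Ee1 : E e1 by apply: (coZ hE); apply: (coM hE) => //; apply: co_exp.
have be1 : hom b e1.
  apply: homZ; have := homM (@hom_Lw b (nseq n.+1 p) s sb) (@hom_xp _ _ chi _ a p n.+1).
  by rewrite wgt_nseq subrK.
have [|||| e2 [Ee2 be2 he2]] := IH (s - e1).
- by apply: agenB => //; apply: EU.
- exact: homB.
- by rewrite LopB; apply: coB => //; apply: coL.
- rewrite -scaleN1r LwD LwZ /e1 LwZ Lw_p_Mr // expr_xp LwZ Lw_pw leqnn subnn.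
  by rewrite /pw dl_nil scale1r -scalerAr mulr1 !scalerA -mulrA mulVf // mulr1 scaleN1r subrr.
exists (e1 + e2); split.
- exact: (coD hE).
- exact: homD.
- by rewrite opprD addrA.
Qed.

Definition E' : sha chi a' -> Prop := fun z => exists x, [/\ E x, G x & z = Tm x].

Lemma E'_coideal : coideal E'.
Proof.
have bh := @blk_hom K V chi I a p M.
split.
- by exists 1; split; [apply: (co1 hE) | apply: agen1 | rewrite Tm1].
- move=> _ _ [x [Ex Gx ->]] [y [Ey Gy ->]]; exists (x + y); split.
  + exact: (coD hE).
  + exact: agenD.
  + by rewrite raddfD.
- move=> k _ [x [Ex Gx ->]]; exists (k *: x); split.
  + exact: (coZ hE).
  + exact: agenZ.
  + by rewrite linearZ.
- move=> _ _ [x [Ex Gx ->]] [y [Ey Gy ->]]; exists (x * y); split.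
  + exact: (coM hE).
  + exact: agenM.
  + by rewrite TmM.
- move=> v _ [x [Ex Gx ->]]; exists (tw v x); split.
  + exact: (cotw hE).
  + exact: agen_tw.
  + by rewrite Tm_tw.
- move=> v _ [x [Ex Gx ->]]; exists (prj v x); split.
  + exact: (coprj hE).
  + exact: agen_prj.
  + by rewrite Tm_prj.
- move=> i _ [x [Ex Gx ->]]; exists (refl_op p M i x); split.
  + rewrite /refl_op; case: ifP => _; last exact: coLw.
    apply: coB => //; apply: (coM hE) => //; exact: (cotw hE).
  + exact: G_Dop.
  + by rewrite Lop_Tm.
Qed.

Lemma E'_U z : E' z -> U z.
Proof. by move=> [x [_ Gx ->]]; apply: Tm_U. Qed.

Lemma Tm_inj x y : G x -> G y -> Tm x = Tm y -> x = y.
Proof.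
move=> hx hy e; apply/eqP; rewrite -subr_eq0; apply/eqP.
by apply: (Tm_inj0 lam_neq0 lam_eq0); [apply: agenB | rewrite raddfB /= e subrr].
Qed.

(** After correction by an element of E the element r is killed by $L_p$, hence lies in the domain
    of the braid operator. Its new derivative at p is the skew commutator with $x_p$, which lies in
    E by [rad] applied to the letter. *)
Lemma reflected_element : exists r' : sha chi a',
  [/\ U r', ~ E' r', hom b r', forall i, E' (Lop i r') &
      forall e, E' e -> E' (r' * e - tw (- b) e * r')].
Proof.
have [n hn] := U_nilp lam_eq0 rU.
have [|e [Ee be he]] := @integrate n r rU rb (rL p).
  by rewrite -Lop_Lw_p hn linear0.
set r0 := r - e; have r0U : U r0 by apply: agenB => //; apply: EU.
have r0G : G r0 by apply: U_ker.
have r0b : hom b r0 by apply: homB.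
have r0E : ~ E r0 by move=> h; apply: rE; rewrite -(subrK e r); apply: (coD hE).
have r0L i : E (Lop i r0) by rewrite LopB; apply: coB => //; apply: coL.
have r0ad f : E f -> E (r0 * f - tw (- b) f * r0).
  move=> Ef.
  have -> : r0 * f - tw (- b) f * r0 = (r * f - tw (- b) f * r) - (e * f - tw (- b) f * e).
    rewrite mulrBl mulrBr !opprB addrACA [RHS]addrACA; congr (_ + _).
    by rewrite addrC.
  apply: coB => //; first exact: rad.
  by apply: coB => //; apply: (coM hE) => //; apply: (cotw hE).
clearbody r0; exists (Tm r0); split.
- exact: Tm_U.
- by move=> [x [Ex Gx /(Tm_inj r0G Gx) er]]; apply: r0E; rewrite er.
- exact: Tm_hom.
- move=> i; exists (refl_op p M i r0); split; last by rewrite Lop_Tm.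
    rewrite /refl_op; case: ifP => _; last by rewrite Lw_cons; apply: coLw.
    have := r0ad _ pE; rewrite /skew_comm tw_dl (hom_tw _ r0b) wgt_cons wgt_nil addr0.
    by rewrite -scalerAr -scalerAl !bchNl bchC.
  exact: G_Dop.
- move=> _ [f [Ef Gf ->]]; exists (r0 * f - tw (- b) f * r0).
  have Gtf : G (tw (- b) f) by apply: agen_tw => //; apply: blk_hom.
  split; first exact: r0ad.
    by apply: agenB; apply: agenM.
  by rewrite [RHS]raddfB /= !TmM // Tm_tw.
Qed.

Lemma supp_E' g : supp E' g -> supp E g.
Proof.
move=> [_ [[x [Ex Gx ->]] hg T0]]; exists (prj g x); split.
- exact: (coprj hE).
- exact: hom_prj.
- by apply: contraNneq T0 => e; rewrite -(hom_prjE hg) -Tm_prj e linear0.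
Qed.

(** The last nonzero p-derivative of an element of E is killed by $L_p$ and survives the braid
    operator by injectivity. *)
Lemma supp_E g : supp E g -> exists n, supp E' (g - a p *+ n).
Proof.
move=> [x [Ex hg x0]]; have [n hn] := U_nilp lam_eq0 (EU Ex).
have ex : exists n, Lw (nseq n p) x == 0 by exists n; rewrite hn.
have [[|m] /eqP hm mmin] := ex_minnP ex; first by rewrite (hm : x = 0) eqxx in x0.
have y0 : Lw (nseq m p) x != 0 by apply/negP => /mmin; rewrite ltnn.
exists m; exists (Tm (Lw (nseq m p) x)).
have yp : Lop p (Lw (nseq m p) x) = 0.
  by rewrite Lop_Lw_p.
have Ey : E (Lw (nseq m p) x) by apply: coLw.
have Gy : G (Lw (nseq m p) x) by apply: U_ker => //; apply: EU.
split.
- by exists (Lw (nseq m p) x).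
- by apply: Tm_hom; rewrite -wgt_nseq; apply: hom_Lw.
- by apply: contraNneq y0 => /(Tm_inj0 lam_neq0 lam_eq0 Gy) ->.
Qed.

Lemma supp_ap : supp E (a p).
Proof.
exists (dl chi a [:: p]); split => //.
  by have := @hom_dl _ _ chi _ a [:: p]; rewrite wgt_cons wgt_nil addr0.
by apply/eqP => /(congr1 (fun x : sha chi a => x [:: p])) /eqP; rewrite dlE eqxx oner_eq0.
Qed.

Lemma supp_neg : ~ supp E (- a p).
Proof.
move=> [x [_ hx /eqP]]; apply; apply: shaP => w; apply/eqP/negP => /negP /hx e.
have : wgt a (p :: w) = 0 by rewrite wgt_cons e subrr.
by move/(wgt_eq0 (rc_indep hC ha)).
Qed.

Lemma supp_ap' : C a' -> ~ supp E' (a p).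
Proof.
move=> ha' [x [_ hx /eqP]]; apply; apply: shaP => w; apply/eqP/negP => /negP /hx e.
have : wgt a' (p :: w) = 0 by rewrite wgt_cons e reflp addNr.
by move/(wgt_eq0 (rc_indep hC ha')).
Qed.

(** If $a_p$ were positive for the final base, then $-a_p$, simple for the reflected base, would
    belong to the support of E' by the last clause of [final_basis], hence to that of E; but no word
    has weight $-a_p$ over the original base. *)
Lemma final_step : C a' ->
  (forall g, g \in Phi -> Qp a g -> g != a p -> Qp a' g) ->
  final_basis E' b -> final_basis E b.
Proof.
move=> ha' hPhi [af [hf hb h1 h2]]; exists af; split => //; last first.
  move=> g gP ga gf; have [->|ne] := eqVneq g (a p); first exact: supp_ap.
  by apply: supp_E'; apply: h2 => //; apply: hPhi.
have nap : Qp af (- a p).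
  case: (rc_pos hC hf (rc_root hC p ha : a p \in Phi)) => // h; case: supp_neg; apply: supp_E'.
  by rewrite -(reflp a p M); apply: h2; rewrite ?(rc_root hC p ha') //;
    [apply: Qp_gen | rewrite reflp opprK].
move=> g /supp_E[n /h1 h]; have := QpD h (QpMn n nap).
by rewrite opprB mulNrn addrAC subrr add0r.
Qed.

End Letter.
End Step.

Lemma coideal_final (a : I -> V) (E : sha chi a -> Prop) (r : sha chi a) (b : V) :
  C a -> coideal E -> (forall x, E x -> U x) ->
  U r -> ~ E r -> hom b r -> (forall i, E (Lop i r)) ->
  (forall e, E e -> E (r * e - tw (- b) e * r)) -> final_basis E b.
Proof.
have [n] := ubnP (count (fun g => `[< supp E g >]) Phi).
elim: n a E r => // n IH a E r lt ha hE EU rU rE rb rL rad.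
have [[p pE]|no] := pselect (exists p, E (dl chi a [:: p])); last first.
  by apply: (no_letter_final ha hE rE rb rL) => p pE; apply: no; exists p.
have [M [l1 l2 ha' hPhi]] := rc_refl hC p ha.
have [r' [r'U r'E r'b r'L r'ad]] := reflected_element hE EU rU rE rb rL rad pE l1 l2.
apply: (final_step ha hE EU pE l1 l2 ha' hPhi).
apply: (IH _ _ r') => //; last by apply: E'_U.
  rewrite -ltnS; apply: leq_trans lt; rewrite ltnS.
  apply: (@count_lt _ _ _ _ (a p)); first exact: (rc_root hC p ha : a p \in Phi).
  - by move=> g /asboolP h; apply/asboolP; apply: supp_E' h.
  - by apply/asboolP; apply: supp_ap.
  - by apply/negP => /asboolP; apply: supp_ap'.
exact: E'_coideal.
Qed.

End RootClass.

(** The measure $|h|+2|k|$ decreases both when k is cut down to its left factor and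
    ([measure_right]) when that left factor moves from k to h. *)
Lemma measure_left (a b c d m : nat) :
  (a + 2 * b < m.+1 -> b = c + d -> 0 < d -> a + 2 * c < m)%N.
Proof. lia. Qed.
Lemma measure_right (a b c d m : nat) :
  (a + 2 * b < m.+1 -> b = c + d -> 0 < c -> a + c + 2 * d < m)%N.
Proof. lia. Qed.

(** * Straightening of Lyndon vectors *)

Section Kharchenko.
Variables (K : fieldType) (V : zmodType) (chi : bichar K V) (n : nat) (rho : 'S_n).
Variable a : 'I_n -> V.
Hypothesis ia : indep a.
Notation S := (sha chi a).
Notation wd := (seq 'I_n).
Implicit Types (x y z : S) (u v w h k l : wd).
Notation "x <w y" := (lexlt rho x y) (at level 70).
Notation "x <=w y" := (lexle rho x y) (at level 70).
Notation lyn := (lyndon rho).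
Notation wg := (wgt a).
Notation cst := (cst rho).

(** The scalar $\chi^{-1}$ turns the product for $q^{-1}$ into the opposite product of the same
    algebra ([inv_mul]), so a Lyndon vector becomes an iterated twisted commutator. *)
Fixpoint rlf (f : nat) (w : wd) : S :=
  match f with
  | 0 => 0
  | f'.+1 => if (size w <= 1)%N then dl chi a w
      else let w1 := take (cst w) w in let w2 := drop (cst w) w in
        rlf f' w1 * rlf f' w2 - (chi (wg w1) (wg w2))^-1 *: (rlf f' w2 * rlf f' w1)
  end.
Definition rl w : S := rlf (size w) w.

Lemma rlf_rl f w : w != [::] -> (size w <= f)%N -> rlf f w = rl w.
Proof.
suff H m : forall f w, w != [::] -> (size w <= m)%N -> (size w <= f)%N -> rlf f w = rlf m w.
  by move=> w0 le; rewrite /rl; apply: H.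
elim: m => [|m IH] {}f {}w w0; first by rewrite leqn0 size_eq0 (negPf w0).
case: f => [|f]; first by rewrite leqn0 size_eq0 (negPf w0).
move=> lem lef /=; case: leqP => // sw.
have [k0 ks _ _] := cst_spec rho sw.
have t0 : take (cst w) w != [::] by rewrite -size_eq0 size_take ks -lt0n.
have d0 : drop (cst w) w != [::] by rewrite -size_eq0 size_drop subn_eq0 -ltnNge.
have st : (size (take (cst w) w) <= m)%N.
  by rewrite size_take ks -ltnS; apply: leq_trans lem.
have sf : (size (take (cst w) w) <= f)%N.
  by rewrite size_take ks -ltnS; apply: leq_trans lef.
have sd (j : nat) : (size w <= j.+1)%N -> (size (drop (cst w) w) <= j)%N.
  by rewrite size_drop; lia.
by rewrite !(IH f) ?sd.
Qed.

Lemma rl_letter i : rl [:: i] = dl chi a [:: i]. Proof. by []. Qed.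

Lemma rl_rec w : (1 < size w)%N ->
  rl w = rl (take (cst w) w) * rl (drop (cst w) w)
    - (chi (wg (take (cst w) w)) (wg (drop (cst w) w)))^-1 *:
      (rl (drop (cst w) w) * rl (take (cst w) w)).
Proof.
move=> sw; have [k0 ks _ _] := cst_spec rho sw.
have t0 : take (cst w) w != [::] by rewrite -size_eq0 size_take ks -lt0n.
have d0 : drop (cst w) w != [::] by rewrite -size_eq0 size_drop subn_eq0 -ltnNge.
rewrite {1}/rl; case e : (size w) (sw) => [|f] // sf; rewrite /= leqNgt e sf /=.
rewrite !rlf_rl //.
  by rewrite size_drop e; lia.
by rewrite size_take ks -ltnS -e.
Qed.

Lemma lyn_ind (P : wd -> Prop) :
  (forall i, P [:: i]) ->
  (forall w1 w2, lyn w1 -> lyn w2 -> w1 <w w2 -> lyn (w1 ++ w2) ->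
     take (cst (w1 ++ w2)) (w1 ++ w2) = w1 -> drop (cst (w1 ++ w2)) (w1 ++ w2) = w2 ->
     rl (w1 ++ w2) = rl w1 * rl w2 - (chi (wg w1) (wg w2))^-1 *: (rl w2 * rl w1) ->
     P w1 -> P w2 -> P (w1 ++ w2)) ->
  forall w, lyn w -> P w.
Proof.
move=> h1 h2 w; have [m] := ubnP (size w); elim: m w => // m IH w lt lw.
have [sw|sw] := leqP (size w) 1.
  by case: w sw lw {lt} => [|i [|]] //= _ _; apply: h1.
have [k0 ks lk _] := cst_spec rho sw; have ld := cst_drop_lyndon lw sw.
have e := cat_take_drop (cst w) w.
have := h2 (take (cst w) w) (drop (cst w) w); rewrite !e; apply => //.
- exact: cst_lt.
- exact: rl_rec.
- by apply: IH => //; rewrite size_take ks; lia.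
- by apply: IH => //; rewrite size_drop; lia.
Qed.

Lemma rl_hom w : lyn w -> hom (wg w) (rl w).
Proof.
elim/lyn_ind => {w} [i|w1 w2 _ _ _ _ _ _ -> h1 h2]; first exact: hom_dl.
rewrite wgt_cat; apply: homB; first exact: homM.
by apply: homZ; rewrite addrC; apply: homM.
Qed.

Lemma rl_U w : lyn w -> U (rl w).
Proof.
elim/lyn_ind => {w} [i|w1 w2 _ _ _ _ _ _ -> h1 h2]; first exact: U_letter.
by apply: agenB; [apply: agenM | apply/agenZ/agenM].
Qed.

(** The twist by $-|h|$ makes the adjoint action of $r_h$ a skew derivation and reproduces the
    bracket of Lyndon vectors on homogeneous elements. *)
Definition adl h x : S := rl h * x - tw (- wg h) x * rl h.

Lemma adlM h x y : adl h (x * y) = adl h x * y + tw (- wg h) x * adl h y.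
Proof. by rewrite /adl twM mulrBl mulrBr !mulrA addrA subrK. Qed.
Lemma adlD h x y : adl h (x + y) = adl h x + adl h y.
Proof. by rewrite /adl raddfD /= mulrDl mulrDr opprD addrACA. Qed.
Lemma adlZ h c x : adl h (c *: x) = c *: adl h x.
Proof. by rewrite /adl linearZ /= -scalerAl -scalerAr scalerBr. Qed.
Lemma adl1 h : adl h 1 = 0.
Proof. by rewrite /adl tw1 mul1r mulr1 subrr. Qed.
Lemma adl_rl h k : lyn k ->
  adl h (rl k) = rl h * rl k - (chi (wg h) (wg k))^-1 *: (rl k * rl h).
Proof. by move=> lk; rewrite /adl (hom_tw _ (rl_hom lk)) bchNl -scalerAl. Qed.

Definition rgen (P : wd -> Prop) : S -> Prop := fun g => exists l, [/\ lyn l, P l & g = rl l].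
(** Because of the bound on the length, no generator strictly above u can have u as a proper prefix;
    the inequality then survives appending letters to u. *)
Definition geg u := rgen (fun l => (u <=w l) /\ (size l <= size u)%N).
Definition gtg u := rgen (fun l => (u <w l) /\ (size l <= size u)%N).
Definition above h := rgen (fun l => h <w l).

Lemma rgen_hom P : homgen (rgen P).
Proof. by move=> _ [l [ll _ ->]]; exists (wg l); apply: rl_hom. Qed.

Lemma rgen_sub P Q x : (forall l, lyn l -> P l -> Q l) -> agen (rgen P) x -> agen (rgen Q) x.
Proof.
by move=> h; apply: agen_sub => _ [l [ll pl ->]]; apply: agen_gen; exists l; split=> //; apply: h.
Qed.

Lemma rgen_in (P : wd -> Prop) l : lyn l -> P l -> agen (rgen P) (rl l).
Proof. by move=> ll pl; apply: agen_gen; exists l. Qed.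

Lemma adl_agen h P Q x : (forall l, lyn l -> P l -> agen Q (adl h (rl l))) ->
  (forall l, lyn l -> P l -> agen Q (rl l)) -> homgen Q -> agen (rgen P) x -> agen Q (adl h x).
Proof.
move=> h1 h2 hQ; suff H : agen (rgen P) x -> agen Q (adl h x) /\ agen Q x by case/H.
elim=> [|u v _ [hu hu'] _ [hv hv']|c u _ [hu hu']|_ u [l [ll pl ->]] _ [hu hu']].
- by rewrite adl1; split; [apply: agen0 | apply: agen1].
- by rewrite adlD; split; apply: agenD.
- by rewrite adlZ; split; apply: agenZ.
split; last by apply: agenM => //; apply: h2.
rewrite adlM; apply: agenD; apply: agenM => //; first exact: h1.
by apply: agen_tw => //; apply: h2.
Qed.

(* in weight |u| the only product of letters >= u involving r_u is r_u itself *)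
Lemma geg_split u x : lyn u -> hom (wg u) x -> agen (geg u) x ->
  exists c y, agen (gtg u) y /\ x = c *: rl u + y.
Proof.
(* Strengthened to the weight $|u|-|v|$, where v collects the generators already split off on the
   left; for nonempty v there is no room left for a factor $r_u$. *)
move=> lu hx; suff H : agen (geg u) x -> forall v, exists c y,
    [/\ agen (gtg u) y, prj (wg u - wg v) x = c *: rl u + y & v != [::] -> c = 0].
  move=> /H/(_ [::])[c [y [hy]]]; rewrite wgt_nil subr0 (hom_prjE hx) => e _.
  by exists c, y.
elim=> [|x1 x2 _ h1 _ h2|d x1 _ h1|_ x1 [l [ll [ul sl] ->]] hx1 IH] v {hx}.
- exists 0, (prj (wg u - wg v) 1); split=> //; last by rewrite scale0r add0r.
  by apply: agen_prj (agen1 _); apply: rgen_hom.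
- have [c1 [y1 [a1 e1 c10]]] := h1 v; have [c2 [y2 [a2 e2 c20]]] := h2 v.
  exists (c1 + c2), (y1 + y2); split; first exact: agenD.
    by rewrite raddfD /= e1 e2 scalerDl addrACA.
  by move=> v0; rewrite c10 // c20 // addr0.
- have [c1 [y1 [a1 e1 c10]]] := h1 v.
  exists (d * c1), (d *: y1); split; first exact: agenZ.
    by rewrite linearZ /= e1 scalerDr scalerA.
  by move=> /c10 ->; rewrite mulr0.
have l0 : l != [::] by apply: lyndon_neq0 ll.
rewrite (prjM _ _ (rl_hom ll)).
case: (le_eqVlt ul) => [eu|ltu].
  rewrite -eu addrAC subrr add0r.
  have e0 g w : prj g x1 w = if wg w == g then x1 w else 0 by [].
  case: (eqVneq v [::]) => [->|v0].
    exists (x1 [::]), 0; split; rewrite ?addr0 //; first exact: agen0.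
    rewrite wgt_nil oppr0; have -> : prj 0 x1 = x1 [::] *: 1.
      apply: shaP => w; rewrite e0 shaZE; case: eqP => [/(wgt_eq0 ia) ->|].
        by rewrite mulr1.
      by case: w => [|i w]; rewrite ?wgt_nil ?mulr0.
    by rewrite -scalerAr mulr1.
  exists 0, 0; split=> //; first exact: agen0.
  have -> : prj (- wg v) x1 = 0.
    apply: shaP => w; rewrite e0; case: eqP => // e.
    have /(wgt_eq0 ia) : wg (v ++ w) = 0 by rewrite wgt_cat e subrr.
    by case: (v) v0.
  by rewrite mulr0 scale0r addr0.
have [c [y [hy e c0]]] := IH (v ++ l).
exists 0, (rl l * y); split=> //; first by apply: agenM => //; apply: rgen_in.
rewrite scale0r add0r -addrA -opprD -wgt_cat e c0 ?scale0r ?add0r //.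
by case: (v) => // ; case: (l) l0.
Qed.

Lemma geg_in u l : lyn l -> u <=w l -> (size l <= size u)%N -> agen (geg u) (rl l).
Proof. by move=> *; apply: rgen_in. Qed.

Lemma adl_hom h k : lyn h -> lyn k -> hom (wg (h ++ k)) (adl h (rl k)).
Proof.
move=> lh lk; rewrite adl_rl // wgt_cat; apply: homB; first exact: homM (rl_hom lh) (rl_hom lk).
by apply: homZ; rewrite addrC; apply: homM (rl_hom lk) (rl_hom lh).
Qed.

(** If the left factor $k_1$ of k is at most h, then hk splits as (h,k) and the bracket is $r_{hk}$.
    Otherwise the Jacobi identity reduces to the brackets of h with $k_1$ and with $k_2$. By
    induction and [geg_split] the former is a multiple of $r_{hk_1}$ plus terms in larger
    generators, and the pair $(hk_1,k_2)$ has smaller measure. *)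
Lemma adl_rl_geg h k : lyn h -> lyn k -> h <w k -> agen (geg (h ++ k)) (adl h (rl k)).
Proof.
have [m] := ubnP (size h + 2 * size k)%N; elim: m h k => // m IH h k lt lh lk hk.
have base : ((1 < size k)%N -> take (cst k) k <=w h) ->
    agen (geg (h ++ k)) (adl h (rl k)).
  move=> hle; have lhk := lyndon_cat lh lk hk.
  have shk : (1 < size (h ++ k))%N.
    by rewrite size_cat; case: (h) lh => // ? ?; case: (k) lk => // ? ? _ _ /=; lia.
  have e := cst_cat lh lk hk hle.
  have := rl_rec shk; rewrite e take_size_cat // drop_size_cat // -adl_rl // => <-.
  by apply: rgen_in => //; split=> //; apply: le_refl.
have [sk|sk] := leqP (size k) 1; first by apply: base; rewrite ltnNge sk.
have [[k0 ks lk1 _] lk2] := (cst_spec rho sk, cst_drop_lyndon lk sk).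
have k12 := cst_lt lk sk; have ek := cat_take_drop (cst k) k.
have er := rl_rec sk.
move: k0 ks lk1 lk2 k12 ek er base; set k1 := take _ k; set k2 := drop _ k.
move=> k0 ks lk1 lk2 k12 ek er base.
have [le|nle] := boolP (k1 <=w h); first by apply: base.
have hk1 : h <w k1.
  by case: (lt_total rho h k1) => // [e|e]; [rewrite e le_refl in nle | rewrite (ltW e) in nle].
have k10 := lyndon_neq0 lk1; have k20 := lyndon_neq0 lk2.
have sk12 : size k = (size k1 + size k2)%N by rewrite -ek size_cat.
have sk1 : (0 < size k1)%N by case: (k1) k10.
have sk2 : (0 < size k2)%N by case: (k2) k20.
have hkk2 : k <w k2.
  by rewrite -{1}ek; apply: lyndon_cat_lt.
have hkk := lyndon_cat_lt lh lk hk.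
set N := geg (h ++ k).
have k2N : agen N (rl k2).
  apply: geg_in => //; last by rewrite size_cat sk12 addnA leq_addl.
  exact: ltW (lt_trans hkk hkk2).
have k1N : agen N (rl k1).
  apply: geg_in => //; last by rewrite size_cat sk12 addnCA leq_addr.
  apply: ltW; case: (dltP hk1) => [d|[x x0 e]].
    by rewrite -(cats0 k1); apply: dlt_lt.
  have d : dlt rho k1 x.
    by rewrite e; apply: lyndon_suffix_dlt => //; [rewrite -e | apply: lyndon_neq0 lh].
  by rewrite e lt_catl -ek -(cats0 x); apply: dlt_lt.
have hk2 : h <w k2 by apply: lt_trans hk1 k12.
have IH1 : agen (geg (h ++ k1)) (adl h (rl k1)).
  by apply: IH => //; apply: measure_left lt sk12 sk2.
have IH2 : agen N (adl h (rl k2)).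
  have : agen (geg (h ++ k2)) (adl h (rl k2)).
    apply: IH => //; apply: leq_trans (measure_right lt sk12 sk1).
    by rewrite ltnS leq_add2r leq_addr.
  apply: rgen_sub => l ll [h1 h2]; split.
    by apply: le_trans h1; apply: ltW; rewrite lt_catl.
  by apply: leq_trans h2 _; rewrite !size_cat leq_add2l sk12 leq_addl.
have lhk1 := lyndon_cat lh lk1 hk1.
have [c [y [hy ey]]] := geg_split lhk1 (adl_hom lh lk1) IH1.
have yN : agen N y.
  apply: rgen_sub hy => l ll [h1 h2]; split; last first.
    by apply: leq_trans h2 _; rewrite !size_cat leq_add2l sk12 leq_addr.
  by rewrite -ek catA; apply: ltW; rewrite -(cats0 l); apply: dlt_lt; apply: lt_dlt.
have hk1k2 : h ++ k1 <w k2 by apply: lt_trans k12; apply: lyndon_cat_lt.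
have IH3 : agen N (adl (h ++ k1) (rl k2)).
  rewrite /N -ek catA; apply: IH => //; rewrite size_cat.
  exact: measure_right lt sk12 sk1.
have hX := adl_hom lh lk1.
rewrite er -scaleN1r adlD !adlZ !adlM scalerDr scalerDr.
rewrite (hom_tw _ (rl_hom lk1)) (hom_tw _ (rl_hom lk2)) -!scalerAl.
set X := adl h (rl k1) in ey hX *; set Y := adl h (rl k2) in IH2 *.
(* The two terms of the Jacobi expansion containing X form its twisted commutator with $r_{k_2}$;
   inserting $X=c\,r_{hk_1}+y$ makes the induction hypothesis for $(hk_1,k_2)$ applicable. *)
have eX : X * rl k2 - (chi (wg (h ++ k1)) (wg k2))^-1 *: (rl k2 * X)
   = c *: adl (h ++ k1) (rl k2) + (y * rl k2 - (chi (wg (h ++ k1)) (wg k2))^-1 *: (rl k2 * y)).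
  rewrite adl_rl // ey mulrDl mulrDr !scalerDr -scalerAl -scalerAr opprD !scalerN.
  rewrite addrACA; congr (_ + _); congr (_ - _).
  by rewrite !scalerA mulrC.
have -> : X * rl k2 + chi (- wg h) (wg k1) *: (rl k1 * Y) +
     ((-1) *: ((chi (wg k1) (wg k2))^-1 *: (Y * rl k1)) +
      (-1) *: ((chi (wg k1) (wg k2))^-1 *: (chi (- wg h) (wg k2) *: (rl k2 * X))))
   = (X * rl k2 - (chi (wg (h ++ k1)) (wg k2))^-1 *: (rl k2 * X)) +
     (chi (- wg h) (wg k1) *: (rl k1 * Y) + (-1) *: ((chi (wg k1) (wg k2))^-1 *: (Y * rl k1))).
  have -> : (-1) *: ((chi (wg k1) (wg k2))^-1 *: (chi (- wg h) (wg k2) *: (rl k2 * X)))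
      = - ((chi (wg (h ++ k1)) (wg k2))^-1 *: (rl k2 * X)).
    by rewrite !scalerA bchNl wgt_cat bchDl invfM mulN1r mulNr scaleNr mulrC.
  by rewrite [X in _ + X]addrC addrACA.
rewrite eX; apply: agenD; apply: agenD.
- exact: agenZ.
- by apply: agenB; [apply: agenM | apply/agenZ/agenM].
- by apply/agenZ/agenM.
- by apply/agenZ/agenZ/agenM.
Qed.

(** The vector $r_{w_1}$ itself need not be available, since $w_1$ is a prefix of w. But the terms
    containing it combine, thanks to the scalar in the Lyndon vector, into the bracket of $r_{w_1}$
    with $L_ir_{w_2}$, which [adl_rl_geg] controls. *)
Lemma Lop_rl i w : lyn w -> agen (gtg w) (Lop i (rl w)).
Proof.
elim/lyn_ind => {w} [j|w1 w2 l1 l2 lt lw _ _ -> h1 h2].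
  by rewrite rl_letter Lop_dl; apply/agenZ/agen1.
have s2 : (size w2 <= size (w1 ++ w2))%N by rewrite size_cat leq_addl.
have w2g : w1 ++ w2 <w w2 by apply: lyndon_cat_lt.
have r2 : agen (gtg (w1 ++ w2)) (rl w2) by apply: rgen_in.
have b1 : agen (gtg (w1 ++ w2)) (Lop i (rl w1)).
  apply: rgen_sub h1 => l ll [h h']; split; last by rewrite size_cat (leq_trans h') ?leq_addr.
  by rewrite -(cats0 l); apply: dlt_lt; apply: lt_dlt.
have gh : homgen (gtg (w1 ++ w2)) by apply: rgen_hom.
have b2 : agen (gtg (w1 ++ w2)) (adl w1 (Lop i (rl w2))).
  apply: (adl_agen _ _ gh h2) => l ll [h h'].
    have := adl_rl_geg l1 ll (lt_trans lt h); apply: rgen_sub => l' ll' [g g'].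
    split; first by apply: lt_le_trans g; rewrite lt_catl.
    by apply: leq_trans g' _; rewrite !size_cat leq_add2l.
  by apply: rgen_in => //; split; [apply: lt_trans h | apply: leq_trans s2].
rewrite LopB LopZ !LopM scalerDr opprD.
have -> : Lop i (rl w1) * tw (a i) (rl w2) + rl w1 * Lop i (rl w2)
    + (- ((chi (wg w1) (wg w2))^-1 *: (Lop i (rl w2) * tw (a i) (rl w1)))
       - (chi (wg w1) (wg w2))^-1 *: (rl w2 * Lop i (rl w1)))
  = (Lop i (rl w1) * tw (a i) (rl w2) - (chi (wg w1) (wg w2))^-1 *: (rl w2 * Lop i (rl w1)))
    + adl w1 (Lop i (rl w2)).
  rewrite /adl (hom_tw _ (rl_hom l1)) (hom_tw _ (@hom_Lop _ _ _ _ _ _ i _ (rl_hom l2))) -scalerAr -scalerAl.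
  rewrite scalerA bchNl bchDr bchNr invfM invrK [chi (a i) _]bchC.
  by rewrite [X in _ + X]addrC addrACA.
apply: agenD => //; apply: agenB; first by apply: agenM => //; apply: agen_tw.
by apply/agenZ/agenM.
Qed.

Lemma above_sub h k x : (k <=w h) -> agen (above h) x -> agen (above k) x.
Proof. by move=> le; apply: rgen_sub => l ll; apply: le_lt_trans. Qed.

Lemma gtg_above h x : agen (gtg h) x -> agen (above h) x.
Proof. by apply: rgen_sub => l ll []. Qed.

Lemma above_coideal h : coideal (agen (above h)).
Proof.
apply: agen_coideal; first exact: rgen_hom.
move=> i _ [l [ll hl ->]]; apply: above_sub (ltW hl) _; apply: gtg_above.
exact: Lop_rl.
Qed.

Lemma above_U h x : agen (above h) x -> U x.
Proof. by apply: agen_sub => _ [l [ll _ ->]]; apply: rl_U. Qed.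

(** Provides the skew commutator hypothesis of [coideal_final] for the algebra above h. *)
Lemma above_adl h x : lyn h -> agen (above h) x -> agen (above h) (adl h x).
Proof.
move=> lh; apply: adl_agen => [l ll hl|l ll hl|]; last exact: rgen_hom.
  have := adl_rl_geg lh ll hl; apply: rgen_sub => l' ll' [g _].
  by apply: lt_le_trans g; apply: lt_prefix; apply: lyndon_neq0 ll.
exact: rgen_in.
Qed.

Lemma Lw_rl_above w h : lyn h -> w != [::] -> agen (above h) (Lw w (rl h)).
Proof.
case: w => // i w lh _; rewrite Lw_cons; apply: coLw; first exact: above_coideal.
by apply: gtg_above; apply: Lop_rl.
Qed.

(* Hard words turn out to be the dominant Lyndon words. *)
Definition hard h := lyn h /\ ~ agen (above h) (rl h).

Variables (Phi : seq V) (C : ('I_n -> V) -> Prop).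
Hypotheses (hC : root_class chi Phi C) (Ca : C a).

Theorem hard_above0 h x : hard h -> agen (above h) x -> hom (wg h) x -> x = 0.
Proof.
move=> [lh hh] hx hom_x; apply/eqP/negP => /negP x0.
have [] := coideal_final hC Ca (above_coideal h) (@above_U h) (rl_U lh) hh (rl_hom lh).
- by move=> i; apply: gtg_above; apply: Lop_rl.
- by move=> e; apply: above_adl.
move=> af [Caf [j ej] h1 _].
have bp : Qp af (wg h) by rewrite ej; apply: Qp_gen.
have sb : supp (agen (above h)) (wg h) by exists x.
have := Qp_anti (rc_indep hC Caf) bp (h1 _ sb).
by move/(wgt_eq0 ia)/eqP; rewrite (negPf (lyndon_neq0 lh)).
Qed.

End Kharchenko.

(** * Dominant words *)

Section Pairing.
Variables (K : fieldType) (V : zmodType) (chi : bichar K V) (I : finType).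
Variable a : I -> V.
Notation S := (sha chi a).
Notation wd := (seq I).
Implicit Types (x y z : S) (u v w : wd) (s t : seq (wd * K)).

Definition Xi w : S := \prod_(i <- w) dl chi a [:: i].
Definition xi_span s : S := \sum_(p <- s) p.2 *: Xi p.1.
Definition word_ev s z : K := \sum_(p <- s) p.2 * z p.1.

Lemma Xi_nil : Xi [::] = 1. Proof. exact: big_nil. Qed.
Lemma Xi_cons i w : Xi (i :: w) = dl chi a [:: i] * Xi w. Proof. exact: big_cons. Qed.
Lemma Xi_cat v w : Xi (v ++ w) = Xi v * Xi w. Proof. exact: big_cat. Qed.
Lemma Xis1 w : xi_span [:: (w, 1)] = Xi w. Proof. by rewrite /xi_span big_seq1 scale1r. Qed.
Lemma Xis_cat s t : xi_span (s ++ t) = xi_span s + xi_span t. Proof. exact: big_cat. Qed.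
Lemma ev_cat s t z : word_ev (s ++ t) z = word_ev s z + word_ev t z. Proof. exact: big_cat. Qed.

Definition scl (c : K) s := [seq (p.1, c * p.2) | p <- s].
Lemma Xis_scl c s : xi_span (scl c s) = c *: xi_span s.
Proof. by rewrite /xi_span big_map scaler_sumr; apply: eq_bigr => p _; rewrite scalerA. Qed.

Definition prods s t := [seq (p.1 ++ r.1, p.2 * r.2) | p <- s, r <- t].
Lemma Xis_prods s t : xi_span (prods s t) = xi_span s * xi_span t.
Proof.
rewrite /xi_span big_allpairs_dep mulr_suml; apply: eq_bigr => p _.
rewrite mulr_sumr; apply: eq_bigr => r _ /=.
by rewrite Xi_cat -scalerAl -scalerAr scalerA.
Qed.

Lemma ev_prods s t z : word_ev (prods s t) z = \sum_(p <- s) p.2 * word_ev t (Lw p.1 z).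
Proof.
rewrite /word_ev big_allpairs_dep; apply: eq_bigr => p _.
by rewrite mulr_sumr; apply: eq_bigr => r _; rewrite mulrA.
Qed.

Lemma Xi_hom w : hom (wgt a w) (Xi w).
Proof.
elim: w => [|i w IH]; first by rewrite Xi_nil wgt_nil; apply: hom1.
rewrite Xi_cons wgt_cons; apply: homM => //.
by have := @hom_dl _ _ chi _ a [:: i]; rewrite wgt_cons wgt_nil addr0.
Qed.

Lemma Xi_U w : U (Xi w).
Proof.
elim: w => [|i w IH]; first by rewrite Xi_nil; apply: agen1.
by rewrite Xi_cons; apply: agenM => //; apply: U_letter.
Qed.

Lemma Xis_U s : U (xi_span s).
Proof.
elim: s => [|p s IH]; first by rewrite /xi_span big_nil; apply: agen0.
by rewrite /xi_span big_cons; apply: agenD => //; apply: agenZ; apply: Xi_U.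
Qed.

Lemma U_Xis x : U x -> exists s, x = xi_span s.
Proof.
elim=> [|u v _ [s ->] _ [t ->]|c u _ [s ->]|_ u [i ->] _ [s ->]].
- by exists [:: ([::], 1)]; rewrite Xis1 Xi_nil.
- by exists (s ++ t); rewrite Xis_cat.
- by exists (scl c s); rewrite Xis_scl.
- exists (prods [:: ([:: i], 1)] s); rewrite Xis_prods Xis1.
  by rewrite Xi_cons Xi_nil mulr1.
Qed.

(** Deletes the letter i from v in all possible ways, u being the part already read; the scalar
    comes from moving i past the letters to its right. *)
Fixpoint ins_sum (i : I) u v (f : wd -> K) : K :=
  match v with
  | [::] => 0
  | j :: v' => (i == j)%:R * chi (a i) (wgt a v') * f (u ++ v') + ins_sum i (rcons u j) v' f
  end.

Lemma Lop_Xi i w v :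
  (Lop i (Xi w)) v = ins_sum i [::] w (fun u => Xi u v).
Proof.
have H : forall w (y : S), Lop i (y * Xi w) = Lop i y * tw (a i) (Xi w) + y * Lop i (Xi w) by [].
suff G : forall u, (Xi u * Lop i (Xi w)) v = ins_sum i u w (fun u => Xi u v).
  by rewrite -G Xi_nil mul1r.
elim: w => [|j w IH] u; first by rewrite Xi_nil Lop1 mulr0.
rewrite Xi_cons LopM Lop_dl mulrDr shaDE /= -IH; congr (_ + _).
  rewrite dl_nil -scalerAl mul1r (hom_tw _ (@Xi_hom w)) scalerA -scalerAr shaZE Xi_cat.
  by [].
by rewrite mulrA -cats1 Xi_cat Xi_cons Xi_nil mulr1.
Qed.

(** The same deletion sum as in [Lop_Xi]: left multiplication by a letter and the derivation at that
    letter are adjoint. *)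
Lemma mul_letter_ins i x v :
  (dl chi a [:: i] * x) v = ins_sum i [::] v x.
Proof.
suff G : forall u, (dl chi a [:: i] * Lw u x) v = ins_sum i u v x by rewrite -G.
elim: v => [|j v IH] u; first by rewrite shaM_nil dlE mul0r.
rewrite -[LHS]/(Lop j (dl chi a [:: i] * Lw u x) v) LopM shaDE /= Lop_dl dl_nil -scalerAl mul1r.
rewrite shaZE; have -> : Lop j (Lw u x) = Lw (rcons u j) x by rewrite -cats1 Lw_cat.
rewrite IH; congr (_ + _).
rewrite [j == i]eq_sym -mulrA; case: eqVneq => [->|_]; last by rewrite !mul0r.
by rewrite !mul1r.
Qed.

Lemma eq_ins_sum i u v f g : f =1 g -> ins_sum i u v f = ins_sum i u v g.
Proof. by move=> h; elim: v u => //= j v IH u; rewrite h IH. Qed.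

(* The pairing (v, w) |-> Xi w v of words is symmetric because chi is. *)
Lemma Xi_sym v w : Xi w v = Xi v w.
Proof.
elim: v w => [|i v IH] w.
  case: w => [|j w] //; rewrite Xi_nil Xi_cons shaM_nil dlE mul0r.
  by [].
rewrite -[LHS]/(Lop i (Xi w) v) Lop_Xi Xi_cons mul_letter_ins.
by apply: eq_ins_sum => u; rewrite IH.
Qed.

Lemma ev_sym s t : word_ev s (xi_span t) = word_ev t (xi_span s).
Proof.
have E s' t' : word_ev s' (xi_span t') = \sum_(p <- s') \sum_(r <- t') p.2 * (r.2 * Xi r.1 p.1).
  rewrite /word_ev; apply: eq_bigr => p _; rewrite -mulr_sumr; congr (_ * _).
  rewrite /xi_span; elim: t' => [|r t' IH]; first by rewrite !big_nil sha0E.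
  by rewrite !big_cons shaDE shaZE IH.
rewrite !E exchange_big; apply: eq_bigr => r _; apply: eq_bigr => p _ /=.
by rewrite mulrCA Xi_sym.
Qed.

(** The pairing of the free algebra with words, carried over to [U] by choosing a preimage of x
    among combinations of products of letters; [bilE] shows independence of the choice. *)
Definition word_form x z : K := word_ev (epsilon (inhabits [::]) (fun s => x = xi_span s)) z.

(** Writing z also as a combination of products of letters and exchanging the arguments, the value
    is seen to depend on the element of [U] alone. *)
Lemma bilE s z : U z -> word_form (xi_span s) z = word_ev s z.
Proof.
move=> /U_Xis[t ->]; rewrite /word_form; set s' := epsilon _ _.
have e : xi_span s = xi_span s' by apply: (epsilon_spec (inhabits [::]) (fun s' => xi_span s = xi_span s')); exists s.
by rewrite !(ev_sym _ t) e.
Qed.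

Lemma bil_Xi w z : U z -> word_form (Xi w) z = z w.
Proof. by move=> hz; rewrite -Xis1 bilE // /word_ev big_seq1 mul1r. Qed.

Lemma bilC x z : U x -> U z -> word_form x z = word_form z x.
Proof.
move=> hx hz; have [s ex] := U_Xis hx; have [t ez] := U_Xis hz.
by rewrite {1}ex bilE // {2}ez bilE // ex ez ev_sym.
Qed.

Lemma bilDl x y z : U x -> U y -> U z -> word_form (x + y) z = word_form x z + word_form y z.
Proof.
move=> /U_Xis[s ->] /U_Xis[t ->] hz.
by rewrite -Xis_cat !bilE // ev_cat.
Qed.

Lemma bilZl c x z : U x -> U z -> word_form (c *: x) z = c * word_form x z.
Proof.
move=> /U_Xis[s ->] hz; rewrite -Xis_scl !bilE // /word_ev big_map mulr_sumr.
by apply: eq_bigr => p _; rewrite mulrA.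
Qed.

Lemma bil0l z : U z -> word_form 0 z = 0.
Proof. by move=> hz; rewrite -[0](scale0r 1) bilZl ?mul0r //; apply: agen1. Qed.

Lemma bil0r x : U x -> word_form x 0 = 0.
Proof. by move=> hx; rewrite bilC ?bil0l //; apply: agen0. Qed.

Lemma Lw_U w z : U z -> U (Lw w z).
Proof. by move=> hz; apply: coLw => //; apply: U_coideal. Qed.

Lemma bilM s y z : U y -> U z ->
  word_form (xi_span s * y) z = \sum_(p <- s) p.2 * word_form y (Lw p.1 z).
Proof.
move=> /U_Xis[t ->] hz; rewrite -Xis_prods bilE // ev_prods.
by apply: eq_bigr => p _; rewrite bilE //; apply: Lw_U.
Qed.

Lemma prj_Xis g s : prj g (xi_span s) = xi_span [seq p <- s | wgt a p.1 == g].
Proof.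
elim: s => [|p s IH]; first by rewrite /xi_span big_nil linear0.
rewrite [xi_span (p :: s)]big_cons raddfD /= -/(xi_span s) IH linearZ /=.
case: eqVneq => [<-|ne]; first by rewrite (hom_prjE (@Xi_hom _)) [RHS]big_cons.
by rewrite (hom_prj0 (@Xi_hom _) ne) scaler0 add0r.
Qed.

Lemma bil_prj g x z : U x -> U z -> hom g x -> word_form x z = word_form x (prj g z).
Proof.
move=> hx /U_Xis[t ->] hg; have ht := Xis_U t.
rewrite prj_Xis bilC // [RHS]bilC //; last exact: Xis_U.
rewrite !bilE // /word_ev big_filter [RHS]big_mkcond; apply: eq_bigr => p _.
by case: eqVneq => // ne; rewrite (homE0 hg ne) mulr0.
Qed.

End Pairing.

(** * Triangularity, and the identification of dominant words *)

Section Triangular.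
Variables (K : fieldType) (V : zmodType) (chi : bichar K V) (n : nat) (rho : 'S_n).
Variable a : 'I_n -> V.
Hypothesis ia : indep a.
Notation S := (sha chi a).
Notation wd := (seq 'I_n).
Implicit Types (x y z : S) (u v w h k l : wd).
Notation "x <w y" := (lexlt rho x y) (at level 70).
Notation "x <=w y" := (lexle rho x y) (at level 70).
Notation lyn := (lyndon rho).
Notation wg := (wgt a).
Notation rl := (@rl K V chi n rho a).
Notation Xi := (@Xi K V chi 'I_n a).
Notation Xis := (@xi_span K V chi 'I_n a).
Notation above := (@above K V chi n rho a).
Notation hard := (@hard K V chi n rho a).

Definition spn (P : wd -> Prop) x := exists s : seq (wd * K),
  (forall p, p \in s -> P p.1) /\ x = Xis s.

Lemma spn0 P : spn P 0.
Proof. by exists [::]; split=> //; rewrite /xi_span big_nil. Qed.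
Lemma spnD P x y : spn P x -> spn P y -> spn P (x + y).
Proof.
move=> [s [hs ->]] [t [ht ->]]; exists (s ++ t); split; last by rewrite Xis_cat.
by move=> p; rewrite mem_cat => /orP[/hs|/ht].
Qed.
Lemma spnZ P c x : spn P x -> spn P (c *: x).
Proof.
move=> [s [hs ->]]; exists (scl c s); split; last by rewrite Xis_scl.
by move=> _ /mapP[p /hs h ->].
Qed.
Lemma spnB P x y : spn P x -> spn P y -> spn P (x - y).
Proof. by move=> hx hy; rewrite -scaleN1r; apply: spnD => //; apply: spnZ. Qed.
Lemma spn_Xi (P : wd -> Prop) w : P w -> spn P (Xi w).
Proof. by move=> h; exists [:: (w, 1)]; rewrite Xis1; split=> // p; rewrite inE => /eqP ->. Qed.
Lemma spn_sub (P Q : wd -> Prop) x : (forall w, P w -> Q w) -> spn P x -> spn Q x.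
Proof. by move=> h [s [hs ->]]; exists s; split=> // p /hs/h. Qed.
Lemma spnM (P Q R : wd -> Prop) x y : (forall u v, P u -> Q v -> R (u ++ v)) ->
  spn P x -> spn Q y -> spn R (x * y).
Proof.
move=> h [s [hs ->]] [t [ht ->]]; exists (prods s t); split; last by rewrite Xis_prods.
by move=> _ /allpairsP[[p r] /= [/hs hp /ht hr ->]]; apply: h.
Qed.
Lemma spn_prj P g x : spn P x -> spn (fun w => P w /\ wg w = g) (prj g x).
Proof.
move=> [s [hs ->]]; rewrite prj_Xis; eexists; split; last by [].
by move=> p; rewrite mem_filter => /andP[/eqP e /hs].
Qed.

Definition fil u := spn (fun v => size v = size u /\ u <=w v).
Definition fgt u := spn (fun v => size v = size u /\ u <w v).

Lemma fil_Xi u : fil u (Xi u).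
Proof. by apply: spn_Xi; split=> //; apply: le_refl. Qed.
Lemma fgt_fil u x : fgt u x -> fil u x.
Proof. by apply: spn_sub => v [e h]; split=> //; apply: ltW. Qed.
Lemma fgt_lt u v x : size v = size u -> u <w v -> fil v x -> fgt u x.
Proof. by move=> e lt; apply: spn_sub => w [e' h]; split; [rewrite e' | apply: lt_le_trans h]. Qed.
Lemma le_cat2 u v u' v' : size u = size u' -> u <=w u' -> v <=w v' -> u ++ v <=w u' ++ v'.
Proof.
move=> e /le_eqVlt[<-|lt] h; first by rewrite le_catl.
by apply: ltW; apply: lt_cat2.
Qed.
Lemma filM u v x y : fil u x -> fil v y -> fil (u ++ v) (x * y).
Proof.
apply: spnM => u' v' [e1 h1] [e2 h2]; split; first by rewrite !size_cat e1 e2.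
by apply: le_cat2 => //; rewrite e1.
Qed.
Lemma fgtMl u v x y : fgt u x -> fil v y -> fgt (u ++ v) (x * y).
Proof.
apply: spnM => u' v' [e1 h1] [e2 h2]; split; first by rewrite !size_cat e1 e2.
by apply: lt_cat2 => //; rewrite e1.
Qed.
Lemma fgtMr u v x y : fil u x -> fgt v y -> fgt (u ++ v) (x * y).
Proof.
apply: spnM => u' v' [e1 h1] [e2 h2]; split; first by rewrite !size_cat e1 e2.
case: (le_eqVlt h1) => [<-|lt]; first by rewrite lt_catl.
by apply: lt_cat2 => //; rewrite e1.
Qed.

Definition lead w x := exists y, fgt w y /\ x = Xi w + y.
Lemma lead_fil w x : lead w x -> fil w x.
Proof. by move=> [y [hy ->]]; apply: spnD; [apply: fil_Xi | apply: fgt_fil]. Qed.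
Lemma leadM u v x y : lead u x -> lead v y -> lead (u ++ v) (x * y).
Proof.
move=> [x' [hx ->]] hy; have fy := lead_fil hy; case: hy => [y' [hy' ey]].
exists (Xi u * y' + x' * y); split.
  by apply: spnD; [apply: fgtMr hy'; apply: fil_Xi | apply: fgtMl].
by rewrite mulrDl {1}ey mulrDr Xi_cat addrA.
Qed.

(** The subtracted product starts at $w_2w_1$, which exceeds $w_1w_2$ since $w_2$ is a proper suffix
    of a Lyndon word. *)
Lemma rl_lead w : lyn w -> lead w (rl w).
Proof.
elim/(@lyn_ind K V chi n rho a) => {w} [i|w1 w2 l1 l2 lt lw _ _ -> h1 h2].
  exists 0; split; first exact: spn0.
  by rewrite addr0 rl_letter Xi_cons Xi_nil mulr1.
have [y [hy ->]] := leadM h1 h2.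
rewrite -addrA; eexists; split; last by [].
apply: spnB => //; apply: spnZ.
apply: (@fgt_lt _ (w2 ++ w1)); first by rewrite !size_cat addnC.
  rewrite -(cats0 (w1 ++ w2)); apply: dlt_lt; apply: lyndon_suffix_dlt;
    [exact: lw | exact: lyndon_neq0 l1 | exact: lyndon_neq0 l2].
by apply: filM; apply: lead_fil.
Qed.

Definition rp (fs : seq wd) : S := \prod_(f <- fs) rl f.

Lemma rp_lead fs : all lyn fs -> lead (flatten fs) (rp fs).
Proof.
elim: fs => [|f fs IH] /=.
  by move=> _; exists 0; split; [apply: spn0 | rewrite /rp big_nil addr0 Xi_nil].
move=> /andP[hf /IH h]; rewrite /rp big_cons; apply: leadM => //; exact: rl_lead.
Qed.
Lemma rp_U fs : all lyn fs -> U (rp fs).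
Proof.
elim: fs => [|f fs IH] /=; first by rewrite /rp big_nil => _; apply: agen1.
by move=> /andP[hf /IH h]; rewrite /rp big_cons; apply: agenM => //; apply: rl_U.
Qed.
Lemma rp_hom fs : all lyn fs -> hom (wg (flatten fs)) (rp fs).
Proof.
elim: fs => [|f fs IH] /=; first by rewrite /rp big_nil wgt_nil => _; apply: hom1.
move=> /andP[hf /IH h]; rewrite /rp big_cons wgt_cat; apply: homM => //; exact: rl_hom.
Qed.
Lemma rp_size fs w : all lyn fs -> rp fs w != 0 -> size w = size (flatten fs).
Proof. by move=> hf /(rp_hom hf) /(wgt_size ia). Qed.

(** Words irreducible for the rewriting into larger words; [good_dom] and [dom_good] identify them
    with the dominant words. *)
Definition good w := ~ fgt w (Xi w).
Definition cf w := canfact rho w.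

Lemma cf_canf w : canf rho w (cf w).
Proof.
apply/canfP; rewrite /cf /canfact.
apply: (epsilon_spec (inhabits [::]) (is_canfact rho w)).
by have [fs /canfP h] := canf_ex rho w; exists fs.
Qed.
Lemma cf_lyn w : all lyn (cf w). Proof. by case: (cf_canf w). Qed.
Lemma cf_flatten w : flatten (cf w) = w. Proof. by case: (cf_canf w). Qed.

Definition Rvec w : S := rp (cf w).
Lemma Rv_lead w : lead w (Rvec w).
Proof. by have := rp_lead (cf_lyn w); rewrite cf_flatten. Qed.
Lemma Rv_U w : U (Rvec w). Proof. exact: rp_U (cf_lyn w). Qed.

Definition rspn (P : wd -> Prop) x := exists s : seq (wd * K),
  (forall p, p \in s -> P p.1) /\ x = \sum_(p <- s) p.2 *: Rvec p.1.

Lemma rspn0 P : rspn P 0.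
Proof. by exists [::]; split=> //; rewrite big_nil. Qed.
Lemma rspnD P x y : rspn P x -> rspn P y -> rspn P (x + y).
Proof.
move=> [s [hs ->]] [t [ht ->]]; exists (s ++ t); split; last by rewrite big_cat.
by move=> p; rewrite mem_cat => /orP[/hs|/ht].
Qed.
Lemma rspnZ P c x : rspn P x -> rspn P (c *: x).
Proof.
move=> [s [hs ->]]; exists (scl c s); split.
  by move=> _ /mapP[p /hs h ->].
by rewrite big_map scaler_sumr; apply: eq_bigr => p _; rewrite scalerA.
Qed.
Lemma rspn_sub (P Q : wd -> Prop) x : (forall w, P w -> Q w) -> rspn P x -> rspn Q x.
Proof. by move=> h [s [hs ->]]; exists s; split=> // p /hs/h. Qed.
Lemma spn_rspn (P Q : wd -> Prop) x : (forall w, P w -> rspn Q (Xi w)) -> spn P x -> rspn Q x.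
Proof.
move=> h [s [hs ->]]; rewrite /xi_span; elim: s hs => [|p s IH] hs; first by rewrite big_nil; apply: rspn0.
rewrite big_cons; apply: rspnD; last by apply: IH => r hr; apply: hs; rewrite inE hr orbT.
by apply: rspnZ; apply: h; apply: hs; rewrite mem_head.
Qed.

Definition gfil u := rspn (fun v => [/\ good v, size v = size u & u <=w v]).

(** Rewriting only moves upwards among the finitely many words of one length, so it stops: a word
    that is not good is replaced by larger ones, a good one by its Lyndon product minus larger
    terms. *)
Lemma Xi_gfil w : gfil w (Xi w).
Proof.
pose N w := #|[set t : (size w).-tuple 'I_n | w <w t]|.
have [m] := ubnP (N w); elim: m w => // m IH w lt.
have [bad|gd] := pselect (fgt w (Xi w)).
  apply: spn_rspn bad => v [sv wv].
  apply: (@rspn_sub (fun u => [/\ good u, size u = size v & v <=w u])).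
    by move=> u [h1 h2 h3]; split; rewrite ?h2 //; apply: ltW; apply: lt_le_trans h3.
  apply: IH; rewrite -ltnS; apply: leq_trans lt; rewrite ltnS /N sv; apply: proper_card.
  apply/properP; split.
    by apply/subsetP => t; rewrite !inE; apply: lt_trans.
  have sv' : size v == size w by apply/eqP.
  by exists (Tuple sv'); rewrite !inE //= lt_irr.
have [y [hy e]] := Rv_lead w.
have -> : Xi w = Rvec w + (-1) *: y by rewrite e scaleN1r addrK.
apply: rspnD.
  by exists [:: (w, 1)]; rewrite big_seq1 scale1r; split=> // p; rewrite inE => /eqP -> /=;
     split=> //; apply: le_refl.
apply: rspnZ; apply: spn_rspn hy => v [sv wv].
apply: (@rspn_sub (fun u => [/\ good u, size u = size v & v <=w u])).
  by move=> u [h1 h2 h3]; split; rewrite ?h2 //; apply: ltW; apply: lt_le_trans h3.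
apply: IH; rewrite -ltnS; apply: leq_trans lt; rewrite ltnS /N sv; apply: proper_card.
apply/properP; split.
  by apply/subsetP => t; rewrite !inE; apply: lt_trans.
have sv' : size v == size w by apply/eqP.
by exists (Tuple sv'); rewrite !inE //= lt_irr.
Qed.

Lemma fil_gfil u x : fil u x -> gfil u x.
Proof.
apply: spn_rspn => v [sv uv]; apply: rspn_sub (Xi_gfil v) => w [h1 h2 h3].
by split; rewrite ?h2 //; apply: le_trans h3.
Qed.

Lemma above_spn h x : agen (above h) x -> spn (fun v => v = [::] \/ h <w v) x.
Proof.
elim=> [|x1 x2 _ h1 _ h2|c x1 _ h1|_ x1 [l [ll hl ->]] _ IH].
- rewrite -[1](Xi_nil chi a); apply: spn_Xi; by left.
- exact: spnD.
- exact: spnZ.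
apply: (spnM _ (lead_fil (rl_lead ll)) IH) => u v [_ lu] _; right.
by apply: lt_le_trans hl _; apply: le_trans lu (le_prefix _ _ _).
Qed.

Lemma not_hard_fgt h : lyn h -> agen (above h) (rl h) -> fgt h (rl h).
Proof.
move=> lh /above_spn/(spn_prj (wg h)); rewrite (hom_prjE (@rl_hom _ _ _ _ _ _ _ lh)).
apply: spn_sub => v [[->|lt] e]; last by split=> //; apply: (wgt_size ia).
by move: (lyndon_neq0 lh); rewrite (wgt_eq0 ia (w := h)) // -e wgt_nil.
Qed.

(** A factor that is not hard is a combination of larger words of its length, and substituting this
    into the product makes the whole word reducible. *)
Lemma good_hard w f : good w -> f \in cf w -> hard f.
Proof.
move=> gw fin; have lf := allP (cf_lyn w) _ fin; split=> // /(not_hard_fgt lf) bad.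
apply: gw; suff : fgt (flatten (cf w)) (Xi (flatten (cf w))) by rewrite cf_flatten.
case/splitPr: fin => s1 s2.
rewrite flatten_cat /= Xi_cat Xi_cat.
have [y [hy e]] := rl_lead lf.
apply: fgtMr; first exact: fil_Xi.
apply: fgtMl; last exact: fil_Xi.
have -> : Xi f = rl f - y by rewrite e addrK.
exact: spnB.
Qed.

Variables (Phi : seq V) (C : ('I_n -> V) -> Prop).
Hypotheses (hC : root_class chi Phi C) (Ca : C a).

Lemma hard_rl_U h : hard h -> U (rl h). Proof. by case=> lh _; apply: rl_U. Qed.

(* orthogonality: L-derivatives of r_h lie in the subalgebra above h, which has no
   element of the weight of a hard k <= h *)
Lemma bil_rp_hard h fs f : hard h -> all lyn fs -> fs != [::] -> hard f -> f <=w h ->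
  word_form (rp fs * rl f) (rl h) = 0.
Proof.
move=> hh hfs fs0 hf le; have [s [hs e]] := lead_fil (rp_lead hfs).
have [lh _] := hh; have [lf _] := hf.
rewrite e bilM; [|exact: hard_rl_U|exact: hard_rl_U].
rewrite big_seq big1 // => p /hs [sp _].
have p0 : p.1 != [::].
  rewrite -size_eq0 sp; case: (fs) fs0 hfs => //= f1 fs1 _ /andP[/lyndon_neq0].
  by case: (f1).
have hL := above_sub le (Lw_rl_above chi ia lh p0).
rewrite (bil_prj (g := wg f)); [|exact: rl_U|exact: above_U hL|exact: rl_hom].
rewrite (hard_above0 ia hC Ca hf (x := prj _ _)) ?bil0r ?mulr0 //.
- exact: rl_U.
- by apply: agen_prj hL; apply: rgen_hom.
- exact: hom_prj.
Qed.

Lemma bil_above_hard h x : hard h -> agen (above h) x -> word_form x (rl h) = 0.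
Proof.
move=> hh hx; have [lh _] := hh.
rewrite bilC; [|exact: above_U hx|exact: rl_U].
rewrite (bil_prj (g := wg h)); [|exact: rl_U|exact: above_U hx|exact: rl_hom].
rewrite (hard_above0 ia hC Ca hh (x := prj _ _)) ?bil0r //.
- exact: rl_U.
- by apply: agen_prj hx; apply: rgen_hom.
- exact: hom_prj.
Qed.

(** The last canonical factor f of w is the smallest. If f is at most h, it is not the only factor
    and [bil_rp_hard] applies. If f exceeds h, the whole product lies in the algebra above h, which
    is orthogonal to $r_h$. *)
Lemma bil_Rv_hard h w : hard h -> good w -> h <w w -> word_form (Rvec w) (rl h) = 0.
Proof.
move=> hh gw lt; rewrite /Rvec.
have := cf_flatten w; have := cf_lyn w; have [_ _ hs] := cf_canf w.
have hhard : forall f, f \in cf w -> hard f by move=> f; apply: good_hard.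
case: (lastP (cf w)) hs hhard => [|fs f] hs hhard hl ef.
  by rewrite -ef in lt; move: lt; case: (h).
have hf : hard f by apply: hhard; rewrite mem_rcons mem_head.
have [le|nle] := boolP (f <=w h).
  have [e|fs0] := eqVneq fs [::].
    move: ef; rewrite e /= cats0 => ef; rewrite ef in le.
    by case: (lt_leN lt le).
  rewrite /rp -cats1 big_cat big_seq1; apply: bil_rp_hard => //.
  by move: hl; rewrite all_rcons => /andP[].
have hfl : h <w f.
  by case: (lt_total rho h f) => // [e|e]; [rewrite e le_refl in nle | rewrite (ltW e) in nle].
apply: bil_above_hard => //; rewrite /rp.
have : forall g, g \in rcons fs f -> lyn g /\ h <w g.
  move=> g gin; split; first exact: (allP hl).
  exact: lt_le_trans hfl (canf_last hl hs gin).
elim: (rcons fs f) => [|g gs IH] hg; first by rewrite big_nil; apply: agen1.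
rewrite big_cons; apply: agenM; last by apply: IH => g' hg'; apply: hg; rewrite inE hg' orbT.
by have [l1 l2] := hg g (mem_head _ _); apply: rgen_in.
Qed.

Lemma bil_sum (s : seq (wd * K)) z : U z ->
  word_form (\sum_(p <- s) p.2 *: Rvec p.1) z = \sum_(p <- s) p.2 * word_form (Rvec p.1) z.
Proof.
move=> hz; suff [_ ->] : U (\sum_(p <- s) p.2 *: Rvec p.1) /\
    word_form (\sum_(p <- s) p.2 *: Rvec p.1) z = \sum_(p <- s) p.2 * word_form (Rvec p.1) z by [].
elim: s => [|p s [IH1 IH2]]; first by rewrite !big_nil bil0l //; split=> //; apply: agen0.
have hp : U (p.2 *: Rvec p.1) by apply: agenZ; apply: Rv_U.
rewrite !big_cons bilDl // bilZl //; last exact: Rv_U.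
by rewrite IH2; split=> //; apply: agenD.
Qed.

(** The coefficient at w is the pairing with the product of the letters of w, which expands into
    Lyndon products of good words not below w, hence above h. *)
Lemma rl_max h w : hard h -> h <w w -> rl h w = 0.
Proof.
move=> hh lt; have hU := hard_rl_U hh; rewrite -(bil_Xi w hU).
have [s [hs ->]] := Xi_gfil w; rewrite bil_sum // big_seq big1 // => p /hs[gp sp wp].
by rewrite bil_Rv_hard ?mulr0 //; apply: lt_le_trans wp.
Qed.

Lemma mul_shuf x y w : (x * y) w != 0 -> exists u v, [/\ x u != 0, y v != 0 & shuf w u v].
Proof.
elim: w x y => [|i w IH] x y.
  rewrite shaM_nil mulf_eq0 negb_or => /andP[hx hy]; exists [::], [::]; split=> //; constructor.
rewrite -[(x * y) (i :: w)]/(Lop i (x * y) w) LopM shaDE => h.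
have [e|/IH[u [v [hu hv hs]]]] := eqVneq ((Lop i x * tw (a i) y) w) 0.
  move: h; rewrite e add0r => /IH[u [v [hu hv hs]]].
  by exists u, (i :: v); split=> //; constructor.
exists (i :: u), v; split=> //; last by constructor.
by apply: contraNneq hv => e; rewrite /tw e mulr0.
Qed.

Lemma mul_max l B fB x y w : lyn l -> canf rho B fB -> (forall f, f \in fB -> f <=w l) ->
  (forall u, x u != 0 -> size u = size l /\ u <=w l) ->
  (forall v, y v != 0 -> size v = size B /\ v <=w B) ->
  (x * y) w != 0 -> w <=w l ++ B.
Proof.
move=> ll hB hl hx hy /mul_shuf[u [v [/hx[su lu] /hy[sv lv] hs]]].
exact: (shuf_le_lyndon ll hB hl hs).
Qed.

Lemma rl_supp h u : hard h -> rl h u != 0 -> size u = size h /\ u <=w h.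
Proof.
move=> hh hu; have [lh _] := hh; split; first exact: wgt_size ia (rl_hom lh hu).
by apply: leNgt => lt; rewrite rl_max ?eqxx in hu.
Qed.

(** Each hard factor has no word above itself, and the shuffle bound says that in nonincreasing
    order nothing exceeds the concatenation. *)
Lemma rp_max fs w : (forall f, f \in fs -> hard f) -> sorted (geW rho) fs -> rp fs w != 0 ->
  w <=w flatten fs.
Proof.
elim: fs w => [|f fs IH] w hf hs.
  by rewrite /rp big_nil; case: w => [|i w]; rewrite ?eqxx // => _; apply: le_refl.
have hf' g : g \in fs -> hard g by move=> gin; apply: hf; rewrite inE gin orbT.
have al : all lyn fs by apply/allP => g /hf' [].
have hff := hf f (mem_head _ _).
rewrite /rp big_cons => hw; apply: (mul_max (fB := fs) _ _ _ _ _ hw).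
- by case: hff.
- by split=> //; apply: path_sorted hs.
- exact: sorted_geW_cons hs.
- by move=> u; apply: rl_supp.
- move=> v hv; split; first exact: (rp_size al).
  by apply: IH => //; apply: path_sorted hs.
Qed.

Lemma Rv_max w v : good w -> w <w v -> Rvec w v = 0.
Proof.
move=> gw lt; apply/eqP/negP => /negP hv; have [_ _ hs] := cf_canf w.
have := rp_max (fun f => @good_hard w f gw) hs hv; rewrite cf_flatten.
exact: lt_leN.
Qed.

Lemma bil_fil w x z : fil w x -> U z -> (forall v, w <=w v -> z v = 0) -> word_form x z = 0.
Proof.
move=> [s [hs ->]] hz h; rewrite bilE // /word_ev big_seq big1 // => p /hs[_ /h ->].
by rewrite mulr0.
Qed.

(** If the coefficient vanished, the vector of w would be orthogonal to the vector of every good v: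
    for v at least w because the latter involves only products over words not below v, for v below w
    by symmetry and [Rv_max]. These vectors span, so the vector of w would be 0 and w reducible. *)
Lemma Rv_lead_neq0 w : good w -> Rvec w w != 0.
Proof.
move=> gw; apply/eqP => e0; have hU := Rv_U w.
have h0 v : w <=w v -> Rvec w v = 0 by case/le_eqVlt => [<-//|]; apply: Rv_max.
suff e : Rvec w = 0.
  apply: gw; have [y [hy ey]] := Rv_lead w.
  have -> : Xi w = 0 - y by rewrite -e ey addrK.
  by apply: spnB => //; apply: spn0.
apply: shaP => v; rewrite -(bil_Xi v hU) sha0E.
have [s [hs ->]] := Xi_gfil v; rewrite bil_sum // big_seq big1 // => p /hs[gp _ _].
have [le|nle] := boolP (w <=w p.1).
  rewrite (bil_fil (lead_fil (Rv_lead p.1)) hU) ?mulr0 // => u hu.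
  by apply: h0; apply: le_trans hu.
have lt : p.1 <w w.
  by case: (lt_total rho p.1 w) => // [e|e]; [rewrite e le_refl in nle | rewrite (ltW e) in nle].
rewrite bilC ?(bil_fil (lead_fil (Rv_lead w))) ?mulr0 //; try exact: Rv_U.
by move=> u hu; apply: Rv_max => //; apply: lt_le_trans hu.
Qed.

Definition dom w := exists u : S, [/\ U u, u w != 0 & forall w', w <w w' -> u w' = 0].

Lemma good_dom w : good w -> dom w.
Proof.
by move=> gw; exists (Rvec w); split; [apply: Rv_U | apply: Rv_lead_neq0 | move=> w'; apply: Rv_max].
Qed.

(** The coefficient of u at w is a pairing with the product of the letters of w. If w were
    reducible, it would be a combination of coefficients at larger words, which vanish. *)
Lemma dom_good w : dom w -> good w.
Proof.
move=> [u [hu uw h]] bad; case/eqP: uw; rewrite -(bil_Xi w hu).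
have [s [hs ->]] := bad; rewrite bilE // /word_ev big_seq big1 // => p /hs[_ /h ->].
by rewrite mulr0.
Qed.

Lemma cf_lyndon w : lyn w -> canf rho w [:: w].
Proof. by move=> lw; split; rewrite /= ?lw ?cats0. Qed.

Lemma dom_hard w : lyn w -> dom w -> hard w.
Proof.
move=> lw /dom_good gw; split=> // /(not_hard_fgt lw) bad; apply: gw.
have [y [hy e]] := rl_lead lw; have -> : Xi w = rl w - y by rewrite e addrK.
exact: spnB.
Qed.

Lemma rspn_max P x b : (forall w, P w -> good w) -> rspn P x ->
  (forall w, x w != 0 -> w <=w b) ->
  exists s : seq (wd * K), (forall p, p \in s -> P p.1 /\ p.1 <=w b) /\
     x = \sum_(p <- s) p.2 *: Rvec p.1.
Proof.
move=> hP [s [hs ex]] hb; have [m] := ubnP (size s).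
elim: m s x hs ex hb => // m IH s x hs ex hb lt.
case es : s => [|p0 s0]; first by exists [::]; split=> //; rewrite ex es.
have [w [ws wmax]] : exists w, w \in map fst s /\ forall p, p \in s -> p.1 <=w w.
  have h0 : map fst s != [::] by rewrite es.
  case ef : (sort (geW rho) (map fst s)) => [|w t].
    by move: (size_sort (geW rho) (map fst s)); rewrite ef /= size_map es.
  exists w; split; first by rewrite -(mem_sort (geW rho)) ef mem_head.
  move=> p ps; have : p.1 \in map fst s by apply: map_f.
  rewrite -(mem_sort (geW rho)) ef inE => /predU1P[->|]; first exact: le_refl.
  by apply: sorted_geW_cons; rewrite -ef; apply: sort_sorted; apply: geW_total.
have gw : P w by case/mapP: ws => p /hs hp ->.
(* The list may contain the same word several times, so its coefficients are added up before testing
   for zero. *)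
pose c := \sum_(p <- s | p.1 == w) p.2.
pose s' := [seq p <- s | p.1 != w].
have ex' : x = c *: Rvec w + \sum_(p <- s') p.2 *: Rvec p.1.
  rewrite ex (bigID (fun p => p.1 == w)) /= big_filter; congr (_ + _).
  by rewrite /c scaler_suml; apply: eq_bigr => p /eqP ->.
have ss' : (size s' < m)%N.
  rewrite -ltnS; apply: leq_trans lt; rewrite ltnS /s' size_filter -(count_predC (fun p => p.1 == w) s).
  rewrite -[X in (X < _)%N]add0n ltn_add2r -has_count; apply/hasP.
  by case/mapP: ws => p ps e; exists p => //; rewrite e.
have hs' p : p \in s' -> P p.1 by rewrite mem_filter => /andP[_ /hs].
have xw : x w = c * Rvec w w.
  rewrite ex' shaDE shaZE; set y := \sum_(p <- s') _.
  suff -> : y w = 0 by rewrite addr0.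
  rewrite /y; have : forall p, p \in s' -> p.1 <w w /\ P p.1.
    move=> p; rewrite mem_filter => /andP[ne ps]; split; last exact: hs.
    by case: (le_eqVlt (wmax p ps)) => // e; rewrite e eqxx in ne.
  elim: (s') => [|p t IHt] ht; first by rewrite big_nil.
  rewrite big_cons shaDE shaZE IHt; last by move=> r hr; apply: ht; rewrite inE hr orbT.
  by have [l1 l2] := ht p (mem_head _ _); rewrite Rv_max ?mulr0 ?addr0 //; apply: hP.
have [c0|c0] := eqVneq c 0.
  move: ex'; rewrite c0 scale0r add0r => ex'; exact: IH hs' ex' hb ss'.
have wb : w <=w b by apply: hb; rewrite xw mulf_neq0 // Rv_lead_neq0 //; apply: hP.
exists s; split=> // p ps; split; first exact: hs.
exact: le_trans (wmax p ps) wb.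
Qed.

(** The lower bound comes from triangularity of the Lyndon vectors. For the upper bound the two
    factors are exchanged in the shuffle, because the bound requires the larger Lyndon word j in
    front. *)
Theorem rl_mul_straighten i j : lyn i -> lyn j -> dom i -> dom j -> i <w j ->
  exists s : seq (wd * K),
    (forall p, p \in s -> [/\ dom p.1, i ++ j <=w p.1 & p.1 <=w j ++ i]) /\
    rl i * rl j = \sum_(p <- s) p.2 *: Rvec p.1.
Proof.
move=> li lj di dj ij; have hi := dom_hard li di; have hj := dom_hard lj dj.
have hf : gfil (i ++ j) (rl i * rl j).
  by apply: fil_gfil; apply: filM; apply: lead_fil; apply: rl_lead.
have hb w : (rl i * rl j) w != 0 -> w <=w j ++ i.
  move=> /mul_shuf[u [v [/(rl_supp hi)[su lu] /(rl_supp hj)[sv lv] hs]]].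
  apply: (shuf_le_lyndon lj (cf_lyndon li) _ (shuf_sym hs) lv lu) => //.
  by move=> f; rewrite inE => /eqP ->; apply: ltW.
have [|s [hs e]] := rspn_max _ hf hb; first by move=> w [].
exists s; split=> // p /hs[[gp _ h1] h2]; split=> //; exact: good_dom.
Qed.

End Triangular.

(** * Fractions and the field of rational functions *)

Lemma frac_eq (F : fieldType) (a b c d : F) : b != 0 -> d != 0 -> a * d = c * b -> a / b = c / d.
Proof. by move=> b0 d0 e; apply/eqP; rewrite eqr_div // e. Qed.
Lemma frac_add (F : fieldType) (a b c d : F) : b != 0 -> d != 0 ->
  (a * d + c * b) / (b * d) = a / b + c / d.
Proof. by move=> b0 d0; rewrite addf_div. Qed.
Lemma frac_mul (F : fieldType) (a b c d : F) : (a * c) / (b * d) = (a / b) * (c / d).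
Proof. by rewrite mulf_div. Qed.

Lemma frac_numden (f : K) :
  f * tof \d_(generic_quotient.repr f) = tof \n_(generic_quotient.repr f).
Proof.
rewrite -[f in X in X * _]generic_quotient.reprK /tof.
set r := generic_quotient.repr f.
rewrite !generic_quotient.piE; apply/generic_quotient.eqmodP.
rewrite /= FracField.equivfE /FracField.mulf !numden_Ratio ?oner_neq0 ?mulf_neq0 ?denom_ratioP //.
by rewrite !mulr1 mulrC.
all: exact: oner_neq0.
Qed.

Lemma tof_inj : injective tof.
Proof. by move=> x y /eqP; rewrite /tof tofrac_eq => /eqP. Qed.
Lemma tof_eq0 p : (tof p == 0) = (p == 0).
Proof. exact: tofrac_eq0. Qed.

HB.instance Definition _ := GRing.RMorphism.on tof.

Definition cK : rat -> K := tof \o polyC.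
HB.instance Definition _ := GRing.RMorphism.on cK.

Lemma cK_ratr : (ratr : rat -> K) =1 cK.
Proof. by move=> x; rewrite (fmorph_eq_rat cK). Qed.

Lemma q_neq0 : q != 0.
Proof. by rewrite /q tof_eq0 polyX_eq0. Qed.

(** * Back to the algebra F *)

Section Evaluation.
Variable b : bool.
Let t : K := if b then - q^-1 else q^-1.

Definition evt (p : {poly rat}) : K := (map_poly (@ratr K) p).[t].

Lemma evtE p : evt p = (map_poly cK p).[t].
Proof. by rewrite /evt (eq_map_poly cK_ratr). Qed.

Lemma evtM p1 p2 : evt (p1 * p2) = evt p1 * evt p2.
Proof. by rewrite !evtE rmorphM hornerM. Qed.
Lemma evtD p1 p2 : evt (p1 + p2) = evt p1 + evt p2.
Proof. by rewrite !evtE rmorphD hornerD. Qed.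
Lemma evt1 : evt 1 = 1.
Proof. by rewrite evtE rmorph1 hornerC. Qed.
Lemma evtX : evt 'X = t.
Proof. by rewrite evtE map_polyX hornerX. Qed.

(** Multiplication by $q^N$, with N the degree, turns $p(\pm q^{-1})$ into the reversed polynomial,
    whose constant term is the leading coefficient of p up to sign. Hence the substitution extends
    to fractions. *)
Lemma evt_eq0 p : (evt p == 0) = (p == 0).
Proof.
have [->|p0] := eqVneq p 0; first by rewrite evtE rmorph0 horner0 eqxx.
apply/negP => /eqP e.
have et : t = (-1) ^+ b * q^-1 by rewrite /t; case: (b); rewrite ?expr1 ?mulN1r ?expr0 ?mul1r.
pose N := (size p).-1.
have sp : size p = N.+1 by rewrite prednK // lt0n size_poly_eq0.
have : tof (\sum_(i < N.+1) (p`_i * (-1) ^+ (b * i)) *: 'X^(N - i)) = q ^+ N * (map_poly cK p).[t].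
  rewrite rmorph_sum /=.
  rewrite horner_coef size_map_poly sp mulr_sumr; apply: eq_bigr => i _.
  rewrite coef_map et -mul_polyC polyCM !rmorphM /= -[tof (p`_i)%:P]/(cK p`_i) -!mulrA [RHS]mulrCA.
  congr (_ * _); rewrite exprMn -exprM exprVn mulrCA; congr (_ * _).
    by rewrite -[tof _]/(cK _) rmorphXn rmorphN1.
  have le : (i <= N)%N by rewrite -ltnS.
  by rewrite rmorphXn; apply: (@expfB_cond K N i q); rewrite (negPf q_neq0).
rewrite -evtE e mulr0 => /eqP; rewrite tof_eq0 => /eqP /(congr1 (fun r : {poly rat} => r`_0)).
rewrite coef0 coef_sum big_ord_recr /= big1 => [|i _]; last first.
  by rewrite coefZ coefXn eq_sym subn_eq0 leqNgt ltn_ord mulr0.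
rewrite add0r coefZ coefXn subnn mulr1 => /eqP; rewrite mulf_eq0 signr_eq0 orbF.
by rewrite -[N]/(size p).-1 -lead_coefE lead_coef_eq0 (negPf p0).
Qed.

Definition barb (f : K) : K :=
  let r := generic_quotient.repr f in evt \n_r / evt \d_r.

(** Frees the bar involution from the chosen representative of a fraction, which makes it a ring
    morphism. *)
Lemma barb_frac (f : K) n d : d != 0 -> f * tof d = tof n -> barb f = evt n / evt d.
Proof.
move=> d0 e; rewrite /barb; set r := generic_quotient.repr f.
have r0 : \d_r != 0 by apply: denom_ratioP.
have e' := frac_numden f; rewrite -/r in e'.
have : \n_r * d = n * \d_r.
  by apply: tof_inj; rewrite !rmorphM /= -e -e' mulrAC.
move/(congr1 evt); rewrite !evtM => ev.
have h1 : evt d != 0 by rewrite evt_eq0.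
have h2 : evt \d_r != 0 by rewrite evt_eq0.
exact: frac_eq h2 h1 ev.
Qed.

Lemma barb_tof p : barb (tof p) = evt p.
Proof. by rewrite (@barb_frac _ p 1) ?oner_eq0 ?rmorph1 ?mulr1 // evt1 divr1. Qed.

Lemma frac_repr (f : K) : exists n d, d != 0 /\ f * tof d = tof n.
Proof.
exists \n_(generic_quotient.repr f), \d_(generic_quotient.repr f).
by split; [apply: denom_ratioP | apply: frac_numden].
Qed.

Lemma barbM f g : barb (f * g) = barb f * barb g.
Proof.
have [n1 [d1 [h1 e1]]] := frac_repr f; have [n2 [d2 [h2 e2]]] := frac_repr g.
rewrite (barb_frac h1 e1) (barb_frac h2 e2) (@barb_frac _ (n1 * n2) (d1 * d2)) ?mulf_neq0 //.
  by rewrite !evtM frac_mul.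
by rewrite !rmorphM /= -e1 -e2 mulrACA.
Qed.

Lemma barbD f g : barb (f + g) = barb f + barb g.
Proof.
have [n1 [d1 [h1 e1]]] := frac_repr f; have [n2 [d2 [h2 e2]]] := frac_repr g.
rewrite (barb_frac h1 e1) (barb_frac h2 e2).
rewrite (@barb_frac _ (n1 * d2 + n2 * d1) (d1 * d2)) ?mulf_neq0 //.
  by rewrite evtD !evtM frac_add // evt_eq0.
rewrite rmorphD !rmorphM /= -e1 -e2.
by move: (tof d1) (tof d2) => x y; rewrite mulrDl mulrA -!mulrA [x * y]mulrC.
Qed.

Lemma barb1 : barb 1 = 1.
Proof. by rewrite -(rmorph1 tof) barb_tof evt1. Qed.

Fact barb_zmod : zmod_morphism barb.
Proof.
move=> f g; apply: (addIr (barb g)); rewrite subrK -barbD subrK //.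
Qed.
HB.instance Definition _ := GRing.isZmodMorphism.Build K K barb barb_zmod.
Fact barb_monoid : monoid_morphism barb.
Proof. by split; [exact: barb1 | exact: barbM]. Qed.
HB.instance Definition _ := GRing.isMonoidMorphism.Build K K barb barb_monoid.

Lemma barb_q : barb q = t.
Proof. by rewrite /q barb_tof evtX. Qed.

End Evaluation.

Lemma q_expn_sign (n : nat) (b : bool) : (0 < n)%N -> q ^+ n != (-1) ^+ b.
Proof.
move=> n0; apply/eqP => e.
have : tof 'X^n = tof ((-1) ^+ b) by rewrite !rmorphXn /= rmorphN1.
move/tof_inj/(congr1 (fun p : {poly rat} => p`_n)).
rewrite coefXn eqxx -[-1]/(-1%:P) -polyCN -rmorphXn /= coefC.
by case: n n0 {e} => // n _ /eqP; rewrite oner_eq0.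
Qed.

Lemma q_expz_sign (d : int) (b : bool) : d != 0 -> q ^ d != (-1) ^+ b.
Proof.
case: d => n h; first by apply: q_expn_sign; rewrite lt0n.
rewrite NegzE -exprz_inv exprz_inv; apply/eqP => e.
have := @q_expn_sign n.+1 b isT; rewrite -[q ^+ _]invrK -[X in X^-1]/(q ^ - (n.+1)%:Z) e.
by case: (b); rewrite ?expr1 ?expr0 ?invrN ?invr1 eqxx.
Qed.

(** * The inverse bicharacter and last-letter derivations *)

Section InverseBichar.
Variables (K : fieldType) (V : zmodType) (chi : bichar K V).

Definition inv_bichar : bichar K V.
Proof.
exists (fun u v => (chi u v)^-1).
- by move=> u v; rewrite bchC.
- by move=> u v w; rewrite bchDl invfM.
- by move=> u v; rewrite invr_eq0 bch_neq0.
Defined.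

Variables (I : finType) (a : I -> V).
Notation S := (sha chi a).
Notation S' := (sha inv_bichar a).

(** Inverting all crossing scalars amounts to exchanging the factors, up to the full crossing scalar
    of the two weights. *)
Lemma inv_mul (x y : S) g h : hom g x -> hom h y ->
  ((x : S') * (y : S') : S') = ((chi g h)^-1 *: (y * x : S) : seq I -> K).
Proof.
move=> hx hy; apply: functional_extensionality_dep => w.
elim: w x y g h hx hy => [|i w IH] x y g h hx hy.
  rewrite shaM_nil shaZE shaM_nil [y _ * x _]mulrC.
  have [->|x0] := eqVneq (x [::]) 0; first by rewrite !mul0r mulr0.
  by rewrite -(hx _ x0) wgt_nil bch0l invr1 mul1r.
have tx : tw (a i) (y : S') = (chi (a i) h)^-1 *: (y : S') by apply: hom_tw.
rewrite -[LHS]/(Lop i ((x : S') * (y : S')) w) LopM tx -scalerAr.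
rewrite -[RHS]/(Lop i ((chi g h)^-1 *: (y * x)) w) LopZ LopM (hom_tw _ hx) -scalerAr.
rewrite !(shaDE, shaZE).
rewrite (IH _ _ _ _ (@hom_Lop _ _ _ _ _ _ i _ hx) hy) (IH _ _ _ _ hx (@hom_Lop _ _ _ _ _ _ i _ hy)).
rewrite !shaZE !(bchDl, bchDr, bchNl, bchNr) !invfM !invrK [chi g (a i)]bchC.
rewrite mulrDr addrC; congr (_ + _); first by rewrite mulrA.
by rewrite [_^-1 * chi (a i) h]mulrC -[chi (a i) h * _ * _]mulrA mulKf // bch_neq0.
Qed.

(** The shuffle product of the statement recurses on last letters, the algebra used here on first
    letters; the Leibniz rule [RopM] reconciles them. *)
Definition Rop (i : I) (x : S) : S := fun w => x (rcons w i).

Lemma RopM i x y : Rop i (x * y) = Rop i x * y + tw (a i) x * Rop i y.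
Proof.
apply: shaP => w; elim: w x y => [|j w IH] x y.
  rewrite -[LHS]/(Lop i (x * y) [::]) LopM !shaDE !shaM_nil.
  by rewrite /tw !wgt_nil !bch0r !mul1r.
rewrite -[LHS]/(Rop i (Lop j (x * y)) w) LopM.
have RD (u v : S) : Rop i (u + v) w = Rop i u w + Rop i v w by [].
rewrite RD !IH -[RHS]/(Lop j (Rop i x * y + tw (a i) x * Rop i y) w) LopD !LopM !shaDE.
rewrite Lop_tw -scalerAl shaZE.
have -> : Rop i (tw (a j) y) = chi (a j) (a i) *: tw (a j) (Rop i y).
  apply: shaP => u; rewrite shaZE /Rop /tw -cats1 wgt_cat wgt_cons wgt_nil addr0 bchDr.
  by rewrite mulrCA mulrA.
rewrite -scalerAr shaZE ?shaDE [chi (a j) _]bchC.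
by rewrite -!addrA; congr (_ + _); rewrite addrCA.
Qed.

End InverseBichar.

(** * Comparison of formal sums of words with the shuffle algebra *)

Section Coefficients.
Variable D : sdatum.
Implicit Types x y : F D.

Lemma coef_nil w : coefF ([::] : F D) w = 0. Proof. exact: big_nil. Qed.
Lemma coef_cons p x w : coefF (p :: x) w = (p.1 == w)%:R * p.2 + coefF x w.
Proof. by rewrite /coefF big_cons; case: eqP; rewrite ?mul1r ?mul0r ?add0r. Qed.
Lemma coef_cat x y w : coefF (x ++ y) w = coefF x w + coefF y w.
Proof. exact: big_cat. Qed.
Lemma coef_scale c x w : coefF (scaleF c x) w = c * coefF x w.
Proof. by rewrite /coefF big_map mulr_sumr. Qed.

Lemma coef_map_rcons (x : F D) (i : letter D) (c : K) w :
  coefF [seq (rcons p.1 i, c * p.2) | p <- x] w =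
  match lastP w with
  | LastNil => 0
  | LastRcons u k => (i == k)%:R * (c * coefF x u)
  end.
Proof.
case: lastP => [|u k].
  by rewrite /coefF big_map big1 // => p; rewrite -size_eq0 size_rcons.
elim: x => [|p x IH]; first by rewrite !coef_nil !mulr0.
rewrite /= !coef_cons IH /= eqseq_rcons.
by case: (p.1 == u); case: (i == k); rewrite /= ?mul1r ?mul0r ?add0r ?mulrDr.
Qed.

End Coefficients.

Section Transfer.
Variables (D : sdatum) (V : zmodType) (chi : bichar K V) (a : 'I_(rank D) -> V).
Variable G : 'I_(rank D) -> 'I_(rank D) -> int.
Hypothesis hG : forall i j, Defs.bil (@sroot D i) (@sroot D j) = (G i j)%:~R.
Hypothesis hchi : forall i j, chi (a i) (a j) = (-1) ^+ (par i && par j) * q ^ (- G i j).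
Notation wd := (word D).
Notation S := (sha chi a).
Notation dlw := (@dl K V chi 'I_(rank D) a).

Lemma bil_wt (w : wd) j : Defs.bil (wt w) (@sroot D j) = (\sum_(i <- w) G i j)%:~R.
Proof.
elim: w => [|i w IH].
  by rewrite /wt !big_nil /Defs.bil !mul0mx mxE.
rewrite /wt !big_cons -/(wt w) rmorphD /= -IH -hG /Defs.bil.
by rewrite !mulmxDl mxE.
Qed.

Lemma ip_wt (w : wd) j : ip (wt w) (@sroot D j) = \sum_(i <- w) G i j.
Proof. by rewrite /ip bil_wt numq_int. Qed.

Lemma chi_wgt (w : wd) j : chi (wgt a w) (a j) =
  (-1) ^+ (wpar w && par j) * q ^ (- ip (wt w) (@sroot D j)).
Proof.
rewrite ip_wt; elim: w => [|i w IH].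
  by rewrite wgt_nil bch0l big_nil oppr0 expr0z mulr1.
rewrite wgt_cons bchDl IH hchi big_cons opprD expfzDr ?q_neq0 // mulrACA; congr (_ * _).
rewrite -signr_addb; congr (_ ^+ nat_of_bool _); rewrite /wpar /= oddD.
by case: (par i); case: (par j); case: (odd _).
Qed.

Lemma wt_rcons (w : wd) i : wt (rcons w i) = wt w + @sroot D i.
Proof. by rewrite /wt -cats1 big_cat big_seq1. Qed.
Lemma wpar_rcons (w : wd) i : wpar (rcons w i) = wpar w (+) par i.
Proof. by rewrite /wpar -cats1 count_cat oddD /= addn0; case: (par i). Qed.

Section Shr.
Variables (v : K) (psi : bichar K V).
Hypothesis hpsi : forall (w : wd) j, psi (wgt a w) (a j) =
  (-1) ^+ (wpar w && par j) * v ^ (- ip (wt w) (@sroot D j)).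
Notation T := (sha psi a).
Notation dT := (@dl K V psi 'I_(rank D) a).

Lemma Rop_dl (i j : letter D) w : Rop i (dT (rcons w j)) = (i == j)%:R *: dT w.
Proof.
apply: shaP => u; rewrite shaZE /Rop !dlE eqseq_rcons.
by case: (u == w); case: (i == j); rewrite /= ?mulr0 ?mul0r ?mul1r.
Qed.

Lemma coef_shr xr yr : (coefF (shr v xr yr) : T) = dT (rev xr) * dT (rev yr).
Proof.
have one (w : wd) : (coefF [:: (w, 1)] : T) = dT w.
  by apply: shaP => u; rewrite coef_cons coef_nil addr0 mulr1 dlE eq_sym.
elim: xr yr => [|i xr IHx].
  move=> yr; have -> : dT (rev [::]) * dT (rev yr) = dT (rev yr).
    by rewrite [dT (rev [::])]dl_nil mul1r.
  by rewrite -one; case: yr.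
elim=> [|j yr IHy].
  by rewrite [dT (rev [::])]dl_nil mulr1 -one.
have e : shr v (i :: xr) (j :: yr) =
   [seq (rcons p.1 i, p.2) | p <- shr v xr (j :: yr)]
   ++ [seq (rcons p.1 j, (-1) ^+ ((wpar (rev xr) (+) par i) && par j)
                 * v ^ (- ip (wt (rev xr) + @sroot D i) (@sroot D j)) * p.2)
           | p <- shr v (i :: xr) yr] by [].
have e1 : [seq (rcons p.1 i, p.2) | p <- shr v xr (j :: yr)]
   = [seq (rcons p.1 i, 1 * p.2) | p <- shr v xr (j :: yr)].
  by apply: eq_map => p; rewrite mul1r.
apply: shaP => w; rewrite e e1 coef_cat !coef_map_rcons.
case: lastP => [|u k]; first by rewrite !rev_cons shaM_nil dlE eq_sym -size_eq0 size_rcons mul0r addr0.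
rewrite -[RHS]/(Rop k (dT (rev (i :: xr)) * dT (rev (j :: yr))) u) RopM !rev_cons !Rop_dl.
rewrite tw_dl -wpar_rcons -wt_rcons bchC -hpsi -!scalerAl -scalerAr shaDE !shaZE -rev_cons.
have -> := congr1 (fun z : T => z u) (IHx (j :: yr)).
have -> := congr1 (fun z : T => z u) IHy.
rewrite !rev_cons mul1r [i == k]eq_sym [j == k]eq_sym; congr (_ + _).
by case: eqP => [->|_]; rewrite ?mul0r ?mulr0 // !mul1r.
Qed.

Lemma coef_mulF (x y : F D) : (coefF (mulF v x y) : T) = (coefF x : T) * (coefF y : T).
Proof.
have cw (z : F D) : (coefF z : T) = \sum_(p <- z) p.2 *: dT p.1.
  elim: z => [|p z IH]; first by rewrite big_nil; apply: shaP => w; rewrite coef_nil.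
  rewrite big_cons -IH; apply: shaP => w; rewrite coef_cons shaDE shaZE dlE eq_sym mulrC.
  by [].
rewrite (cw x) (cw y) mulr_suml /mulF.
have sc c (z : F D) : (coefF [seq (r.1, c * r.2) | r <- z] : T) = c *: (coefF z : T).
  by apply: shaP => w; rewrite shaZE -coef_scale.
have fl (ls : seq (F D)) : (coefF (flatten ls) : T) = \sum_(l <- ls) (coefF l : T).
  elim: ls => [|l ls IH]; first by rewrite big_nil; apply: shaP => w; rewrite coef_nil.
  by rewrite big_cons -IH; apply: shaP => w; rewrite /= coef_cat shaDE.
rewrite fl big_allpairs_dep; apply: eq_bigr => p _; rewrite mulr_sumr; apply: eq_bigr => r _.
by rewrite sc /shuffle coef_shr !revK -scalerAl -scalerAr scalerA.
Qed.

End Shr.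

Notation phi x := (coefF x : S).

Lemma phi_star (x y : F D) : phi (star x y) = phi x * phi y.
Proof. by apply: coef_mulF => w j; rewrite chi_wgt. Qed.

(** Passing from $q$ to $q^{-1}$ inverts the bicharacter, the signs being their own inverses. *)
Lemma phi_star_inv (x y : F D) g h : hom g (phi x) -> hom h (phi y) ->
  phi (mulF q^-1 x y) = (chi g h)^-1 *: (phi y * phi x).
Proof.
move=> hx hy; rewrite -(inv_mul hx hy).
apply: (@coef_mulF q^-1 (inv_bichar chi)) => w j.
rewrite /= chi_wgt invfM exprz_inv; congr (_ * _); last by rewrite invr_expz.
by case: (_ && _); rewrite ?expr1 ?expr0 ?invrN ?invr1.
Qed.

Lemma phi_cat (x y : F D) : phi (x ++ y) = phi x + phi y.
Proof. by apply: shaP => w; rewrite coef_cat. Qed.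
Lemma phi_scale c (x : F D) : phi (scaleF c x) = c *: phi x.
Proof. by apply: shaP => w; rewrite coef_scale. Qed.
Lemma phi_one (w : wd) : phi [:: (w, 1)] = dlw w.
Proof. by apply: shaP => u; rewrite coef_cons coef_nil addr0 mulr1 dlE eq_sym. Qed.
Lemma phi_unit : phi (unitF D) = 1.
Proof. by rewrite phi_one. Qed.

Lemma inU_U x : inU x -> U (phi x).
Proof.
elim=> [|i|u v _ hu _ hv|c u _ hu|u v _ hu _ hv|u v _ hu e].
- by rewrite phi_unit; apply: agen1.
- by rewrite phi_one; apply: U_letter.
- by rewrite phi_cat; apply: agenD.
- by rewrite phi_scale; apply: agenZ.
- by rewrite phi_star; apply: agenM.
- by have -> : phi v = phi u by apply: shaP => w; rewrite e.
Qed.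

Lemma U_inU (x : S) : U x -> exists2 u, inU u & phi u = x.
Proof.
elim=> [|u v _ [u' hu <-] _ [v' hv <-]|c u _ [u' hu <-]|_ u [i ->] _ [u' hu <-]].
- by exists (unitF D); [constructor | rewrite phi_unit].
- by exists (u' ++ v'); [constructor | rewrite phi_cat].
- by exists (scaleF c u'); [constructor | rewrite phi_scale].
- by exists (star [:: ([:: i], 1)] u'); [repeat constructor | rewrite phi_star phi_one].
Qed.

Variable rho : 'S_(rank D).

Lemma dominantE w : dominant rho w <-> dom chi rho a w.
Proof.
split=> [[u [hu [h1 h2]]]|[u [/U_inU[u' hu <-] h1 h2]]].
  by exists (phi u); split=> //; apply: inU_U.
by exists u'.
Qed.

Notation rl := (@rl K V chi (rank D) rho a).
Notation rlf := (@rlf K V chi (rank D) rho a).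

Lemma rlf_hom f w : hom (wgt a w) (rlf f w).
Proof.
elim: f w => [|f IH] w /=; first exact: hom0.
case: ifP => _; first exact: hom_dl.
rewrite -[w in wgt _ w](cat_take_drop (cst rho w)) wgt_cat.
apply: homB; first exact: homM.
by apply: homZ; rewrite addrC; apply: homM.
Qed.

Lemma phi_rvec f w : phi (rvec rho f w) = rlf f w.
Proof.
elim: f w => [|f IH] w /=; first by apply: shaP => u; rewrite coef_nil.
case: ifP => _; first exact: phi_one.
rewrite /starqq phi_cat phi_scale scaleN1r -!IH -phi_star.
rewrite (@phi_star_inv _ _ (wgt a (take (cst rho w) w)) (wgt a (drop (cst rho w) w))) //;
  by rewrite IH; apply: rlf_hom.
Qed.

Lemma phi_rv w : phi (rv rho w) = rl w.
Proof. exact: phi_rvec. Qed.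

End Transfer.

(** * Nonvanishing of quantum integers *)

Lemma q_expz_pow (d : int) k : (q ^ d) ^+ k = q ^ (d * k%:Z).
Proof. by rewrite -exprz_exp. Qed.

Lemma expr_sub_neq0 (E : fieldType) (v : E) k : v != 0 -> v ^+ (k + k) != 1 ->
  v ^+ k - v ^- k != 0.
Proof.
move=> v0; apply: contraNneq => /subr0_eq e.
by rewrite exprD {1}e mulVf // expf_neq0.
Qed.

Lemma expr_sub_sign_neq0 (E : fieldType) (v : E) k : v != 0 -> v ^+ (k + k) != (-1) ^+ odd k ->
  (-1) ^+ k * v ^+ k - v ^- k != 0.
Proof.
move=> v0; rewrite signr_odd; apply: contraNneq => /subr0_eq e.
have e' : (-1) ^+ k * (v ^+ k * v ^+ k) = 1 by rewrite mulrA e mulVf // expf_neq0.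
have s2 : (-1) ^+ k * (-1) ^+ k = 1 :> E by rewrite -expr2 sqrr_sign.
have s0 : (-1) ^+ k != 0 :> E by rewrite signr_eq0.
by apply/eqP; apply: (mulfI s0); rewrite exprD e' s2.
Qed.

Lemma q_pow_sign (d : int) k (c : bool) : d != 0 -> (q ^ d) ^+ (k.+1 + k.+1) != (-1) ^+ c.
Proof. by move=> d0; rewrite q_expz_pow q_expz_sign // mulf_neq0. Qed.

Lemma qint_neq0 (d : int) m : d != 0 -> qint (q ^ d) m.+1 != 0.
Proof.
move=> d0; have v0 : q ^ d != 0 by rewrite expfz_neq0 // q_neq0.
have H k := expr_sub_neq0 v0 (q_pow_sign k false d0).
by rewrite /qint; apply: mulf_neq0; [apply: H | rewrite invr_eq0; apply: (H 0%N)].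
Qed.

Lemma qintpi_neq0 (d : int) m : d != 0 -> qintpi (q ^ d) m.+1 != 0.
Proof.
move=> d0; have v0 : q ^ d != 0 by rewrite expfz_neq0 // q_neq0.
have H k := expr_sub_sign_neq0 v0 (q_pow_sign k (odd k.+1) d0).
rewrite /qintpi; apply: mulf_neq0; first exact: H.
by rewrite invr_eq0; have := H 0%N; rewrite !expr1 mulN1r.
Qed.

(** * The antiautomorphism sigma and the vectors E *)

Section Sigma.
Variables (D : sdatum) (V : zmodType) (chi : bichar K V) (a : 'I_(rank D) -> V).
Variable G : 'I_(rank D) -> 'I_(rank D) -> int.
Hypothesis hG : forall i j, Defs.bil (@sroot D i) (@sroot D j) = (G i j)%:~R.
Hypothesis hchi : forall i j, chi (a i) (a j) = (-1) ^+ (par i && par j) * q ^ (- G i j).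
Hypothesis hd : diso D != 0.
Hypothesis heven : barneg D -> forall i j, exists e, G i j = e + e.
Notation wd := (word D).
Notation S := (sha chi a).
Notation phi x := (coefF x : S).
Notation b := (barneg D).

Let m1_neq0 : (-1 : K) != 0. Proof. by rewrite oppr_eq0 oner_neq0. Qed.

Lemma chi_wgt_sum (u : wd) i : chi (wgt a u) (a i) =
  (-1) ^ (\sum_(j <- u) ((par j && par i : bool) : nat)%:Z)
  * q ^ (- \sum_(j <- u) ip (@sroot D j) (@sroot D i)).
Proof.
elim: u => [|j u IH]; first by rewrite wgt_nil bch0l !big_nil oppr0 !expr0z mulr1.
rewrite wgt_cons bchDl IH !big_cons opprD (expfzDr _ _ m1_neq0) (expfzDr _ _ q_neq0).
by rewrite hchi {2}/ip hG numq_int mulrACA.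
Qed.

Lemma pairsum_rcons (g : letter D -> letter D -> int) u i :
  pairsum g (rcons u i) = pairsum g u + \sum_(j <- u) g j i.
Proof.
elim: u => [|j u IH]; first by rewrite /= !big_nil addr0.
by rewrite /= IH -cats1 big_cat big_seq1 big_cons !addrA; congr (_ + _); rewrite addrAC.
Qed.

Lemma barword_rcons (u : wd) i : barword (rcons u i) = barword u * chi (wgt a u) (a i).
Proof.
rewrite /barword !pairsum_rcons opprD (expfzDr _ _ m1_neq0) (expfzDr _ _ q_neq0).
by rewrite chi_wgt_sum mulrACA.
Qed.

Lemma wgt_rev (u : wd) : wgt a (rev u) = wgt a u.
Proof. by apply: perm_big; apply/permEl/perm_rev. Qed.

(** The product of the bicharacter over all pairs of letters of the word; a new first letter
    contributes just a twist ([kw_cons]). *)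
Definition kw (w : wd) : K := barword (rev w).
Lemma kw_nil : kw [::] = 1.
Proof. by rewrite /kw /barword /= oppr0 !expr0z mulr1. Qed.
Lemma kw_cons i w : kw (i :: w) = chi (a i) (wgt a w) * kw w.
Proof. by rewrite /kw rev_cons barword_rcons wgt_rev bchC mulrC. Qed.

(** Bar and reversal both reverse words, so their composite fixes every word and changes
    coefficients only. *)
Definition sg (x : S) : S := fun w => barb b (x w) * kw w.

Lemma phi_sigma x : phi (sigmaF x) = sg (phi x).
Proof.
apply: shaP => w; rewrite /sg; elim: x => [|p x IH].
  by rewrite !coef_nil rmorph0 mul0r.
rewrite /sigmaF /= !coef_cons [X in _ + X]IH /= revK rmorphD /= mulrDl; congr (_ + _).
case: eqP => [<-|_]; last by rewrite !mul0r rmorph0 mul0r.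
by rewrite !mul1r /kw.
Qed.

(** In type $B(0,n+1)$ the bar sends q to $-q^{-1}$; the form takes even values there, so no sign
    appears. *)
Lemma barb_chi i j : barb b (chi (a i) (a j)) = (chi (a i) (a j))^-1.
Proof.
rewrite hchi rmorphM rmorphXn rmorphN1 invfM /=; congr (_ * _).
  by case: (_ && _); rewrite ?expr1 ?expr0 ?invrN ?invr1.
rewrite rmorphXz ?unitfE ?q_neq0 //= barb_q invr_expz opprK.
case hb : (barneg D); last by rewrite exprz_inv opprK.
have [e ->] := heven hb i j.
have mq0 : - q != 0 by rewrite oppr_eq0 q_neq0.
rewrite -invrN exprz_inv opprK (expfzDr _ _ mq0) (expfzDr _ _ q_neq0).
by rewrite -!expfzMl mulrNN.
Qed.

Lemma barb_chi_wgt i w : barb b (chi (a i) (wgt a w)) = (chi (a i) (wgt a w))^-1.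
Proof.
elim: w => [|j w IH]; first by rewrite wgt_nil bch0r rmorph1 invr1.
by rewrite wgt_cons bchDr rmorphM /= IH barb_chi invfM.
Qed.

Lemma sgD x y : sg (x + y) = sg x + sg y.
Proof. by apply: shaP => w; rewrite shaDE /sg shaDE rmorphD /= mulrDl. Qed.
Lemma sgZ c x : sg (c *: x) = barb b c *: sg x.
Proof. by apply: shaP => w; rewrite [RHS]shaZE /sg shaZE rmorphM /= [RHS]mulrA. Qed.
Lemma sg1 : sg 1 = 1.
Proof.
apply: shaP => -[|i w]; rewrite /sg; first by rewrite sha1_nil rmorph1 kw_nil mulr1.
by rewrite -[(1 : S) _]/(0 : K) rmorph0 mul0r.
Qed.
Lemma Lop_sg i x : Lop i (sg x) = tw (a i) (sg (Lop i x)).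
Proof. by apply: shaP => w; rewrite /Lop /sg kw_cons /tw mulrCA. Qed.
Lemma sg_tw i x : sg (tw (a i) x) = tw (- a i) (sg x).
Proof. by apply: shaP => w; rewrite /sg /tw rmorphM /= barb_chi_wgt bchNl -[LHS]mulrA. Qed.

(** By [Lop_sg], sigma turns the twist on one term of the Leibniz rule into a twist on the other,
    which is the Leibniz rule of the opposite product. *)
Lemma sgM x y : sg (x * y) = sg y * sg x.
Proof.
apply: shaP => w; elim: w x y => [|i w IH] x y.
  by rewrite shaM_nil /sg shaM_nil rmorphM /= kw_nil !mulr1 mulrC.
rewrite -[LHS]/(Lop i (sg (x * y)) w) Lop_sg LopM sgD /tw shaDE !IH sg_tw mulrDr.
rewrite -[RHS]/(Lop i (sg y * sg x) w) LopM shaDE addrC; congr (_ + _).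
  by rewrite Lop_sg -twM.
rewrite Lop_sg -{2}(twNK (a i) (sg y)) -twM.
by [].
Qed.

Lemma sgX x m : sg (x ^+ m) = sg x ^+ m.
Proof. by elim: m => [|m IH]; [rewrite !expr0 sg1 | rewrite exprS exprSr sgM IH]. Qed.

Lemma dR_neq0 (v : 'rV[rat]_(amb D)) : dR v != 0.
Proof. by rewrite /dR; case: ifPn => h; [exact: hd | rewrite numq_eq0 mulf_neq0]. Qed.

Lemma qnum_neq0 (v : 'rV[rat]_(amb D)) m : qnum v m.+1 != 0.
Proof. by rewrite /qnum; case: ifP => _; [apply: qintpi_neq0 | apply: qint_neq0]; apply: dR_neq0. Qed.

Lemma qfact_neq0 (v : 'rV[rat]_(amb D)) m : qfact v m != 0.
Proof. by rewrite /qfact; apply/prodf_neq0 => i _; apply: qnum_neq0. Qed.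

Variable rho : 'S_(rank D).
Notation rl := (@rl K V chi (rank D) rho a).
Notation Rv := (@Rvec K V chi (rank D) rho a).

Lemma kappa_neq0 (w : wd) : kappa rho w != 0.
Proof.
rewrite /kappa; move: (size w) => f; elim: f w => [|f IH] w /=; first exact: oner_neq0.
case: ifP => _; first exact: oner_neq0.
by rewrite !mulf_neq0 ?IH ?qnum_neq0.
Qed.

Lemma phi_EL w : phi (EL rho w) = (kappa rho w)^-1 *: sg (rl w).
Proof. by rewrite /EL phi_scale phi_sigma (phi_rv hG hchi). Qed.

Lemma phi_iter x m : phi (iter m (star x) (unitF D)) = phi x ^+ m.
Proof.
elim: m => [|m IH]; first by rewrite phi_unit.
by rewrite iterS (phi_star hG hchi) IH exprS.
Qed.

Lemma phi_Epow w m : exists2 c, c != 0 & phi (Epow rho w m) = c *: sg (rl w ^+ m).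
Proof.
exists ((qfact (wt w) m)^-1 * (kappa rho w)^-1 ^+ m).
  by rewrite mulf_neq0 ?expf_neq0 ?invr_eq0 ?qfact_neq0 ?kappa_neq0.
by rewrite /Epow phi_scale phi_iter phi_EL sgX exprZn scalerA.
Qed.

Lemma prod_runs (fs : seq wd) : \prod_(f <- fs) rl f = \prod_(lm <- runs fs) rl lm.1 ^+ lm.2.
Proof.
elim: fs => [|f fs IH]; first by rewrite !big_nil.
rewrite big_cons IH /=; case: (runs fs) => [|[l m] rs]; first by rewrite big_seq1 big_nil mulr1.
case: eqVneq => [->|_]; rewrite !big_cons /=; first by rewrite exprS mulrA.
by rewrite expr1.
Qed.

(** All normalizing constants are nonzero. The fold multiplies each further power on the left, which
    is the reversal that sigma performs on the Lyndon product. *)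
Lemma phi_Ew w : exists2 c, c != 0 & phi (Ew rho w) = c *: sg (Rv w).
Proof.
rewrite /Ew /Rvec /rp /cf prod_runs.
(* Generalized over the accumulator, which corresponds to the Lyndon product of the powers already
   read. *)
suff H : forall (rs : seq (wd * nat)) acc y, (exists2 c, c != 0 & phi acc = c *: sg y) ->
    exists2 c, c != 0 & phi (foldl (fun acc lm => star (Epow rho lm.1 lm.2) acc) acc rs)
      = c *: sg (y * \prod_(lm <- rs) rl lm.1 ^+ lm.2).
  have [|c c0 e] := H (runs (canfact rho w)) (unitF D) 1; last by exists c; rewrite ?e ?mul1r.
  by exists 1; rewrite ?oner_neq0 // phi_unit sg1 scale1r.
elim=> [|lm rs IH] acc y h; first by rewrite big_nil mulr1.
rewrite big_cons mulrA; apply: IH; have [c c0 e] := h.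
have [d d0 e'] := phi_Epow lm.1 lm.2.
exists (d * c); first exact: mulf_neq0 d0 c0.
rewrite (phi_star hG hchi) e e' sgM.
rewrite -scalerAl.
rewrite -scalerAr.
by rewrite scalerA.
Qed.

Lemma sg_sum (s : seq (wd * K)) (f : wd * K -> S) :
  sg (\sum_(p <- s) f p) = \sum_(p <- s) sg (f p).
Proof.
elim: s => [|p s IH]; last by rewrite !big_cons sgD IH.
by rewrite !big_nil; apply: shaP => w; rewrite /sg sha0E rmorph0 mul0r.
Qed.

Variables (Phi : seq V) (C : ('I_(rank D) -> V) -> Prop).
Hypotheses (hC : root_class chi Phi C) (Ca : C a).

Theorem straightening (i j : wd) : Lplus rho i -> Lplus rho j -> lexlt rho i j ->
  exists cs : seq (word D * K),
    (forall kc, kc \in cs ->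
       dominant rho kc.1 /\ lexle rho (i ++ j) kc.1 /\ lexle rho kc.1 (j ++ i)) /\
    eqF (star (EL rho j) (EL rho i))
        (flatten [seq scaleF kc.2 (Ew rho kc.1) | kc <- cs]).
Proof.
move=> [li /(dominantE hG hchi) di] [lj /(dominantE hG hchi) dj] ij.
have ia := rc_indep hC Ca.
have [s [hs e]] := rl_mul_straighten ia hC Ca li lj di dj ij.
have [ce hce] : exists ce : wd -> K, forall w, ce w != 0 /\ phi (Ew rho w) = ce w *: sg (Rv w).
  have ex w : exists c, c != 0 /\ phi (Ew rho w) = c *: sg (Rv w).
    by have [c c0 ec] := phi_Ew w; exists c.
  exists (fun w => epsilon (inhabits 0) (fun c => c != 0 /\ phi (Ew rho w) = c *: sg (Rv w))).
  by move=> w; apply: (epsilon_spec (inhabits 0)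
     (fun c => c != 0 /\ phi (Ew rho w) = c *: sg (Rv w))); apply: ex.
pose k := (kappa rho j)^-1 * (kappa rho i)^-1.
(* Sigma is semilinear, hence the bar on the coefficients; k comes from the normalizations of the
   two factors, and [ce] from that of each basis vector. *)
exists [seq (p.1, k * barb b p.2 / ce p.1) | p <- s]; split.
  by move=> _ /mapP[p /hs[h1 h2 h3] ->]; split=> //; apply/(dominantE hG hchi).
move=> w; suff -> : phi (star (EL rho j) (EL rho i)) =
  phi (flatten [seq scaleF kc.2 (Ew rho kc.1) | kc <- [seq (p.1, k * barb b p.2 / ce p.1) | p <- s]])
  by [].
rewrite (phi_star hG hchi) !phi_EL -scalerAl -scalerAr scalerA -/k -sgM e sg_sum scaler_sumr.
elim: s {hs e} => [|p s IH].
  by rewrite big_nil; apply: shaP => u; rewrite coef_nil.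
rewrite big_cons /= phi_cat -IH phi_scale; congr (_ + _).
have [c0 ->] := hce p.1; rewrite sgZ !scalerA; congr (_ *: _).
by rewrite /= mulfVK.
Qed.

End Sigma.

(** * Bicharacters of integral forms *)

(** The additive function [zs] lifts the parity to the integers: its value mod 2 is the parity of a
    weight. *)
Record zform (V : zmodType) := ZForm {
  zf : V -> V -> int;
  zs : V -> int;
  zfC : forall u v, zf u v = zf v u;
  zfDl : forall u v w, zf (u + v) w = zf u w + zf v w;
  zsD : forall u v, zs (u + v) = zs u + zs v }.

Section ZForm.
Variables (V : zmodType) (f : zform V).
Implicit Types u v w : V.
Notation "<< u , v >>" := (zf f u v).

Lemma zfDr u v w : << u, v + w >> = << u, v >> + << u, w >>.
Proof. by rewrite zfC zfDl ![<< _, u >>]zfC. Qed.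
Lemma zf0l v : << 0, v >> = 0.
Proof. by apply: (addIr << 0, v >>); rewrite -zfDl !add0r. Qed.
Lemma zf0r v : << v, 0 >> = 0. Proof. by rewrite zfC zf0l. Qed.
Lemma zfNl u v : << - u, v >> = - << u, v >>.
Proof. by apply: (addIr << u, v >>); rewrite -zfDl !addNr zf0l. Qed.
Lemma zfNr u v : << u, - v >> = - << u, v >>.
Proof. by rewrite zfC zfNl zfC. Qed.
Lemma zfMl u v n : << u *+ n, v >> = << u, v >> * n%:Z.
Proof. by elim: n => [|n IH]; rewrite ?mulr0n ?zf0l ?mulr0 // mulrS zfDl IH -add1n PoszD mulrDr mulr1. Qed.
Lemma zfMr u v n : << u, v *+ n >> = << u, v >> * n%:Z.
Proof. by rewrite zfC zfMl zfC. Qed.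
Lemma zs0 : zs f 0 = 0.
Proof. by apply: (addIr (zs f 0)); rewrite -zsD !add0r. Qed.
Lemma zsN u : zs f (- u) = - zs f u.
Proof. by apply: (addIr (zs f u)); rewrite -zsD !addNr zs0. Qed.
Lemma zsMn u n : zs f (u *+ n) = zs f u * n%:Z.
Proof. by elim: n => [|n IH]; rewrite ?mulr0n ?zs0 ?mulr0 // mulrS zsD IH -add1n PoszD mulrDr mulr1. Qed.

Definition zodd (z : int) : bool := odd `|z|%N.
Lemma zoddD y z : zodd (y + z) = zodd y (+) zodd z.
Proof. rewrite /zodd; lia. Qed.
Lemma zoddN z : zodd (- z) = zodd z.
Proof. by rewrite /zodd abszN. Qed.
Lemma zoddMn z n : zodd (z * n%:Z) = zodd z && odd n.
Proof. by rewrite /zodd abszM oddM. Qed.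

Definition zpar u := zodd (zs f u).
Lemma parD u v : zpar (u + v) = zpar u (+) zpar v. Proof. by rewrite /zpar zsD zoddD. Qed.
Lemma parN u : zpar (- u) = zpar u. Proof. by rewrite /zpar zsN zoddN. Qed.
Lemma parMn u n : zpar (u *+ n) = zpar u && odd n. Proof. by rewrite /zpar zsMn zoddMn. Qed.

Definition zchi : bichar K V.
Proof.
exists (fun u v => (-1) ^+ (zpar u && zpar v) * q ^ (- << u, v >>)).
- by move=> u v; rewrite andbC zfC.
- move=> u v w; rewrite parD zfDl opprD (expfzDr _ _ q_neq0) mulrACA -signr_addb.
  by rewrite andb_addl.
- by move=> u v; rewrite mulf_neq0 ?signr_eq0 // expfz_neq0 // q_neq0.
Defined.

Lemma zchiE u v : zchi u v = (-1) ^+ (zpar u && zpar v) * q ^ (- << u, v >>).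
Proof. by []. Qed.

(* closed form of the vanishing order of [serre_coef] at a simple pair (u, v) *)
Definition isMult u v (M : nat) : Prop :=
  if << u, u >> == 0 then zpar u /\ M = (<< u, v >> != 0) :> nat
  else << u, u >> * M%:Z + << u, v >> + << u, v >> = 0 /\ (zpar u -> ~~ odd M).

Lemma sign_q_eq1 (b : bool) (d : int) : d != 0 -> (-1) ^+ b * q ^ d != 1.
Proof.
move=> d0; apply/eqP => e; have := q_expz_sign b d0.
have s0 : (-1) ^+ b != 0 :> K by rewrite signr_eq0.
have s2 : (-1) ^+ b * (-1) ^+ b = 1 :> K by rewrite -expr2 sqrr_sign.
by case/eqP; apply: (mulfI s0); rewrite e s2.
Qed.

Variables (I : finType) (a : I -> V).

Lemma zchi_pow_sqr u v m :
  zchi u u ^+ m * zchi u v ^+ 2 =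
  (-1) ^+ (zpar u && odd m) * q ^ (- (<< u, u >> * m%:Z + << u, v >> + << u, v >>)).
Proof.
have e1 : zchi u u ^+ m = (-1) ^+ (zpar u && odd m) * q ^ (- (<< u, u >> * m%:Z)).
  by rewrite zchiE exprMn q_expz_pow mulNr andbb -exprM -[(-1) ^+ _ in LHS]signr_odd oddM oddb.
have e2 : zchi u v ^+ 2 = q ^ (- (<< u, v >> + << u, v >>)).
  by rewrite zchiE exprMn q_expz_pow mulNr sqrr_sign mul1r (_ : 2%:Z = 1 + 1) // mulrDr mulr1.
rewrite e1 e2 -mulrA -(expfzDr _ _ q_neq0); congr (_ * (q ^ _)).
by rewrite -opprD addrA.
Qed.

Lemma qn_mul (F : fieldType) (c : F) k : (c - 1) * qn c k = c ^+ k - 1.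
Proof. by rewrite subrX1. Qed.

Lemma qn_zchi_neq0 u m : << u, u >> != 0 -> qn (zchi u u) m.+1 != 0.
Proof.
move=> n0; have : zchi u u ^+ m.+1 != 1.
  have := zchi_pow_sqr u 0 m.+1; rewrite [zchi u 0]bch0r expr1n mulr1 => ->.
  by rewrite zf0r !addr0; apply: sign_q_eq1; rewrite oppr_eq0 mulf_neq0.
by apply: contraNneq => e; rewrite -subr_eq0 -qn_mul e mulr0.
Qed.

(** For u isotropic odd, $c=-1$ and $[2]_c=0$, so the order is 0 or 1 according to whether $(u,v)$
    vanishes. For u non-isotropic, c is not a root of unity and only $c^md^2=1$ can occur: a signed
    power of q, equal to 1 exactly when exponent and sign are trivial. *)
Lemma isM_lam p i M : isMult (a p) (a i) M ->
  (forall m, (m < M)%N -> serre_coef zchi a p i m != 0) /\ serre_coef zchi a p i M = 0.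
Proof.
rewrite /isMult /serre_coef; case: eqP => [n0 [op ->]|/eqP n0 [e po]].
  have c1 : zchi (a p) (a p) = -1 by rewrite zchiE op n0 oppr0 expr0z mulr1.
  case: eqP => [g0|/eqP g0]; rewrite [nat_of_bool _]/=.
    by split=> [[]|] //; rewrite zchi_pow_sqr n0 g0 andbF mul0r !addr0 oppr0 expr0z mulr1 expr0 subrr mulr0.
  split.
    move=> m; rewrite ltnS leqn0 => /eqP ->; apply: mulf_neq0; first by rewrite /qn big_ord1 expr0 oner_neq0.
    rewrite subr_eq0 zchi_pow_sqr; apply: sign_q_eq1; rewrite n0 mul0r add0r oppr_eq0.
    by move: << a p, a i >> g0 => d; lia.
  have q2 : qn (-1 : K) 2 = 0 by rewrite !qnSr qn0 add0r expr0 expr1 subrr.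
  by rewrite c1 q2 mul0r.
split=> [m lt|]; last first.
  rewrite zchi_pow_sqr e oppr0 expr0z mulr1.
  suff -> : zpar (a p) && odd M = false by rewrite expr0 subrr mulr0.
  by case: (zpar _) po => // /(_ isT) /negbTE.
apply: mulf_neq0; first exact: qn_zchi_neq0.
rewrite subr_eq0 zchi_pow_sqr; apply: sign_q_eq1; rewrite oppr_eq0.
apply: contraTneq lt => e2; rewrite -leqNgt.
have : << a p, a p >> * (M%:Z - m%:Z) = 0.
  rewrite mulrBr; apply/eqP; rewrite subr_eq0 -(inj_eq (addIr (<< a p, a i >> + << a p, a i >>))).
  by rewrite !addrA e e2.
by move/eqP; rewrite mulf_eq0 (negPf n0) /= subr_eq0 => /eqP[->].
Qed.

End ZForm.

(** * Families of bases closed under reflections up to relabelling *)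

Section Sclass.
Variables (V : zmodType) (f : zform V) (I : finType) (Phi : seq V).
Implicit Types a : I -> V.

(* Fewer conditions than [root_class]: reflections are only closed up to relabelling the
   nodes, and the last condition of [rc_refl] is replaced by reducedness of [Phi]. *)
Record sclass (C : (I -> V) -> Prop) : Prop := Sclass {
  sc_indep : forall a, C a -> indep a;
  sc_root : forall a i, C a -> a i \in Phi;
  sc_0 : 0 \notin Phi;
  sc_red : forall g n, g \in Phi -> g *+ n \in Phi -> n = 1%N;
  sc_pos : forall a g, C a -> g \in Phi -> Qp a g \/ Qp a (- g);
  sc_refl : forall a p, C a -> exists M : I -> nat,
    (forall i, i != p -> isMult f (a p) (a i) (M i)) /\
    exists s : {perm I}, C (refl_base a p M \o s) }.

Variable C : (I -> V) -> Prop.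
Hypothesis hC : sclass C.
Let C' a := exists s : {perm I}, C (a \o s).

Lemma Qp_perm a (s : {perm I}) g : Qp (a \o s) g -> Qp a g.
Proof.
move=> [h ->]; exists (h \o s^-1%g); rewrite [RHS](reindex_inj (@perm_inj _ s)).
by apply: eq_bigr => i _; rewrite /= permK.
Qed.

Lemma perm_indep a (s : {perm I}) : indep (a \o s) -> indep a.
Proof.
move=> h c e i; rewrite -[i](permKV s); apply: (h (c \o s)).
by rewrite -[RHS]e [RHS](reindex_inj (@perm_inj _ s)).
Qed.

(** If $-g$ were positive for the reflected base, comparing coefficients over a would kill all
    coordinates of g away from p. Then g is a multiple of $a_p$, and reducedness gives $g=a_p$. *)
Lemma refl_pos a p M g : indep a ->
  (forall n, a p *+ n \in Phi -> n = 1%N) -> g \in Phi -> Qp a g -> g != a p ->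
  Qp (refl_base a p M) g \/ Qp (refl_base a p M) (- g) -> Qp (refl_base a p M) g.
Proof.
move=> ia red gP [c ec] gp [//|[c' ec']].
case/eqP: gp.
(* The multiple of $a_p$ contributed by the summands $a_i+M_ia_p$ in the expansion of $-g$ over the
   reflected base. *)
pose N := (\sum_(i | i != p) M i * c' i)%N.
have e : \sum_i a i *+ (c i + (i != p) * c' i + (i == p) * N) = a p *+ c' p.
  rewrite (eq_bigr (fun i => a i *+ c i + (a i *+ ((i != p) * c' i) + a i *+ ((i == p) * N)))); last first.
    by move=> i _; rewrite !mulrnDr addrA.
  rewrite big_split /= -ec -[g]opprK ec' big_split /=.
  rewrite (bigD1 p) //= (bigD1 p (F := fun i => a i *+ ((i != p) * c' i))) //=.
  rewrite (bigD1 p (F := fun i => a i *+ ((i == p) * N))) //= eqxx mul1n mul0n mulr0n add0r.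
  rewrite [X in a p *+ N + X]big1 ?addr0 => [|i /negPf ->]; last by rewrite mul0n mulr0n.
  rewrite /refl_base eqxx mulNrn.
  rewrite (eq_bigr (fun i => a i *+ ((i != p) * c' i) + a p *+ (M i * c' i))); last first.
    by move=> i ip; rewrite (negPf ip) mul1n mulrnDl mulrnA.
  rewrite big_split /= -[X in - (_ + (_ + X))]/(\sum_(i | i != p) a p *+ (M i * c' i)).
  rewrite -(big_morph (fun n => a p *+ n) (fun m n => mulrnDr (a p) m n) (mulr0n (a p))) -/N.
  by rewrite opprD opprK subrK.
have e' : a p *+ c' p = \sum_i a i *+ ((i == p) * c' p).
  by rewrite (bigD1 p) //= eqxx mul1n big1 ?addr0 // => i /negPf ->.
have h := indep_inj ia (etrans e e').
have gE : g = a p *+ c p.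
  rewrite ec (bigD1 p) //= big1 ?addr0 // => i ip; have := h i.
  rewrite (negPf ip) mul0n addn0 => /eqP; rewrite addn_eq0 => /andP[/eqP -> _].
  by rewrite mulr0n.
by rewrite gE; rewrite gE in gP; rewrite (red _ gP).
Qed.

(** Adjoining all relabellings makes the family closed on the nose; multiplicities are transported
    along the relabelling. *)
Theorem sclass_root_class : root_class (zchi f) Phi C'.
Proof.
split.
- by move=> a [s /(sc_indep hC)]; apply: perm_indep.
- by move=> a i [s h]; rewrite -[i](permKV s); have := sc_root hC (s^-1%g i) h.
- exact: sc_0 hC.
- by move=> a g [s h] gP; case: (sc_pos hC h gP) => /Qp_perm; [left|right].
move=> a p [s h]; have [M [hM [t ht]]] := sc_refl hC (s^-1%g p) h.
have E : refl_base a p (M \o s^-1%g) \o s = refl_base (a \o s) (s^-1%g p) M.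
  apply: funext => i; rewrite /refl_base /= -{1}[p](permKV s) (inj_eq (@perm_inj _ s)).
  by rewrite !permKV permK.
have C1 : C' (refl_base a p (M \o s^-1%g)).
  exists (t * s)%g; rewrite (_ : _ \o _ = refl_base (a \o s) (s^-1%g p) M \o t) //.
  by rewrite -E; apply: funext => i; rewrite /= permM.
exists (M \o s^-1%g).
have H i : i != p -> isMult f (a p) (a i) (M (s^-1%g i)).
  move=> ip; have := hM (s^-1%g i); rewrite (inj_eq (@perm_inj _ _)) /= !permKV; exact.
split=> //.
- by move=> i m /H /isM_lam[+ _]; apply.
- by move=> i /H /isM_lam[].
have ia : indep a by apply: perm_indep (sc_indep hC h).
have pP : a p \in Phi by have := sc_root hC (s^-1%g p) h; rewrite /= permKV.
move=> g gP ag gp; apply: refl_pos => //; first by move=> n; apply: (sc_red hC).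
have [r hr] := C1.
by case: (sc_pos hC hr gP) => /Qp_perm; [left|right].
Qed.

End Sclass.

Import Num.Theory Order.TTheory.

(** * Types A, B, C and D *)

Section Frame.
Variables (V : zmodType) (f : zform V).
Implicit Types (u v g : V) (x : nat -> V).
Notation "<< u , v >>" := (zf f u v).
Notation par := (zpar f).
Notation isM := (isMult f).

Lemma zfMz u v (n : int) : << u *~ n, v >> = << u, v >> * n.
Proof. by case: n => n; rewrite ?NegzE ?mulrNz ?zfNl ?mulrN -pmulrn zfMl. Qed.

Lemma zf_suml (J : Type) (s : seq J) (P : pred J) (F : J -> V) v :
  << \sum_(j <- s | P j) F j, v >> = \sum_(j <- s | P j) << F j, v >>.
Proof.
apply: (big_morph (fun u => << u, v >>)); first by move=> u w; rewrite zfDl.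
exact: zf0l.
Qed.

Lemma indep_dual (I : finType) (a y : I -> V) (d : I -> int) :
  (forall k, d k != 0) -> (forall i k, << a i, y k >> = if i == k then d k else 0) ->
  indep a.
Proof.
move=> d0 h c e k; have := zf_suml (index_enum I) xpredT (fun i => a i *~ c i) (y k).
rewrite e zf0l (bigD1 k) //= zfMz h eqxx big1 ?addr0 => [|i /negPf ik].
  by move/esym/eqP; rewrite mulf_eq0 (negPf (d0 k)) => /eqP.
by rewrite zfMz h ik mul0r.
Qed.

Lemma isM_0 u v : (<< u, u >> = 0 -> par u) -> << u, v >> = 0 -> isM u v 0.
Proof.
by move=> pu e; rewrite /isMult e eqxx mulr0 !addr0; case: eqP => // /pu.
Qed.

Lemma isM_1 u v : (<< u, u >> = 0 -> par u) -> << u, v >> != 0 ->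
  (<< u, u >> != 0 -> << u, u >> + << u, v >> + << u, v >> = 0 /\ ~~ par u) -> isM u v 1.
Proof.
move=> pu e h; rewrite /isMult e mulr1; case: eqP => [/pu //|/eqP /h[-> /negPf ->]] //.
Qed.

Lemma isM_2 u v : << u, u >> != 0 -> << u, u >> + << u, v >> = 0 -> isM u v 2.
Proof.
move=> n0 e; rewrite /isMult (negPf n0); split=> //.
by rewrite (_ : 2%:Z = 1 + 1) // mulrDr mulr1 -addrA addrACA e addr0.
Qed.

Variables (N : nat) (nu : int).
Hypothesis nu_gt0 : 0 < nu.

Definition frame_norm (b : bool) : int := if b then - nu else nu.
Definition sgn (b : bool) v : V := if b then - v else v.

(* [x] stands for a signed permutation of the coordinate vectors epsilon_i, delta_i, the odd
   ones being the delta_i. *)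
Definition orth x := forall j k, (j < N)%N -> (k < N)%N ->
  << x j, x k >> = if j == k then frame_norm (par (x k)) else 0.

Section Orth.
Variable x : nat -> V.
Hypothesis ox : orth x.

Lemma orth0 j k : (j < N)%N -> (k < N)%N -> (j != k)%N -> << x j, x k >> = 0.
Proof. by move=> hj hk /negPf jk; rewrite ox ?jk. Qed.
Lemma orthn k : (k < N)%N -> << x k, x k >> = frame_norm (par (x k)).
Proof. by move=> hk; rewrite ox ?eqxx. Qed.

(** Up to the factor [nu] these vectors are dual to the differences $x_i-x_{i+1}$; the signs
    compensate the negative norm of the odd frame vectors. *)
Definition dualv k : V := \sum_(j < k.+1) sgn (par (x j)) (x j).

Lemma dualvE i k : (i < N)%N -> (k < N)%N ->
  << x i, dualv k >> = if (i <= k)%N then nu else 0.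
Proof.
move=> hi hk; rewrite zfC zf_suml.
have E j : (j < N)%N -> << sgn (par (x j)) (x j), x i >> = if j == i then nu else 0.
  move=> hj; rewrite zfC; case: eqP => [->|/eqP ji].
    by rewrite /sgn; case: (boolP (par (x i))) => h; rewrite ?zfNr orthn // /frame_norm ?h ?(negPf h) ?opprK.
  have z : << x i, x j >> = 0 by rewrite orth0 // eq_sym.
  by rewrite /sgn; case: (par _); rewrite ?zfNr z ?oppr0.
case: leqP => ik.
  rewrite (bigD1 (Ordinal (n := k.+1) (m := i) ik)) //= E // eqxx big1 ?addr0 // => j.
  rewrite -val_eqE /= => /negPf ji; rewrite E ?ji //; exact: leq_trans (ltn_ord j) _.
rewrite big1 // => j _; rewrite E; last exact: leq_trans (ltn_ord j) _.
by case: eqP => // ji; have := ltn_ord j; rewrite ji ltnS leqNgt ik.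
Qed.

(** A nonnegative substitute for the indefinite form. Since it takes only the values c and 2c on
    roots, no root is a proper multiple of another. *)
Definition sqnorm g : int := \sum_(k < N) << g, x k >> ^+ 2.

Lemma QnM g n : sqnorm (g *+ n) = sqnorm g * (n * n)%:Z.
Proof.
rewrite /sqnorm mulr_suml; apply: eq_bigr => k _.
by rewrite zfMl exprMn; congr (_ * _); rewrite expr2 PoszM.
Qed.

Lemma Qn2 i j b c : (i < N)%N -> (j < N)%N -> i != j ->
  sqnorm (sgn b (x i) + sgn c (x j)) = nu ^+ 2 + nu ^+ 2.
Proof.
move=> hi hj ij; rewrite /sqnorm (bigD1 (Ordinal hi)) //= (bigD1 (Ordinal hj)) /=; last first.
  by rewrite -val_eqE /= eq_sym.
have S d v w : << sgn d v, w >> = (if d then -1 else 1) * << v, w >>.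
  by rewrite /sgn; case: d; rewrite ?zfNl ?mulN1r ?mul1r.
rewrite big1 => [|k /andP[]]; last first.
  rewrite -!val_eqE /= => k1 k2; rewrite zfDl !S !orth0 ?mulr0 ?addr0 ?expr0n //;
  by rewrite eq_sym.
rewrite !zfDl !S (orthn hi) (orthn hj) (orth0 hi hj ij) (orth0 hj hi) 1?eq_sym //.
by rewrite !mulr0 addr0 add0r addr0 /frame_norm; congr (_ + _); case: b; case: c; case: (par _);
   rewrite ?mulN1r ?mul1r ?opprK ?sqrrN.
Qed.

Lemma Qn1 i b n : (i < N)%N -> sqnorm (sgn b (x i *+ n)) = nu ^+ 2 * (n * n)%:Z.
Proof.
move=> hi; have -> : sgn b (x i *+ n) = sgn b (x i) *+ n by case: b; rewrite /sgn ?mulNrn.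
rewrite QnM /sqnorm; congr (_ * _); rewrite (bigD1 (Ordinal hi)) //=.
have S d v w : << sgn d v, w >> = (if d then -1 else 1) * << v, w >>.
  by rewrite /sgn; case: d; rewrite ?zfNl ?mulN1r ?mul1r.
rewrite big1 => [|k]; last first.
  by rewrite -val_eqE /= => ki; rewrite S orth0 ?mulr0 ?expr0n // eq_sym.
by rewrite S orthn // addr0 /frame_norm; case: b; case: (par _); rewrite ?mulN1r ?mul1r ?opprK ?sqrrN.
Qed.

End Orth.

Lemma Qn_red (Phi : seq V) x c : 0 < c ->
  (forall g, g \in Phi -> sqnorm x g = c \/ sqnorm x g = c + c) ->
  0 \notin Phi /\ (forall g n, g \in Phi -> g *+ n \in Phi -> n = 1%N).
Proof.
clear nu_gt0; move=> c0 h; split.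
  apply/negP => /h; rewrite -[0](mulr0n 0) QnM mulr0 => -[e|e]; move: c0 e; lia.
move=> g n gP /h; rewrite QnM; have := h _ gP; case: n => [|[|n]] //.
  by move=> _; rewrite mulr0 => -[e|e]; move: c0 e; lia.
by case=> ->; case => e; exfalso; move: c0 e; clear; nia.
Qed.

Lemma sgnK b v : sgn b (sgn b v) = v.
Proof. by case: b; rewrite /sgn ?opprK. Qed.
Lemma sgn_sgn b c v : sgn b (sgn c v) = sgn (b (+) c) v.
Proof. by case: b; case: c; rewrite /sgn ?opprK. Qed.
Lemma par_sgn b v : par (sgn b v) = par v.
Proof. by case: b; rewrite /sgn ?parN. Qed.
Lemma sgnMn b v n : sgn b (v *+ n) = sgn b v *+ n.
Proof. by case: b; rewrite /sgn ?mulNrn. Qed.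

Record signed_perm (e : nat -> bool) (s : nat -> nat) x x' : Prop := SignedPerm {
  sp_lt : forall k, (k < N)%N -> (s k < N)%N;
  sp_inv : forall k, (k < N)%N -> s (s k) = k;
  sp_E : forall k, (k < N)%N -> x' k = sgn (e k) (x (s k)) }.

Lemma sp_eq e s x x' j k : signed_perm e s x x' -> (j < N)%N -> (k < N)%N ->
  (s j == s k) = (j == k).
Proof.
move=> h hj hk; apply/eqP/eqP => [E|-> //].
by rewrite -(sp_inv h hj) E (sp_inv h hk).
Qed.

Lemma signed_perm_sym e s x x' : signed_perm e s x x' -> signed_perm (e \o s) s x' x.
Proof.
move=> [h1 h2 h3]; split=> // k hk; by rewrite h3 ?h1 //= sgnK h2.
Qed.

Lemma signed_perm_orth e s x x' : signed_perm e s x x' -> orth x -> orth x'.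
Proof.
move=> h; have [h1 h2 h3] := h; move=> ox j k hj hk.
have S b c u v : << sgn b u, sgn c v >> = if b (+) c then - << u, v >> else << u, v >>.
  by case: b; case: c; rewrite /sgn ?zfNl ?zfNr ?opprK.
rewrite !h3 // S ox ?h1 // par_sgn (sp_eq h) //.
by case: eqP => [->|]; rewrite ?addbb ?oppr0 // if_same.
Qed.

Definition rtA x g := exists i j, [/\ (i < N)%N, (j < N)%N, i != j & g = x i - x j].
(* [sh] selects type [B] (short roots), otherwise [C] or [D] (long roots). *)
Definition rtB (sh : bool) x g :=
  (exists i j b c, [/\ (i < N)%N, (j < N)%N, i != j & g = sgn b (x i) + sgn c (x j)]) \/
  (exists i b, (i < N)%N /\ if sh then g = sgn b (x i) else par (x i) /\ g = sgn b (x i *+ 2)).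

Lemma rtA_perm s x x' g : signed_perm (fun _ => false) s x x' -> rtA x' g -> rtA x g.
Proof.
move=> h; have [h1 h2 h3] := h; move=> [i [j [hi hj ij ->]]]; exists (s i), (s j); rewrite !h1 // !h3 //.
by rewrite (sp_eq h).
Qed.

Lemma rtB_perm sh e s x x' g : signed_perm e s x x' -> rtB sh x' g -> rtB sh x g.
Proof.
move=> h; have [h1 h2 h3] := h; move=> [[i [j [b [c [hi hj ij ->]]]]]|[i [b [hi hg]]]].
  left; exists (s i), (s j), (b (+) e i), (c (+) e j); rewrite !h1 // !h3 // !sgn_sgn.
  by rewrite (sp_eq h).
right; exists (s i), (b (+) e i); rewrite h1 //; split=> //.
by case: sh hg; rewrite h3 // ?par_sgn -?sgnMn sgn_sgn.
Qed.

End Frame.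

Ltac gram ox := rewrite ?(zfDl, zfDr, zfNl, zfNr, zfMl, zfMr);
  repeat match goal with |- context [zf ?f (?x ?j) (?x ?k)] =>
    first [ constr_eq j k; rewrite (orthn ox (k := k)); [|lia]
          | rewrite (orth0 ox (j := j) (k := k)); [|lia|lia|lia] ] end.

(** * Differences of consecutive frame vectors *)

Section Chain.
Variables (V : zmodType) (f : zform V) (N : nat) (nu : int).
Notation "<< u , v >>" := (zf f u v).
Notation par := (zpar f).
Notation isM := (isMult f).
Notation nrm := (frame_norm nu).
Implicit Types (x : nat -> V) (u v : V).

Definition swp (p k : nat) : nat := if k == p then p.+1 else if k == p.+1 then p else k.

Lemma swp_lt p k : (p.+1 < N)%N -> (k < N)%N -> (swp p k < N)%N.
Proof. by rewrite /swp; case: eqP => // _; case: eqP => // _ /ltnW. Qed.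
Lemma swpK p : involutive (swp p).
Proof. by move=> k; rewrite /swp; do ![case: eqP => //]; lia. Qed.
Lemma swpL p : swp p p = p.+1. Proof. by rewrite /swp eqxx. Qed.
Lemma swpR p : swp p p.+1 = p.
Proof. by rewrite /swp eqxx; case: eqP => // ?; lia. Qed.
Lemma swpD p k : k != p -> k != p.+1 -> swp p k = k.
Proof. by rewrite /swp => /negPf -> /negPf ->. Qed.

Lemma signed_perm_swp p x : (p.+1 < N)%N ->
  signed_perm N (fun _ => false) (swp p) x (x \o swp p).
Proof. by move=> h; split=> // k hk; [apply: swp_lt | rewrite swpK]. Qed.

Definition dif x (i : nat) : V := x i - x i.+1.

Definition Mchain (p i : nat) : nat := (i == p.+1) || (p == i.+1).

Lemma dif_swp x p i : i != p -> dif (x \o swp p) i = dif x i + dif x p *+ Mchain p i.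
Proof.
move=> ip; rewrite /Mchain /dif /=; have [->|n1] := eqVneq i p.+1.
  by rewrite swpR swpD ?mulr1n; [rewrite [RHS]addrC subrKA | lia | lia].
have [e|n2] := eqVneq p i.+1.
  by rewrite e swpL swpD ?mulr1n ?subrKA //; lia.
by rewrite !swpD ?addr0 // eq_sym.
Qed.

Lemma dif_swp_self x p : dif (x \o swp p) p = - dif x p.
Proof. by rewrite /dif /= swpL swpR opprB. Qed.

Lemma dif_Qp r (a : 'I_r -> V) x m : (m <= r)%N ->
  (forall i : 'I_r, (i < m)%N -> a i = dif x i) ->
  forall i j, (i <= j)%N -> (j <= m)%N -> Qp a (x i - x j).
Proof.
move=> mr ha i j; elim: j => [|j IH]; first by rewrite leqn0 => /eqP ->; rewrite subrr => _; apply: Qp0.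
rewrite leq_eqVlt => /predU1P[-> _|]; first by rewrite subrr; apply: Qp0.
rewrite ltnS => ij jm; rewrite (_ : x i - x j.+1 = (x i - x j) + dif x j); last by rewrite subrKA.
apply: QpD; first by apply: IH => //; exact: ltnW.
by rewrite -(ha (Ordinal (leq_trans jm mr))) //; apply: Qp_gen.
Qed.

Hypothesis nu_gt0 : 0 < nu.

Lemma nrm_iso b c : nrm b + nrm c = 0 -> b (+) c.
Proof. by rewrite /frame_norm; case: b; case: c => //; move: nu_gt0; lia. Qed.
Lemma nrm_aniso b c : nrm b + nrm c != 0 -> c = b.
Proof. by rewrite /frame_norm; case: b; case: c => //; lia. Qed.
Lemma nrm_neq0 b : nrm b != 0.
Proof. by rewrite /frame_norm; case: b; move: nu_gt0; lia. Qed.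

Lemma isM_0n u v b c : << u, u >> = nrm b + nrm c -> par u = b (+) c ->
  << u, v >> = 0 -> isM u v 0.
Proof. by move=> e p; apply: isM_0 => h; rewrite p nrm_iso // -e. Qed.

Lemma isM_1n u v b c : << u, u >> = nrm b + nrm c -> par u = b (+) c ->
  << u, v >> = - nrm b -> isM u v 1.
Proof.
move=> e p h; apply: isM_1.
- by rewrite e => /nrm_iso; rewrite p.
- by rewrite h oppr_eq0 nrm_neq0.
by rewrite e => /nrm_aniso E; rewrite p E addbb h addrK subrr.
Qed.

Lemma isM_1nr u v b c : << u, u >> = nrm b + nrm c -> par u = b (+) c ->
  << u, v >> = - nrm c -> isM u v 1.
Proof. by rewrite addrC addbC; apply: isM_1n. Qed.

Section Dif.
Variables (x : nat -> V) (p : nat).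
Hypotheses (ox : orth f N nu x) (hp : (p.+1 < N)%N).

Lemma dif_norm : << dif x p, dif x p >> = nrm (par (x p)) + nrm (par (x p.+1)).
Proof. by rewrite /dif; gram ox; rewrite !oppr0 opprK addr0 add0r. Qed.
Lemma dif_par : par (dif x p) = par (x p) (+) par (x p.+1).
Proof. by rewrite /dif parD parN. Qed.

Lemma dif0 v : << dif x p, v >> = 0 -> isM (dif x p) v 0.
Proof. exact: (isM_0n dif_norm dif_par). Qed.
Lemma dif1 v : << dif x p, v >> = - nrm (par (x p)) -> isM (dif x p) v 1.
Proof. exact: (isM_1n dif_norm dif_par). Qed.
Lemma dif1r v : << dif x p, v >> = - nrm (par (x p.+1)) -> isM (dif x p) v 1.
Proof. exact: (isM_1nr dif_norm dif_par). Qed.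

Lemma dif_isM i : (i.+1 < N)%N -> i != p -> isM (dif x p) (dif x i) (Mchain p i).
Proof.
move=> hi ip; rewrite /Mchain; have [e|n1] := eqVneq i p.+1.
  by rewrite e in hi *; apply: dif1r; rewrite /dif; gram ox; rewrite !oppr0 !(addr0, add0r).
have [e|n2] := eqVneq p i.+1.
  by apply: dif1; have hp2 := hp; rewrite e in hp2; rewrite /dif e; gram ox; rewrite !oppr0 !(addr0, add0r).
by apply: dif0; rewrite /dif; gram ox; rewrite !oppr0 !(addr0, add0r).
Qed.

End Dif.

End Chain.

(** * Type A *)

Section TypeA.
Variables (V : zmodType) (f : zform V) (r : nat) (nu : int).
Hypothesis nu_gt0 : 0 < nu.
Variable x0 : nat -> V.
Hypothesis ox0 : orth f r.+1 nu x0.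

Definition PhiA : seq V :=
  [seq x0 ij.1 - x0 ij.2 | ij <- [seq ij <- allpairs pair (iota 0 r.+1) (iota 0 r.+1) | ij.1 != ij.2]].

Lemma PhiAP g : reflect (rtA r.+1 x0 g) (g \in PhiA).
Proof.
apply: (iffP mapP) => [[[i j]]|[i [j [hi hj ij ->]]]].
  rewrite mem_filter => /andP[ij /allpairsP[[i' j'] [hi hj [ei ej]]]] ->.
  by move: hi hj; rewrite !mem_iota -ei -ej => hi hj; exists i, j.
exists (i, j) => //; rewrite mem_filter ij; apply/allpairsP; exists (i, j).
by split=> [||//]; rewrite ?mem_iota.
Qed.

Definition baseA (x : nat -> V) (i : 'I_r) : V := dif x i.

Definition classA (a : 'I_r -> V) : Prop :=
  exists x, [/\ orth f r.+1 nu x, forall g, g \in PhiA <-> rtA r.+1 x g & a = baseA x].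

Lemma classA0 : classA (baseA x0).
Proof. by exists x0; split=> // g; split=> /PhiAP. Qed.

Lemma classA_sclass : sclass f PhiA classA.
Proof.
have [n0 red] : 0 \notin PhiA /\ (forall g n, g \in PhiA -> g *+ n \in PhiA -> n = 1%N).
  apply: (Qn_red (f := f) (N := r.+1) (c := nu ^+ 2 + nu ^+ 2)); first by rewrite addr_gt0 // exprn_gt0.
  by move=> g /PhiAP[i [j [hi hj ij ->]]]; left; apply: (Qn2 ox0 false true).
split=> //.
- move=> _ [x [ox _ ->]].
  apply: (@indep_dual _ f _ _ (fun k : 'I_r => dualv f x k) (fun=> nu)).
    by move=> _; rewrite gt_eqF.
  move=> i k; have hi := ltn_ord i; have hk := ltn_ord k.
  have D j (hj : (j < r.+1)%N) := dualvE ox hj (leqW hk).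
  rewrite /baseA /dif zfDl zfNl !D ?ltnS ?(ltnW hi) // -val_eqE /=.
  by case: ltngtP => h; rewrite ?subrr ?subr0.
- move=> _ i [x [ox hP ->]]; apply/hP; exists (i : nat), i.+1.
  by split=> //; rewrite ?ltnS // 1?ltnW ?ltn_ord // neq_ltn ltnSn.
- move=> _ g [x [ox hP ->]] /hP[i [j [hi hj ij ->]]].
  have Q := @dif_Qp _ r (baseA x) x r (leqnn r) (fun _ _ => erefl).
  by rewrite opprB; case: (ltngtP i j) ij => // h _; [left|right]; apply: Q => //; exact: ltnW.
move=> _ p [x [ox hP ->]]; have hp : (p.+1 < r.+1)%N by rewrite ltnS.
exists (fun i : 'I_r => Mchain p i); split.
  by move=> i ip; apply: (dif_isM nu_gt0 ox); rewrite ?ltnS.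
have sp := signed_perm_swp x hp.
exists 1%g, (x \o swp p); split.
- exact: signed_perm_orth sp ox.
- move=> g; rewrite hP; split; last exact: rtA_perm sp.
  by apply: rtA_perm (signed_perm_sym sp).
apply: funext => i; rewrite /= perm1 /refl_base /baseA; case: eqVneq => [->|ip].
  by rewrite dif_swp_self.
by rewrite dif_swp.
Qed.

End TypeA.

Lemma mulz2 (z : int) : z * 2%:Z = z + z.
Proof. by rewrite (_ : 2%:Z = 1 + 1) // mulrDr mulr1. Qed.

(** * Types B, C and D: reflections of a single base *)

Section TypeB.
Variables (V : zmodType) (f : zform V) (n : nat) (nu : int) (sh : bool).
Notation N := n.+1.
Notation "<< u , v >>" := (zf f u v).
Notation par := (zpar f).
Notation isM := (isMult f).
Notation nrm := (frame_norm nu).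
Notation orth := (orth f N nu).
Implicit Types (x : nat -> V) (u v : V).

(* [sh] selects type [B]; otherwise the parity of the last frame vector separates the two
   shapes of the diagram in types [C] and [D]. *)
Definition lastB x : V := if sh then x n else if par (x n) then x n *+ 2 else x n.-1 + x n.
Definition base x (i : nat) : V := if (i < n)%N then dif x i else lastB x.

Lemma base_lt x i : (i < n)%N -> base x i = dif x i. Proof. by rewrite /base => ->. Qed.
Lemma base_n x : base x n = lastB x. Proof. by rewrite /base ltnn. Qed.

Definition flp (k j : nat) : bool := j == k.
Lemma signed_perm_neg x : signed_perm N (flp n) id x (fun k => sgn (flp n k) (x k)).
Proof. by []. Qed.

Definition flp2 (k j : nat) : bool := (j == k) || (j == k.+1).
Lemma signed_perm_swp_neg x p e : (p.+1 < N)%N ->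
  signed_perm N e (swp p) x (fun k => sgn (e k) (x (swp p k))).
Proof. by move=> h; split=> // k hk; [apply: swp_lt | rewrite swpK]. Qed.

(* what a reflection of the [p]-th simple root has to provide, up to relabelling by [t] *)
Definition refl_step x p (t : nat -> nat) := exists e s x' (M : nat -> nat),
  [/\ signed_perm N e s x x', forall i, (i < N)%N -> i != p -> isM (base x p) (base x i) (M i),
      forall i, (i < N)%N -> t i != p -> base x' i = base x (t i) + base x p *+ M (t i) &
      forall i, (i < N)%N -> t i = p -> base x' i = - base x p].

Hypothesis nu_gt0 : 0 < nu.
Hypothesis hn : sh || (0 < n)%N.
Variable x : nat -> V.
Hypothesis ox : orth x.

Lemma refl_step_chain_aux p ML : (p < n)%N -> isM (dif x p) (lastB x) ML ->
  lastB (x \o swp p) = lastB x + dif x p *+ ML -> refl_step x p id.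
Proof.
move=> hp hM hl; have hp' : (p.+1 < N)%N by [].
exists (fun=> false), (swp p), (x \o swp p), (fun i => if (i < n)%N then Mchain p i else ML).
split.
- exact: signed_perm_swp.
- move=> i hi ip; rewrite (base_lt _ hp) /base; case: ifP => h //.
  exact: (dif_isM nu_gt0 ox).
- move=> i hi ip; rewrite (base_lt _ hp) /base; case: ifP => h //.
  exact: dif_swp.
- by move=> i hi ->; rewrite !base_lt // dif_swp_self.
Qed.

Lemma refl_step_chain p : (p < n)%N -> refl_step x p id.
Proof.
move=> hp; have := ltn_predK hp => en.
have [e|h] := eqVneq p.+1 n; last first.
  have sn : swp p n = n by apply: swpD; lia.
  (* The last root moves only if it is $x_{n-1}+x_n$ and the swap touches $x_{n-1}$. *)
  pose ML : nat := ~~ sh && ~~ par (x n) && (p.+2 == n).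
  apply: (refl_step_chain_aux (ML := ML)) => //; rewrite /ML /lastB /=; case: (sh) => /=.
  - by apply: (dif0 nu_gt0 ox) => //; rewrite /dif; gram ox; rewrite oppr0 addr0.
  - case: (par (x n)) => /=.
      by apply: (dif0 nu_gt0 ox) => //; rewrite /dif; gram ox; rewrite !(mul0r, oppr0, addr0).
    case: eqP => [e2|n2].
      have -> : n.-1 = p.+1 by lia.
      by apply: (dif1r nu_gt0 ox) => //; rewrite /dif; gram ox; rewrite !(oppr0, addr0, add0r).
    by apply: (dif0 nu_gt0 ox) => //; rewrite /dif; gram ox; rewrite !(oppr0, addr0).
  - by rewrite sn addr0.
  rewrite sn; case: (par (x n)) => /=; first by rewrite addr0.
  case: eqP => [e2|n2].
    have -> : n.-1 = p.+1 by lia.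
    by rewrite swpR /dif mulr1n addrAC [x p.+1 + _]addrC subrK.
  by rewrite swpD ?addr0 //; lia.
have hp1 : n.-1 = p by lia.
have sL : swp p n = p by rewrite -e swpR.
have sK : swp p p = n by rewrite -e swpL.
have nn : (nrm (par (x n)) == 0) = false by apply/negbTE/(nrm_neq0 nu_gt0).
(* Outside type B the swap may change the shape of the last root. With $d=x_p-x_n$: both odd,
   $2x_n+2d=2x_p$; exactly one odd, $2x_n+d$ is $x_p+x_n$ or $x_p+x_n+d$ is $2x_p$; both even, no
   change. *)
pose ML := if sh then 1%N else if par (x n) then (if par (x p) then 2%N else 1%N) else nat_of_bool (par (x p)).
apply: (refl_step_chain_aux (ML := ML)) => //; rewrite /ML /lastB /=; case: (sh) => /=.
- apply: (dif1r nu_gt0 ox) => //; rewrite e /dif e; gram ox; rewrite ?(oppr0, addr0, add0r) //.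
- case pn: (par (x n)) => /=.
    case pp: (par (x p)) => /=.
      apply: isM_2; rewrite (dif_norm nu_gt0 ox) // e ?pn ?pp; first by rewrite /frame_norm; move: nu_gt0; lia.
      rewrite /dif e; gram ox; rewrite /frame_norm pn; lia.
    apply: isM_1; rewrite ?(dif_norm nu_gt0 ox) // ?dif_par ?e ?pn ?pp //.
      rewrite /dif e; gram ox; rewrite /frame_norm pn; move: nu_gt0; lia.
    by rewrite /frame_norm subrr eqxx.
  case pp: (par (x p)) => /=.
    apply: isM_1; rewrite ?(dif_norm nu_gt0 ox) // ?dif_par ?e ?pn ?pp //.
      rewrite /dif e hp1; gram ox; rewrite /frame_norm pn pp; move: nu_gt0; lia.
    by rewrite /frame_norm addNr eqxx.
  apply: (dif0 nu_gt0 ox) => //; rewrite /dif e hp1; gram ox.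
  by rewrite pn pp /frame_norm oppr0 add0r addr0 subrr.
- by rewrite sL /dif e mulr1n addrC subrK.
rewrite sL hp1 sK; case pn: (par (x n)); case pp: (par (x p)) => /=; rewrite /dif e.
- by rewrite mulrnBl addrC subrK.
- by rewrite mulr1n mulr2n -addrA [x n + (_ - _)]addrC subrK.
- by rewrite mulr1n addrACA subrr addr0 mulr2n.
by rewrite addr0 addrC.
Qed.

(** The last root is $x_n$ (m = 0) or $2x_n$ (m = 1), and the reflection negates $x_n$. The
    neighbour $x_{n-1}-x_n$ becomes $x_{n-1}+x_n$, that is, the last root is added $2-m$ times. *)
Lemma refl_step_last_neg m : base x n = x n *+ m.+1 -> (m <= 1)%N ->
  lastB (fun k => sgn (flp n k) (x k)) = - lastB x -> refl_step x n id.
Proof.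
move=> bn m1 hl; pose M i : nat := if i.+1 == n then (2 - m)%N else 0%N.
have m01 : m = 0%N \/ m = 1%N by lia.
exists (flp n), id, (fun k => sgn (flp n k) (x k)), M.
have nn := nrm_neq0 nu_gt0 (par (x n)).
have nb : << base x n, base x n >> != 0.
  by rewrite bn; gram ox; rewrite !mulf_neq0.
split; first exact: signed_perm_neg.
- move=> i hi ip; have h : (i < n)%N by lia.
  rewrite (base_lt _ h) /M; case: eqP => [e|h2]; last first.
    by apply: isM_0; [move/eqP: nb | rewrite bn /dif; gram ox; rewrite !(oppr0, mul0r, addr0)].
  move: nb; rewrite bn; case: m01 => -> nb.
    apply: isM_2 => //; rewrite /dif e mulr1n; gram ox; rewrite add0r; exact: subrr.
  apply: isM_1; first by move/eqP: nb.
    by rewrite /dif e; gram ox; rewrite add0r; move: nn; lia.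
  move=> _; rewrite parMn andbF; split=> //; rewrite /dif e; gram ox; move: (nrm _); lia.
- move=> i hi ip; have h : (i < n)%N by lia.
  rewrite !(base_lt _ h) /M /dif /flp (ltn_eqF h) /=; case: eqP => [e|h2]; last by rewrite addr0.
  have m2 : (m.+1 * (2 - m) = 2)%N by case: m01 => ->.
  by rewrite e bn -mulrnA m2 /sgn opprK mulr2n addrA subrK.
by move=> i hi ->; rewrite !base_n.
Qed.

Section EvenLast.
Variable k : nat.
Hypotheses (nsh : sh = false) (hk : k.+1 = n) (pn : par (x n) = false).

Let xk1 : x k.+1 = x n. Proof. by rewrite hk. Qed.
Let k1 : n.-1 = k. Proof. by rewrite -hk. Qed.

Lemma lastB_even : lastB x = x k + x n.
Proof. by rewrite /lastB nsh pn k1. Qed.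

Lemma lastB_norm : << lastB x, lastB x >> = nrm (par (x k)) + nrm (par (x n)).
Proof. by rewrite lastB_even; gram ox; rewrite addr0 add0r. Qed.
Lemma lastB_par : par (lastB x) = par (x k) (+) par (x n).
Proof. by rewrite lastB_even parD. Qed.

Lemma lastB_isM i : (i < k)%N -> isM (lastB x) (dif x i) (i.+1 == k).
Proof.
move=> hi; case: eqP => [e|ne].
  apply: (isM_1n nu_gt0 lastB_norm lastB_par); rewrite lastB_even /dif e; gram ox.
  by rewrite !(oppr0, addr0, add0r).
apply: (isM_0n nu_gt0 lastB_norm lastB_par); rewrite lastB_even /dif; gram ox.
by rewrite !(oppr0, addr0, add0r).
Qed.

Lemma dif_swp_neg e i : (i < k)%N -> (forall j, (j < k)%N -> e j = false) -> e k = true ->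
  dif (fun j => sgn (e j) (x (swp k j))) i = dif x i + lastB x *+ (i.+1 == k).
Proof.
move=> hi e0 e1; rewrite /dif lastB_even (e0 i) //= swpD; [|lia|lia].
case: eqP => [e2|ne]; last by rewrite e0 /= ?swpD ?addr0 //; lia.
by rewrite e2 e1 swpL hk /sgn opprK mulr1n addrA subrK.
Qed.

(** An ordinary reflection at the fork of a type D diagram: $x_k$ and $x_n$ are exchanged and both
    negated, so their difference is fixed. *)
Lemma refl_step_last_even : par (x k) = false -> refl_step x n id.
Proof.
move=> pk; exists (flp2 k), (swp k), (fun j => sgn (flp2 k j) (x (swp k j))).
exists (fun i => (i.+1 == k) : nat); split.
- by apply: signed_perm_swp_neg; rewrite hk.
- move=> i hi ip; rewrite base_n; have [e|ne] := eqVneq i k.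
    rewrite base_lt e; last lia.
    rewrite (_ : k.+1 == k = false); last lia.
    apply: (isM_0n nu_gt0 lastB_norm lastB_par); rewrite lastB_even /dif xk1; gram ox.
    by rewrite pk pn !(oppr0, addr0, add0r) subrr.
  rewrite base_lt; last lia.
  by apply: lastB_isM; lia.
- move=> i hi ip; rewrite base_n; have [e|ne] := eqVneq i k.
    rewrite !base_lt e; [|lia|lia].
    rewrite (_ : k.+1 == k = false); last lia.
    by rewrite addr0 /dif /flp2 !eqxx orbT /= swpL swpR hk opprK addrC.
  rewrite !base_lt; [|lia|lia].
  apply: dif_swp_neg; rewrite /flp2 ?eqxx //; [lia | move=> j hj; lia].
move=> i hi ->; rewrite !base_n lastB_even /lastB nsh par_sgn k1 /flp2.
by rewrite -[swp k n]/(swp k n) -hk swpR pk !eqxx orbT /= swpL hk opprD addrC.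
Qed.

(** The last root $x_k+x_n$ is isotropic. Taking $-x_n$ and $x_k$ as new last frame vectors turns
    the fork into a chain ending in $2x_k$; the negated root now sits at node k, whence the
    relabelling [swp k]. *)
Lemma refl_step_last_odd : par (x k) -> refl_step x n (swp k).
Proof.
move=> pk; exists (flp k), (swp k), (fun j => sgn (flp k j) (x (swp k j))).
exists (fun i => (i.+1 == k) || (i == k) : nat); split.
- by apply: signed_perm_swp_neg; rewrite hk.
- move=> i hi ip; rewrite base_n; have [e|ne] := eqVneq i k.
    rewrite base_lt e ?orbT; last lia.
    apply: isM_1; rewrite ?lastB_norm ?lastB_par ?pk ?pn //.
      rewrite lastB_even /dif xk1; gram ox; rewrite pk pn /frame_norm; move: nu_gt0; lia.
    by rewrite /frame_norm addNr eqxx.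
  rewrite base_lt ?orbF; last lia.
  by apply: lastB_isM; lia.
- move=> i hi; have [e|ni] := eqVneq i n.
    rewrite e -[in swp k _]hk swpR => _; rewrite eqxx orbT !base_n base_lt; last lia.
    rewrite lastB_even /lastB nsh par_sgn k1 /flp.
    have -> : swp k n = k by rewrite -hk swpR.
    have -> : (n == k) = false by lia.
    by rewrite pk /dif xk1 mulr1n addrACA addNr addr0.
  have [e|ne] := eqVneq i k; first by rewrite e swpL hk eqxx.
  rewrite swpD //; last by rewrite hk.
  move=> _; rewrite base_n !base_lt ?(negPf ne) ?orbF; [|lia|lia].
  apply: dif_swp_neg; rewrite /flp ?eqxx //; [lia | move=> j hj; lia].
move=> i hi e; have -> : i = k by rewrite -(swpK k i) e -hk swpR.
rewrite base_n base_lt; last lia.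
rewrite lastB_even /dif swpL swpR /flp eqxx (_ : (k.+1 == k) = false); last lia.
by rewrite /sgn xk1 opprD addrC.
Qed.

End EvenLast.

Lemma refl_stepP p : (p < N)%N -> exists t : {perm 'I_N},
  refl_step x p (fun i => t (inord i)).
Proof.
have W s : (forall i, (i < N)%N -> (s i < N)%N) -> involutive s -> refl_step x p s ->
    exists t : {perm 'I_N}, refl_step x p (fun i => t (inord i)).
  move=> hs ss [e [s' [x' [M [h1 h2 h3 h4]]]]].
  have inj : injective (fun i : 'I_N => Ordinal (hs i (ltn_ord i))).
    by move=> i j [e']; apply: val_inj; rewrite /= -[i : nat]ss e' ss.
  exists (perm inj), e, s', x', M; split=> // i hi; rewrite permE /= inordK //; first exact: h3.
  exact: h4.
rewrite ltnS leq_eqVlt => /predU1P[e|hp]; last by apply: (W id); [| |apply: refl_step_chain].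
subst p.
have [hs|hs] := boolP sh; last first.
  move: hn; rewrite (negPf hs) /= => n0; have hk : n.-1.+1 = n by rewrite prednK.
  case pn: (par (x n)); last first.
    case pk: (par (x n.-1)).
      by apply: (W (swp n.-1)); [move=> i; apply: swp_lt; rewrite hk | exact: swpK
                                |apply: refl_step_last_odd => //; exact: negbTE].
    by apply: (W id) => //; apply: (@refl_step_last_even n.-1); rewrite ?(negbTE hs).
  apply: (W id) => //; apply: (@refl_step_last_neg 1); rewrite // ?base_n /lastB (negPf hs) ?pn //.
  by rewrite par_sgn pn /flp eqxx mulNrn.
apply: (W id) => //; apply: (@refl_step_last_neg 0); rewrite // ?base_n /lastB hs ?mulr1n //.
by rewrite /flp eqxx.
Qed.

End TypeB.

(** * Types B, C and D: the class of bases *)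

Section ClassB.
Variables (V : zmodType) (f : zform V) (n : nat) (nu : int) (sh : bool).
Notation N := n.+1.
Hypothesis nu_gt0 : 0 < nu.
Hypothesis hn : sh || (0 < n)%N.
Variable x0 : nat -> V.
Hypothesis ox0 : orth f N nu x0.

Definition PhiB : seq V :=
  [seq sgn t.1.2 (x0 t.1.1.1) + sgn t.2 (x0 t.1.1.2) |
     t : 'I_N * 'I_N * bool * bool <- enum [pred t : 'I_N * 'I_N * bool * bool | t.1.1.1 != t.1.1.2]] ++
  if sh then [seq sgn t.2 (x0 t.1) | t : 'I_N * bool <- enum {: 'I_N * bool}]
  else [seq sgn t.2 (x0 t.1 *+ 2) | t : 'I_N * bool <- enum [pred t : 'I_N * bool | zpar f (x0 t.1)]].

Lemma PhiBP g : g \in PhiB <-> rtB f N sh x0 g.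
Proof.
rewrite mem_cat; split.
  case/orP => [/mapP[[[[i j] b] c]]|]; rewrite ?mem_enum /=.
    by move=> ij ->; left; exists i, j, b, c.
  case: (sh) => /mapP[[i b]]; rewrite mem_enum ?inE /=.
    by move=> _ ->; right; exists i, b.
  by move=> pi ->; right; exists i, b.
case=> [[i [j [b [c [hi hj ij ->]]]]]|[i [b [hi h]]]]; apply/orP; [left|right].
  by apply/mapP; exists (Ordinal hi, Ordinal hj, b, c); rewrite ?mem_enum.
case: (sh) h => [->|[pi ->]]; apply/mapP; exists (Ordinal hi, b); rewrite ?mem_enum //.
Qed.

Definition baseB x (i : 'I_N) : V := base f n sh x i.

Definition classB (a : 'I_N -> V) : Prop :=
  exists x, [/\ orth f N nu x, forall g, g \in PhiB <-> rtB f N sh x g & a = baseB x].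

Lemma classB0 : classB (baseB x0).
Proof. by exists x0; split=> // g; exact: PhiBP. Qed.

Section Frame.
Variable x : nat -> V.
Hypothesis ox : orth f N nu x.
Notation a := (baseB x).

Lemma baseB_dif i j : (i <= j)%N -> (j <= n)%N -> Qp a (x i - x j).
Proof. by apply: dif_Qp (leqnSn n) _ _ _ => i' hi; rewrite /baseB base_lt. Qed.

Lemma baseB_last : Qp a (lastB f n sh x).
Proof. by rewrite -base_n; exact: (Qp_gen a ord_max). Qed.

Lemma baseB_short i : sh -> (i <= n)%N -> Qp a (x i).
Proof.
move=> hs hi; rewrite -(subrK (x n) (x i)); apply: QpD; first exact: baseB_dif.
by have := baseB_last; rewrite /lastB hs.
Qed.

Lemma subr_addK (u v w z : V) : (u - w) + (v - z) + (w + z) = u + v.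
Proof. by rewrite addrACA !subrK. Qed.

(** Both vectors are lowered along the chain until the last simple root remains. For $x_n$ even
    outside type B that root is $x_{n-1}+x_n$, which excludes $i=j=n$. *)
Lemma baseB_pair i j : (i <= j)%N -> (j <= n)%N -> (~~ zpar f (x n) -> (i < n)%N) ->
  Qp a (x i + x j).
Proof.
move=> ij jn h; have hi := leq_trans ij jn.
have [hs|hs] := boolP sh; first by apply: QpD; apply: baseB_short.
have := baseB_last; rewrite /lastB (negPf hs); case: (zpar f (x n)) h => h l.
  by rewrite -(subr_addK (x i) (x j) (x n) (x n)) -mulr2n; apply: QpD l; apply: QpD; apply: baseB_dif.
have {}h := h isT; rewrite -(subr_addK (x i) (x j) (x n.-1) (x n)); apply: QpD l.
apply: QpD; apply: baseB_dif => //; last exact: leq_pred.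
by rewrite -ltnS prednK // (leq_ltn_trans _ h).
Qed.

Lemma baseB_pos g : rtB f N sh x g -> Qp a g \/ Qp a (- g).
Proof.
have sum i j b c : (i < j)%N -> (j < N)%N ->
    let g := sgn b (x i) + sgn c (x j) in Qp a g \/ Qp a (- g).
  rewrite ltnS => ij jn /=; case: b; case: c => /=; rewrite /sgn ?opprD ?opprK.
  - by right; apply: baseB_pair => //; [exact: ltnW | move=> _; exact: leq_trans ij jn].
  - by right; apply: baseB_dif => //; exact: ltnW.
  - by left; apply: baseB_dif => //; exact: ltnW.
  - by left; apply: baseB_pair => //; [exact: ltnW | move=> _; exact: leq_trans ij jn].
have one b v : Qp a v -> Qp a (sgn b v) \/ Qp a (- sgn b v).
  by case: b => h; rewrite /sgn ?opprK; [right|left].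
case=> [[i [j [b [c [hi hj ij ->]]]]]|[i [b [hi h]]]].
  case: (ltngtP i j) ij => // ij _; first exact: sum.
  by rewrite addrC; apply: sum.
have [hs|hs] := boolP sh; move: h; rewrite ?hs ?(negPf hs).
  by move=> ->; apply: one; apply: baseB_short.
move=> [pi ->]; apply: one; rewrite mulr2n; apply: baseB_pair => // pn; rewrite ltn_neqAle; apply/andP; split=> //.
by apply: contraNneq pn => <-.
Qed.

Lemma dif_dualv i k : (i < n)%N -> (k < N)%N ->
  zf f (dif x i) (dualv f x k) = if i == k then nu else 0.
Proof.
move=> hi hk; have D l (hl : (l < N)%N) := dualvE ox hl hk.
rewrite /dif zfDl zfNl !D ?(leqW hi) ?(ltnW hi) //.
by case: ltngtP => h; rewrite ?subrr ?subr0.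
Qed.

Lemma baseB_indep : indep a.
Proof.
have D l j (hl : (l < N)%N) (hj : (j < N)%N) := dualvE ox hl hj.
have aE (i : 'I_N) : a i = if (i < n)%N then dif x i else lastB f n sh x by [].
have iN (i : 'I_N) : (i < n)%N = false -> i = n :> nat.
  by have := ltn_ord i; lia.
case ev : (~~ sh && ~~ zpar f (x n)); last first.
  pose d (k : 'I_N) : int := if (k < n)%N then nu else if sh then nu else nu + nu.
  apply: (@indep_dual _ f _ a (fun k : 'I_N => dualv f x k) d).
    by move=> k; rewrite /d; do ![case: ifP => _]; move: nu_gt0; lia.
  move=> i k; have hk := ltn_ord k; rewrite aE /d -val_eqE /=; case: ifP => hi.
    by rewrite dif_dualv //; case: eqP => // <-; rewrite hi.
  have kn : n != k -> (k < n)%N by lia.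
  rewrite /lastB (iN i hi); case: (sh) ev => /= [_|].
    by rewrite D //; have [<-|ne] := eqVneq n k; rewrite ?leqnn ?ltnn // leqNgt kn.
  move=> /negbFE ->; rewrite zfMl D //; have [<-|ne] := eqVneq n k.
    by rewrite leqnn ltnn mulz2.
  by rewrite leqNgt kn.
have /andP[/negPf hs /negPf pn] := ev.
have n0 : (0 < n)%N by move: hn; rewrite hs.
have hK : (n.-1 < N)%N by rewrite ltnS leq_pred.
(* When the last root is $x_{n-1}+x_n$, the dual vector of node $n-1$ has to be corrected so that it
   vanishes on that root. *)
pose y (k : 'I_N) := if k.+1 == n then dualv f x k *+ 2 - dualv f x n else dualv f x k.
pose d (k : 'I_N) : int := if (k.+1 < n)%N then nu else nu + nu.
apply: (@indep_dual _ f _ a y d).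
  by move=> k; rewrite /d; case: ifP => _; move: nu_gt0; lia.
move=> i k; have hk := ltn_ord k; rewrite aE /y /d -val_eqE /=; case: ifP => hi.
  case: eqP => [e|ne].
    rewrite zfDr zfNr zfMr !dif_dualv // (ltn_eqF hi) subr0.
    by rewrite e ltnn; case: eqP => _; rewrite ?mul0r // mulz2.
  rewrite dif_dualv //; case: eqP => // e; rewrite -e in ne.
  by rewrite -e ltn_neqAle hi andbT; move/eqP: ne => ->.
rewrite (iN i hi) /lastB hs pn; case: eqP => [e|ne].
  rewrite zfDr zfNr zfMr !zfDl !D // leqnn leq_pred.
  have -> : (n.-1 <= k)%N by lia.
  have [-> ->] : (n <= k)%N = false /\ (n == k) = false by lia.
  by rewrite addr0 mulz2 subrr.
rewrite zfDl !D //; have [e|ne2] := eqVneq n k.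
  by rewrite -e leqnn leq_pred ltnNge leqnSn.
have [-> ->] : (n <= k)%N = false /\ (n.-1 <= k)%N = false by lia.
by rewrite addr0.
Qed.

End Frame.

Theorem classB_sclass : sclass f PhiB classB.
Proof.
pose c := if sh then nu ^+ 2 else nu ^+ 2 + nu ^+ 2.
have nu2 : 0 < nu ^+ 2 by rewrite exprn_gt0.
have c0 : 0 < c by rewrite /c; case: (sh); rewrite ?addr_gt0.
have [z red] : 0 \notin PhiB /\ (forall g n, g \in PhiB -> g *+ n \in PhiB -> n = 1%N).
  apply: (Qn_red (f := f) (N := N) (x := x0) c0) => g /PhiBP[[i [j [b [c' [hi hj ij ->]]]]]|[i [b [hi h]]]].
    by rewrite (Qn2 ox0) // /c; case: (sh); [right|left].
  rewrite /c; case: (sh) h => [->|[pi ->]].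
    by left; rewrite -[x0 i]mulr1n (Qn1 ox0) // mulr1.
  by right; rewrite (Qn1 ox0) // PoszM mulrA !mulz2.
split=> //.
- by move=> _ [x [ox _ ->]]; apply: baseB_indep.
- move=> _ i [x [ox hP ->]]; apply/hP; rewrite /baseB /base; case: ifP => hi.
    by left; exists (i : nat), i.+1, false, true; split=> //; lia.
  rewrite /lastB; case hs: (sh); first by right; exists n, false; rewrite ltnSn.
  case pn: (zpar f (x n)); first by right; exists n, false; rewrite ltnSn pn.
  left; exists n.-1, n, false, false; split=> //; first by rewrite ltnS leq_pred.
  by move: hn; rewrite hs /=; lia.
- by move=> _ g [x [ox hP ->]] /hP; apply: baseB_pos.
move=> _ p [x [ox hP ->]].
have [t [e [s [x' [M [sp hM h1 h2]]]]]] := refl_stepP nu_gt0 hn ox (ltn_ord p).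
exists (fun i : 'I_N => M i); split; first by move=> i ip; apply: hM.
exists t, x'; split.
- exact: signed_perm_orth sp ox.
- move=> g; rewrite hP; split; last exact: rtB_perm sp.
  by apply: rtB_perm (signed_perm_sym sp).
apply: funext => i; have := h1 i (ltn_ord i); have := h2 i (ltn_ord i).
rewrite inord_val /refl_base /= -val_eqE /= /baseB; case: eqVneq => [-> /(_ erefl) -> _ //|tp _].
by move=> ->.
Qed.

End ClassB.

(** * Types F and G *)

(* Gram matrix, parities, and coordinates of the positive roots of a simple system *)
Definition dynkin : Type := seq (seq int) * seq bool * seq (seq nat).

Section Dynkin.
Variable n : nat.
Implicit Types (o : dynkin) (p i j : nat) (c : seq nat).

Definition dkG o i j : int := nth 0 (nth [::] o.1.1 i) j.
Definition dkP o i : bool := nth false o.1.2 i.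
(** Computed by a division of absolute values; the test [dk_isM] inside [dk_closed] certifies the
    result. *)
Definition dkM o p i : nat :=
  if i == p then 0%N else
  if dkG o p p == 0 then nat_of_bool (dkG o p i != 0) else (absz (dkG o p i + dkG o p i)%R %/ absz (dkG o p p))%N.
Definition unit_seq p : seq nat := mkseq (fun i => i == p : nat) n.

(** In the reflected base the p-coordinate $c_p$ of a root is replaced by this number minus
    $c_p$. *)
Definition dk_height o p c : nat := sumn [seq dkM o p j * nth 0 c j | j <- iota 0 n]%N.
(** The root $a_p$ becomes negative, so the positive root $-a_p$ takes its place; it is the new
    simple root at p, with the same coordinates. *)
Definition dk_refl_root o p c : seq nat := if c == unit_seq p then c else
  mkseq (fun i => if i == p then dk_height o p c - nth 0 c p else nth 0 c i)%N n.

Definition dk_refl_gram o p i j : int :=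
  let s k : int := if k == p then -1 else 1 in let m k : int := (dkM o p k)%:Z in
  s i * s j * dkG o i j + s i * m j * dkG o i p + m i * s j * dkG o p j + m i * m j * dkG o p p.

Definition dk_isM o p i (M : nat) : bool :=
  if dkG o p p == 0 then dkP o p && (M == nat_of_bool (dkG o p i != 0))
  else (dkG o p p * M%:Z + dkG o p i + dkG o p i == 0) && (dkP o p ==> ~~ odd M).

Definition dk_refl_of o p o' : bool :=
  [&& all (fun i => all (fun j => dkG o' i j == dk_refl_gram o p i j) (iota 0 n)) (iota 0 n),
      all (fun i => dkP o' i == dkP o i (+) (dkP o p && odd (dkM o p i))) (iota 0 n),
      all (fun c => dk_refl_root o p c \in o'.2) o.2 &
      all (mem [seq dk_refl_root o p c | c <- o.2]) o'.2].

(** A finite certificate, checked by evaluation, that the list is stable under reflections. The test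
    on [dk_height] excludes truncation in the subtraction of [dk_refl_root]. *)
Definition dk_closed (os : seq dynkin) : bool := all (fun o =>
  all (fun p => [&& unit_seq p \in o.2,
     all (fun i => (i == p) || dk_isM o p i (dkM o p i)) (iota 0 n),
     all (fun c => (c == unit_seq p) || (nth 0 c p <= dk_height o p c)%N) o.2 &
     has (dk_refl_of o p) os]) (iota 0 n)) os.

(** Coordinates with greatest common divisor 1 force the root system to be reduced, see [dk_red]. *)
Definition dk_primitive o : bool := all (fun c => (size c == n) && (foldr gcdn 0%N c == 1)%N) o.2.

Definition dk_refl o p : dynkin :=
  (mkseq (fun i => mkseq (dk_refl_gram o p i) n) n,
   mkseq (fun i => dkP o i (+) (dkP o p && odd (dkM o p i))) n,
   [seq dk_refl_root o p c | c <- o.2]).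

Definition dk_step (os : seq dynkin) : seq dynkin :=
  foldl (fun s op => if has (dk_refl_of op.1 op.2) s then s else rcons s (dk_refl op.1 op.2))
    os [seq (o, p) | o <- os, p <- iota 0 n].

End Dynkin.

Lemma all_iotaP n (P : pred nat) : all P (iota 0 n) -> forall i, (i < n)%N -> P i.
Proof. by move=> /allP h i hi; apply: h; rewrite mem_iota. Qed.

Lemma dvdn_foldr_gcdn m (c : seq nat) : all (dvdn m) c -> (m %| foldr gcdn 0 c)%N.
Proof. by elim: c => //= k c IH /andP[h /IH]; rewrite dvdn_gcd h. Qed.

(** * The class of bases described by a closed list of data *)

Section DynkinClass.
Variables (V : zmodType) (f : zform V) (n : nat).
Implicit Types (a : 'I_n -> V) (o : dynkin) (c : seq nat) (g : V).

Lemma zfMzr u v (m : int) : zf f u (v *~ m) = zf f u v * m.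
Proof. by rewrite zfC zfMz zfC. Qed.

Definition comb a c : V := \sum_(i < n) a i *+ nth 0%N c i.

Lemma comb_unit a (p : 'I_n) : comb a (unit_seq n p) = a p.
Proof.
rewrite /comb (bigD1 p) //= nth_mkseq // eqxx big1 ?addr0 // => i /negPf ip.
by rewrite nth_mkseq // (inj_eq val_inj) ip.
Qed.

Lemma indep_refl a p M : indep a -> indep (refl_base a p M).
Proof.
move=> ia h e.
have E : \sum_i a i *~ (if i == p then (\sum_(j | j != p) (M j)%:Z * h j) - h p else h i) = 0.
  rewrite -[RHS]e (bigD1 p) //= [RHS](bigD1 p) //= /refl_base eqxx mulrzBr mulNrz.
  rewrite [X in _ = _ + X](eq_bigr (fun i => a i *~ h i + a p *~ ((M i)%:Z * h i))); last first.
    by move=> i /negPf ->; rewrite mulrzDl pmulrn -mulrzA.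
  rewrite [X in _ + X](eq_bigr (fun i => a i *~ h i)); last by move=> i /negPf ->.
  rewrite big_split /= -(big_morph (fun z => a p *~ z) (mulrzDr (a p)) (mulr0z (a p))).
  by rewrite addrC [RHS]addrCA [- _ + _]addrC.
have hi i : i != p -> h i = 0 by move=> /negPf ip; have := ia _ E i; rewrite ip.
move=> i; have [->|/hi //] := eqVneq i p.
have := ia _ E p; rewrite eqxx big1 => [/eqP|j /hi ->]; last by rewrite mulr0.
by rewrite add0r oppr_eq0 => /eqP.
Qed.

Variables (Phi : seq V) (os : seq dynkin) (o0 : dynkin) (a0 : 'I_n -> V).

Definition dk_match a o : Prop :=
  [/\ forall i j, zf f (a i) (a j) = dkG o i j, forall i, zpar f (a i) = dkP o i &
      forall g, g \in Phi <-> exists c b, c \in o.2 /\ g = sgn b (comb a c)].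

Definition dk_class a : Prop := indep a /\ exists2 o, o \in os & dk_match a o.

Lemma dk_heightE o p c : dk_height n o p c = (\sum_(i < n) dkM o p i * nth 0 c i)%N.
Proof. by rewrite /dk_height sumnE big_map -[n in iota 0 n]subn0 big_mkord. Qed.

Lemma dkM_self o p : dkM o p p = 0%N. Proof. by rewrite /dkM eqxx. Qed.

Lemma dk_reflE a o (p i : 'I_n) : refl_base a p (fun i => dkM o p i) i =
  a i *~ (if i == p :> nat then -1 else 1) + a p *~ (dkM o p i)%:Z.
Proof.
rewrite /refl_base (inj_eq val_inj); case: eqP => [->|_]; last by rewrite mulr1z -pmulrn.
by rewrite dkM_self mulr0z addr0 mulrN1z.
Qed.

Lemma comb_refl a o (p : 'I_n) c : (c == unit_seq n p) || (nth 0%N c p <= dk_height n o p c)%N ->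
  comb (refl_base a p (fun i => dkM o p i)) (dk_refl_root n o p c) = sgn (c == unit_seq n p) (comb a c).
Proof.
rewrite /dk_refl_root; case: eqP => [-> _|_ /= h].
  by rewrite !comb_unit /refl_base eqxx.
pose c' i := if i == p :> nat then (dk_height n o p c - nth 0 c p)%N else nth 0%N c i.
have E : (\sum_(i < n) dkM o p i * c' i = dk_height n o p c)%N.
  rewrite dk_heightE; apply: eq_bigr => i _; rewrite /c'; case: eqP => // ->.
  by rewrite dkM_self.
rewrite /comb (eq_bigr (fun i : 'I_n =>
   a i *~ (if i == p :> nat then -1 else 1) *+ c' i + a p *+ (dkM o p i * c' i))); last first.
  by move=> i _; rewrite nth_mkseq // dk_reflE mulrnDl -pmulrn mulrnA.
rewrite big_split /= -(big_morph (fun k => a p *+ k) (mulrnDr (a p)) (mulr0n (a p))) E.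
rewrite (bigD1 p) //= [in RHS](bigD1 p) //= /c' eqxx mulrN1z mulNrn mulrnBr //.
rewrite opprB addrAC addrNK; congr (_ + _); apply: eq_bigr => i /negPf ip.
by rewrite (inj_eq val_inj) ip mulr1z.
Qed.

Hypothesis closed : dk_closed n os.
Hypotheses (ho0 : o0 \in os) (prim : dk_primitive n o0).
Hypotheses (ia0 : indep a0) (ma0 : dk_match a0 o0).

Lemma dk_refl_match a o p : o \in os -> dk_match a o ->
  exists2 o', o' \in os & dk_match (refl_base a p (fun i => dkM o p i)) o'.
Proof.
move=> oos [mG mP mR].
have /and4P[_ _ /allP hpos /hasP[o' o'os]] := all_iotaP (allP closed _ oos) (ltn_ord p).
move=> /and4P[hG hP /allP hR1 /allP hR2]; exists o' => //; split.
- move=> i j; have /eqP -> := all_iotaP (all_iotaP hG (ltn_ord i)) (ltn_ord j).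
  rewrite !dk_reflE !(zfDl, zfDr, zfMz, zfMzr) !mG /dk_refl_gram; ring.
- move=> i; have /eqP -> := all_iotaP hP (ltn_ord i).
  rewrite /refl_base; case: eqVneq => [->|_]; last by rewrite parD parMn !mP.
  by rewrite parN dkM_self andbF addbF mP.
move=> g; split=> [/mR[c [b [hc ->]]]|[c' [b [/hR2 /mapP[c hc ->] ->]]]].
  exists (dk_refl_root n o p c), (b (+) (c == unit_seq n p)); split; first exact: hR1.
  by rewrite (comb_refl _ (hpos _ hc)) sgn_sgn addbK.
rewrite (comb_refl _ (hpos _ hc)) sgn_sgn; apply/mR.
by exists c, (b (+) (c == unit_seq n p)).
Qed.

(** By independence m divides every coordinate of the root $mg$, and these have greatest common
    divisor 1. *)
Lemma dk_red g m : g \in Phi -> g *+ m \in Phi -> m = 1%N.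
Proof.
have [_ _ mR] := ma0; move=> /mR[c [b [hc ->]]] /mR[c' [b' [hc' e]]].
have /andP[/eqP sz /eqP g1] := allP prim _ hc'.
have sE (d : bool) (l : seq nat) : sgn d (comb a0 l) =
    \sum_i a0 i *~ ((if d then -1 else 1) * (nth 0%N l i)%:Z).
  rewrite /comb /sgn; case: d; rewrite -?sumrN; apply: eq_bigr => i _.
    by rewrite mulN1r mulrNz -pmulrn.
  by rewrite mul1r -pmulrn.
have h := ia0 (f := fun i => ((if b then -1 else 1) * (nth 0%N c i)%:Z) * m%:Z -
   ((if b' then -1 else 1) * (nth 0%N c' i)%:Z)).
apply/eqP; rewrite -dvdn1 -g1; apply: dvdn_foldr_gcdn; apply/(all_nthP 0%N) => i.
rewrite sz => hi; have {}h := h _ (Ordinal hi).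
have /h/eqP : \sum_i a0 i *~ ((if b then -1 else 1) * (nth 0%N c i)%:Z * m%:Z -
   (if b' then -1 else 1) * (nth 0%N c' i)%:Z) = 0.
  rewrite (eq_bigr (fun i => a0 i *~ ((if b then -1 else 1) * (nth 0%N c i)%:Z) *+ m -
     a0 i *~ ((if b' then -1 else 1) * (nth 0%N c' i)%:Z))); last first.
    by move=> k _; rewrite mulrzBr mulrzA -pmulrn.
  by rewrite sumrB sumrMnl -!sE e subrr.
rewrite subr_eq0 /= => /eqP /(congr1 absz); rewrite !abszM.
have a1 (d : bool) : absz (if d then -1 else 1) = 1%N by case: d.
by rewrite !a1 !mul1n /= => <-; apply: dvdn_mull.
Qed.

Theorem dk_class_sclass : sclass f Phi dk_class.
Proof.
split.
- by move=> a [].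
- move=> a i [_ [o oos [_ _ mR]]]; apply/mR; exists (unit_seq n i), false.
  by have /andP[h _] := all_iotaP (allP closed _ oos) (ltn_ord i); rewrite comb_unit.
- by apply/negP => h; have := dk_red h; move/(_ 0%N); rewrite mulr0n => /(_ h).
- exact: dk_red.
- move=> a g [_ [o _ [_ _ mR]]] /mR[c [b [_ ->]]].
  have q : Qp a (comb a c) by exists (fun i : 'I_n => nth 0%N c i).
  by case: b; rewrite /sgn ?opprK; [right|left].
move=> a p [ia [o oos m]]; exists (fun i : 'I_n => dkM o p i); split; last first.
  exists 1%g; have [o' h1 h2] := dk_refl_match p oos m.
  rewrite (_ : _ \o _ = refl_base a p (fun i : 'I_n => dkM o p i)); last by apply: funext => i /=; rewrite perm1.
  by split; [apply: indep_refl | exists o'].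
have [mG mP _] := m.
have /and4P[_ h _ _] := all_iotaP (allP closed _ oos) (ltn_ord p).
move=> i ip; have := all_iotaP h (ltn_ord i); rewrite (inj_eq val_inj) (negPf ip) /= /dk_isM /isMult.
rewrite !mG mP; case: eqP => _ /andP[h1 h2]; first by rewrite h1 (eqP h2).
by rewrite (eqP h1); split=> //; apply/implyP.
Qed.

End DynkinClass.

(** The nine positive roots of $B_3$ have last coordinate 0, the eight odd ones have 1, and $\delta$
    is the root with last coordinate 2. *)
Definition dkF : dynkin :=
 ([:: [:: 4; -2; 0; 0]; [:: -2; 4; -2; 0]; [:: 0; -2; 2; -1]; [:: 0; 0; -1; 0]],
  [:: false; false; false; true],
  [:: [:: 0; 0; 0; 1]; [:: 0; 0; 1; 0]; [:: 0; 0; 1; 1]; [:: 0; 1; 0; 0]; [:: 0; 1; 1; 0];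
      [:: 0; 1; 1; 1]; [:: 0; 1; 2; 0]; [:: 0; 1; 2; 1]; [:: 1; 0; 0; 0]; [:: 1; 1; 0; 0];
      [:: 1; 1; 1; 0]; [:: 1; 1; 1; 1]; [:: 1; 1; 2; 0]; [:: 1; 1; 2; 1]; [:: 1; 2; 2; 0];
      [:: 1; 2; 2; 1]; [:: 1; 2; 3; 1]; [:: 1; 2; 3; 2]]%N).

(** First coordinate 0 gives the positive roots of $G_2$, first coordinate 1 the odd roots; $\delta$
    is $(1,2,1)$ and $2\delta$ is left out. *)
Definition dkG3 : dynkin :=
 ([:: [:: 0; 1; 0]; [:: 1; -2; 3]; [:: 0; 3; -6]], [:: true; false; false],
  [:: [:: 0; 0; 1]; [:: 0; 1; 0]; [:: 0; 1; 1]; [:: 0; 2; 1]; [:: 0; 3; 1]; [:: 0; 3; 2];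
      [:: 1; 0; 0]; [:: 1; 1; 0]; [:: 1; 1; 1]; [:: 1; 2; 1]; [:: 1; 3; 1]; [:: 1; 3; 2];
      [:: 1; 4; 2]]%N).

(* The reflections of [dkF] (resp. [dkG3]) reach 6 (resp. 4) data up to the order of the roots. *)
Lemma dkF_closed : dk_closed 4 (iter 5 (dk_step 4) [:: dkF]).
Proof. by vm_compute. Qed.
Lemma dkG3_closed : dk_closed 3 (iter 4 (dk_step 3) [:: dkG3]).
Proof. by vm_compute. Qed.

(** * The root data of the theorem *)

Definition straightens (D : sdatum) : Prop :=
  forall (rho : 'S_(rank D)) (i j : word D), Lplus rho i -> Lplus rho j -> lexlt rho i j ->
  exists cs : seq (word D * K),
    (forall kc, kc \in cs ->
       dominant rho kc.1 /\ lexle rho (i ++ j) kc.1 /\ lexle rho kc.1 (j ++ i)) /\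
    eqF (star (EL rho j) (EL rho i))
        (flatten [seq scaleF kc.2 (Ew rho kc.1) | kc <- cs]).

Lemma sclass_straightens (D : sdatum) (V : zmodType) (f : zform V) (a : 'I_(rank D) -> V) Phi C :
  sclass f Phi C -> C a ->
  (forall i j, Defs.bil (@sroot D i) (@sroot D j) = (zf f (a i) (a j))%:~R) ->
  (forall i : letter D, Defs.par i = zpar f (a i)) ->
  diso D != 0 -> (barneg D -> forall u v, exists e, zf f u v = e + e) -> straightens D.
Proof.
move=> hC Ca hG hp hd hb rho i j.
apply: (@straightening D V (zchi f) a (fun i j => zf f (a i) (a j)) hG _ hd _ rho Phi
  (fun a => exists s : {perm 'I_(rank D)}, C (a \o s)) (sclass_root_class hC)).
- by move=> k l; rewrite zchiE !hp.
- by move=> b k l; apply: hb.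
by exists 1%g; rewrite (_ : _ \o _ = a) //; apply: funext => k /=; rewrite perm1.
Qed.

(** * Integral models of the diagonal forms *)

Section Diag.
Variables (N : nat) (isd : 'I_N -> bool) (g : int).

Definition diag_zf (u v : 'rV[int]_N) : int :=
  \sum_k (if isd k then - g else g) * (u 0 k * v 0 k).
Definition diag_zs (u : 'rV[int]_N) : int := \sum_k (if isd k then u 0 k else 0).

Definition diag_zform : zform 'rV[int]_N.
Proof.
exists diag_zf diag_zs.
- by move=> u v; apply: eq_bigr => k _; rewrite [u 0 k * _]mulrC.
- move=> u v w; rewrite /diag_zf -big_split; apply: eq_bigr => k _.
  by rewrite mxE mulrDl mulrDr.
move=> u v; rewrite /diag_zs -big_split; apply: eq_bigr => k _.
by rewrite mxE; case: (isd k); rewrite ?addr0.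
Defined.

Definition Rv (u : 'rV[int]_N) : 'rV[rat]_N := map_mx intr u.

Lemma RvD u v : Rv (u + v) = Rv u + Rv v.
Proof. by apply/rowP => k; rewrite !mxE rmorphD. Qed.
Lemma RvB u v : Rv (u - v) = Rv u - Rv v.
Proof. by apply/rowP => k; rewrite !mxE rmorphB. Qed.
Lemma RvMn u n : Rv (u *+ n) = n%:R *: Rv u.
Proof. by apply/rowP => k; rewrite !mxE mulmxnE rmorphMn /= mulr_natl. Qed.
Lemma Rv_delta k : Rv (delta_mx 0 k) = ev k.
Proof. by apply/rowP => j; rewrite !mxE; case: (_ && _). Qed.

Lemma bil_diag u v : (Rv u *m diag_gram isd g%:~R *m (Rv v)^T) 0 0 = (diag_zf u v)%:~R.
Proof.
rewrite mxE rmorph_sum; apply: eq_bigr => k _; rewrite !mxE (bigD1 k) //= big1 => [|j].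
  by rewrite !mxE eqxx addr0 !rmorphM; case: (isd k); rewrite /= ?rmorphN /= mulrAC mulrC.
by rewrite !mxE => /negPf ->; rewrite mulr0.
Qed.

(** The sum of the delta coordinates: $\pm1$ on every odd root, while on the integral lattice its
    residue mod 2 is the parity. *)
Definition odd_wt (v : 'rV[rat]_N) : rat := \sum_k (if isd k then v 0 k else 0).

Lemma odd_wt_Rv u : odd_wt (Rv u) = (diag_zs u)%:~R.
Proof. by rewrite rmorph_sum; apply: eq_bigr => k _; rewrite mxE; case: (isd k). Qed.

Lemma odd_wtD u v : odd_wt (u + v) = odd_wt u + odd_wt v.
Proof. by rewrite /odd_wt -big_split; apply: eq_bigr => k _; rewrite mxE; case: (isd k); rewrite ?addr0. Qed.
Lemma odd_wtZ c u : odd_wt (c *: u) = c * odd_wt u.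
Proof. by rewrite /odd_wt mulr_sumr; apply: eq_bigr => k _; rewrite mxE; case: (isd k); rewrite ?mulr0. Qed.
Lemma odd_wt_ev k : odd_wt (ev k) = (isd k)%:R.
Proof.
rewrite /odd_wt (bigD1 k) //= big1 => [|j /negPf jk]; last by rewrite mxE jk andbF if_same.
by rewrite mxE !eqxx addr0; case: (isd k).
Qed.

Definition odd_int (z : rat) : Prop := z = 1 \/ z = -1.

Lemma odd_par u : odd_int (odd_wt (Rv u)) -> zpar diag_zform u.
Proof.
have E (z : int) : odd_int z%:~R -> zodd z.
  by case=> /eqP; [rewrite (_ : 1 = 1%:~R) // eqr_int | rewrite (_ : -1 = (-1)%:~R) // eqr_int] => /eqP ->.
by rewrite odd_wt_Rv => /E.
Qed.

Lemma rootsA_odd v : (v, true) \in rootsA isd -> odd_int (odd_wt v).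
Proof.
move=> /flatten_mapP[i _ /mapP[j _ [-> e]]].
rewrite odd_wtD -scaleN1r odd_wtZ !odd_wt_ev; move: e.
by case: (isd i); case: (isd j) => // _; [left|right]; rewrite ?mulr0 ?addr0 ?add0r ?mulr1.
Qed.

Lemma rootsA_mem i j : isd i != isd j -> (ev i - ev j, true) \in rootsA isd.
Proof.
move=> h; apply/flatten_mapP; exists i; first by rewrite mem_enum.
apply/mapP; exists j; last by rewrite h.
by rewrite mem_filter mem_enum andbT; apply: contraNneq h => ->.
Qed.

Lemma rootsBCD_odd sh lo v : (v, true) \in rootsBCD isd sh lo -> odd_int (odd_wt v).
Proof.
have P (s : rat) : s \in pm -> odd_int s by rewrite !inE => /orP[] /eqP ->; [left|right].
rewrite !mem_cat => /or3P[|h|h].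
- move=> /flattenP[L /flattenP[L' /mapP[i _ ->] /mapP[j _ ->]]].
  move=> /allpairsP[[s u] /= [hs hu [-> e]]].
  rewrite odd_wtD !odd_wtZ !odd_wt_ev; move: e.
  by case: (isd i); case: (isd j) => // _; rewrite ?mulr0 ?addr0 ?add0r ?mulr1; apply: P.
- case: sh h => // /allpairsP[[i s] /= [_ hs [-> e]]].
  by rewrite odd_wtZ odd_wt_ev -e mulr1; apply: P.
by case: lo h => // /allpairsP[[i s] /= [_ hs []]].
Qed.

Lemma rootsBCD_mem sh lo i j s u : isd i != isd j -> s \in pm -> u \in pm ->
  (s *: ev i + u *: ev j, true) \in rootsBCD isd sh lo.
Proof.
wlog ij : i j s u / (i < j)%N => [W h hs hu|h hs hu].
  case: (ltngtP i j) => ij; first exact: W.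
    by rewrite addrC; apply: W => //; rewrite eq_sym.
  by case/eqP: h; rewrite (val_inj ij).
rewrite mem_cat; apply/orP; left; apply/flattenP.
exists [seq (s *: ev i + u *: ev j, isd i != isd j) | s <- pm, u <- pm]; last first.
  by apply/allpairsP; exists (s, u); rewrite /= h.
apply/flattenP; exists [seq [seq (s *: ev i + u *: ev j, isd i != isd j) | s <- pm, u <- pm]
         | j <- [seq j : 'I_N <- enum 'I_N | (i < j)%N]].
  by apply/mapP; exists i; rewrite ?mem_enum.
apply/mapP; exists j => //; rewrite mem_filter ij. by rewrite mem_enum.
Qed.

Lemma rootsB_mem lo i : isd i -> (ev i, true) \in rootsBCD isd true lo.
Proof.
move=> h; rewrite !mem_cat; apply/or3P; apply: Or32; apply/allpairsP; exists (i, 1).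
by rewrite /= mem_enum h scale1r.
Qed.

End Diag.

Lemma pm1 : (1 : rat) \in pm. Proof. by []. Qed.
Lemma pmN1 : (-1 : rat) \in pm. Proof. by []. Qed.

Section Frame0.
Variables (n : nat) (isd : 'I_n.+1 -> bool) (g : int) (s : 'S_n.+1).
Notation f := (diag_zform isd g).

Definition frame0 (k : nat) : 'rV[int]_n.+1 := delta_mx 0 (s (inord k)).

Lemma frame0_par k : zpar f (frame0 k) = isd (s (inord k)).
Proof.
rewrite /zpar /= /diag_zs (bigD1 (s (inord k))) //= big1 ?addr0.
  by rewrite mxE !eqxx; case: (isd _).
by move=> j /negPf jk; rewrite mxE jk andbF if_same.
Qed.

Lemma frame0_orth : orth f n.+1 g frame0.
Proof.
move=> j k hj hk; rewrite frame0_par /= /diag_zf (bigD1 (s (inord k))) //= big1 ?addr0.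
  rewrite !mxE !eqxx /= mulr1 (inj_eq perm_inj) -val_eqE /= !inordK // eq_sym.
  by case: eqP => _; rewrite ?mulr1 ?mulr0.
by move=> i /negPf ik; rewrite [frame0 k _ _]mxE ik andbF !mulr0.
Qed.

Lemma Rv_dif a : Rv (dif frame0 a) = sdiff s a.
Proof. by rewrite RvB !Rv_delta. Qed.

Lemma par_dif a : zpar f (dif frame0 a) = isd (s (inord a)) (+) isd (s (inord a.+1)).
Proof. by rewrite parD parN !frame0_par. Qed.

End Frame0.

Lemma straightens_A m n (s : 'S_((m + n).+2)) : straightens (datumA s).
Proof.
pose isd := fun k : 'I_((m + n).+2) => (m < k)%N.
have ox := frame0_orth isd 1 s.
apply: (@sclass_straightens (datumA s) _ (diag_zform isd 1) (baseA (frame0 s)) _ _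
  (classA_sclass ltr01 ox) (classA0 ox)) => //.
- by move=> i j; rewrite -(bil_diag isd) !Rv_dif.
move=> i; rewrite /baseA par_dif; apply/idP/idP => h.
  by rewrite -(par_dif isd 1 s); apply: odd_par; rewrite Rv_dif; apply: rootsA_odd.
by apply: (@rootsA_mem _ isd); rewrite negb_eqb.
Qed.

Section BCD.
Variables (n : nat) (isd : 'I_n.+1 -> bool) (g : int) (s : 'S_n.+1) (sh : bool).
Notation x := (frame0 s).
Notation f := (diag_zform isd g).
Notation a := (baseB f sh x).

Definition srootB (i : 'I_n.+1) : 'rV[rat]_n.+1 :=
  if (i.+1 < n.+1)%N then sdiff s i else if sh then ev (s (inord i)) else lastCD isd s i.

Lemma Rv_baseB i : Rv (a i) = srootB i.
Proof.
rewrite /srootB /baseB /base ltnS; case: ifP => h; first exact: Rv_dif.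
have -> : i = n :> nat by have := ltn_ord i; lia.
rewrite /lastB /lastCD frame0_par; case: (sh); first exact: Rv_delta.
by case: (isd _); rewrite ?RvMn ?RvD !Rv_delta.
Qed.

Lemma par_baseB i : (srootB i, true) \in rootsBCD isd sh (~~ sh) = zpar f (a i).
Proof.
apply/idP/idP => [h|].
  by apply: odd_par; rewrite Rv_baseB; apply: rootsBCD_odd h.
rewrite /srootB /baseB /base ltnS; case: ifP => h.
  rewrite par_dif => e; rewrite /sdiff -[ev (s (inord i))]scale1r -scaleN1r.
  by apply: rootsBCD_mem; rewrite ?pm1 ?pmN1 // negb_eqb.
have -> : i = n :> nat by have := ltn_ord i; lia.
rewrite /lastB /lastCD frame0_par; case: (sh); first by rewrite frame0_par => e; apply: rootsB_mem.
case e: (isd _); first by rewrite parMn andbF.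
rewrite parD !frame0_par e addbF => e'; rewrite -[ev (s (inord n.-1))]scale1r -[ev (s (inord n))]scale1r.
by apply: rootsBCD_mem; rewrite ?pm1 // negb_eqb e addbF.
Qed.

End BCD.

(** One statement for three types: [sh] singles out type B, and g is the scale of the form, required
    even where the bar sends q to $-q^{-1}$. *)
Lemma straightens_BCD n (isd : 'I_n.+1 -> bool) (g : int) (s : 'S_n.+1) (sh bn : bool) :
  0 < g -> sh || (0 < n)%N -> (bn -> exists e, g = e + e) ->
  straightens (@SDatum n.+1 n.+1 (diag_gram isd g%:~R) (fun i => srootB isd s sh i)
    (rootsBCD isd sh (~~ sh)) g bn).
Proof.
move=> g0 hn hb; have ox := frame0_orth isd g s.
apply: (@sclass_straightens (SDatum _ _ _ _ _) _ (diag_zform isd g) (baseB (diag_zform isd g) sh (frame0 s)) _ _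
  (classB_sclass g0 hn ox) (classB0 _ ox)) => /=.
- by move=> i j; rewrite -(bil_diag isd) !Rv_baseB.
- by move=> i; rewrite -par_baseB.
- by rewrite gt_eqF.
move=> /hb[e ->] u v; exists (\sum_k (if isd k then - e else e) * (u 0 k * v 0 k)).
rewrite -big_split; apply: eq_bigr => k _; rewrite /= -mulrDl; case: (isd k) => //.
by rewrite opprD.
Qed.

Lemma straightens_B m n (s : 'S_((m + n).+1)) : straightens (datumB s).
Proof.
apply: (@straightens_BCD _ (fun k : 'I_((m + n).+1) => (m <= k)%N) 2 s true (m == 0)%N) => //.
by exists 1.
Qed.

Lemma straightens_C n (s : 'S_n.+1) : (1 <= n)%N -> straightens (datumC s).
Proof.
by move=> hn; apply: (@straightens_BCD _ (fun k : 'I_n.+1 => (0 < k)%N) 1 s false false).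
Qed.

Lemma straightens_D m n (s : 'S_((m + n).+1)) : (2 <= m)%N -> straightens (datumD s).
Proof.
move=> hm; apply: (@straightens_BCD _ (fun k : 'I_((m + n).+1) => (m <= k)%N) 1 s false false) => //.
by rewrite addn_gt0 (ltnW hm).
Qed.

(** * The integral form of a Gram matrix *)

Section DynkinForm.
Variables (n : nat) (o : dynkin).
Hypothesis sym : all (fun i => all (fun j => dkG o i j == dkG o j i) (iota 0 n)) (iota 0 n).

Definition dk_zform : zform 'rV[int]_n.
Proof.
exists (fun u v : 'rV[int]_n => \sum_(i < n) \sum_(j < n) u 0 i * dkG o i j * v 0 j)
  (fun u : 'rV[int]_n => \sum_(i < n) u 0 i * (dkP o i)%:Z).
- move=> u v; rewrite exchange_big; apply: eq_bigr => i _; apply: eq_bigr => j _.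
  by rewrite (eqP (all_iotaP (all_iotaP sym (ltn_ord i)) (ltn_ord j))); ring.
- move=> u v w; rewrite -big_split; apply: eq_bigr => i _; rewrite -big_split.
  by apply: eq_bigr => j _; rewrite mxE !mulrDl.
by move=> u v; rewrite -big_split; apply: eq_bigr => i _; rewrite mxE mulrDl.
Defined.

Definition dk_base (i : 'I_n) : 'rV[int]_n := delta_mx 0 i.

Lemma dk_zfE i j : zf dk_zform (dk_base i) (dk_base j) = dkG o i j.
Proof.
rewrite /= (bigD1 i) //= [X in _ + X]big1 => [|k /negPf ki]; last first.
  by rewrite big1 // => l _; rewrite mxE ki andbF !mul0r.
rewrite addr0 (bigD1 j) //= big1 => [|l /negPf lj]; last by rewrite [dk_base j _ _]mxE lj andbF mulr0.
by rewrite !mxE !eqxx mul1r mulr1 addr0.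
Qed.

Lemma dk_parE i : zpar dk_zform (dk_base i) = dkP o i.
Proof.
rewrite /zpar /= (bigD1 i) //= big1 => [|k /negPf ki]; last by rewrite mxE ki andbF mul0r.
by rewrite mxE !eqxx mul1r addr0; case: (dkP o i).
Qed.

Lemma dk_base_indep : indep dk_base.
Proof.
move=> h /rowP e i; have := e i; rewrite summxE mxE (bigD1 i) //= big1 => [|k ki].
  by rewrite -scaler_int !mxE !eqxx addr0 mulr1 intz.
by rewrite -scaler_int !mxE eq_sym (negPf ki) andbF mulr0.
Qed.

Definition dk_Phi : seq 'rV[int]_n :=
  [seq sgn cb.2 (comb dk_base cb.1) | cb <- [seq (c, b) | c <- o.2, b <- [:: true; false]]].

Lemma dk_base_match : dk_match dk_zform dk_Phi dk_base o.
Proof.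
split; [exact: dk_zfE | exact: dk_parE | move=> g; split].
  by move=> /mapP[_ /allpairsP[[c b] [hc _ ->]] ->]; exists c, b.
move=> [c [b [hc ->]]]; apply/mapP; exists (c, b) => //; apply/allpairsP; exists (c, b).
by split=> //; case: b.
Qed.

End DynkinForm.

Lemma dk_straightens D o (os : seq dynkin) : dk_closed (rank D) os -> o \in os ->
  dk_primitive (rank D) o ->
  all (fun i => all (fun j => dkG o i j == dkG o j i) (iota 0 (rank D))) (iota 0 (rank D)) ->
  (forall i j, Defs.bil (@sroot D i) (@sroot D j) = (dkG o i j)%:~R) ->
  (forall i : letter D, Defs.par i = dkP o i) -> diso D != 0 -> ~~ barneg D -> straightens D.
Proof.
move=> cl ho pr sym hG hp hd hb; have ia := @dk_base_indep (rank D).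
have ma := dk_base_match sym.
have Ca : dk_class (dk_zform sym) (dk_Phi _ o) os (@dk_base (rank D)).
  by split=> //; exists o.
apply: (@sclass_straightens D _ (dk_zform sym) (@dk_base (rank D)) _ _ (dk_class_sclass cl pr ia ma) Ca) => //.
- by move=> i j; rewrite dk_zfE.
- by move=> i; rewrite dk_parE.
by rewrite (negPf hb).
Qed.

(** * Explicit coordinates for F(3|1) and G(3) *)

Lemma sum_foldr n (F : nat -> rat) :
  \sum_(l < n) F l = foldr (fun l z => F l + z) 0 (iota 0 n).
Proof. by rewrite -(big_mkord xpredT F) /index_iota subn0 unlock. Qed.

(** Expresses the form through folds over tables of rational numbers, so that all inner products of
    simple roots are checked by evaluation. *)
Lemma bil_table D o (t h : nat -> nat -> rat) :
  (forall i k, @sroot D i 0 k = t i k) -> (forall k l, gram D k l = h k l) ->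
  let s F := foldr (fun l z => F l + z) 0 (iota 0 (amb D)) in
  all (fun i => all (fun j => s (fun l => s (fun k => t i k * h k l) * t j l) == (dkG o i j)%:~R)
    (iota 0 (rank D))) (iota 0 (rank D)) ->
  forall i j, Defs.bil (@sroot D i) (@sroot D j) = (dkG o i j)%:~R.
Proof.
move=> ht hh s H i j; rewrite -(eqP (all_iotaP (all_iotaP H (ltn_ord i)) (ltn_ord j))).
rewrite /s -sum_foldr /Defs.bil mxE; apply: eq_bigr => l _; rewrite !mxE ht -sum_foldr.
by congr (_ * _); apply: eq_bigr => k _; rewrite ht hh.
Qed.

Section RowEntry.
Variables (N : nat) (u v : 'rV[rat]_N) (c : rat) (k : 'I_N).
Lemma rvD : (u + v) 0 k = u 0 k + v 0 k. Proof. exact: mxE. Qed.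
Lemma rvN : (- u) 0 k = - u 0 k. Proof. exact: mxE. Qed.
Lemma rvZ : (c *: u) 0 k = c * u 0 k. Proof. exact: mxE. Qed.
End RowEntry.

Lemma e4E k (j : 'I_4) : (k < 4)%N -> e4 k 0 j = (j == k :> nat)%:R.
Proof. by move=> hk; rewrite mxE eqxx -val_eqE /= inordK. Qed.

Lemma e3E k (j : 'I_3) : (k < 3)%N -> e3 k 0 j = (j == k :> nat)%:R.
Proof. by move=> hk; rewrite mxE eqxx -val_eqE /= inordK. Qed.

Definition srootF_table : seq (seq rat) :=
  [:: [:: 1; -1; 0; 0]; [:: 0; 1; -1; 0]; [:: 0; 0; 1; 0]; [:: - 2^-1; - 2^-1; - 2^-1; 2^-1]].

Lemma srootF_E (i k : 'I_4) : @sroot datumF i 0 k = nth 0 (nth [::] srootF_table i) k.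
Proof.
case: i k => [[|[|[|[|//]]]] hi] [[|[|[|[|//]]]] hk]; rewrite /= ?(rvZ, rvD, rvN) !e4E //=;
by apply/eqP; vm_compute.
Qed.

Definition gramF_entry (k l : nat) : rat := if k == l then if k == 3 then -6 else 2 else 0.

Lemma gramF_E (k l : 'I_4) : gram datumF k l = gramF_entry k l.
Proof. by rewrite mxE. Qed.

(** Odd roots have delta coordinate $\pm1/2$, which separates them from the even simple roots. *)
Lemma rootsF_odd v : (v, true) \in rootsF -> v 0 (inord 3) != 0.
Proof.
have /allP H : all (fun p : 'rV[rat]_4 * bool => p.2 ==> (p.1 0 (inord 3) != 0)) rootsF.
  by rewrite /rootsF /= ?(rvZ, rvD, rvN) !e4E // inordK.
by move=> /H.
Qed.

Lemma straightens_F : straightens datumF.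
Proof.
apply: (@dk_straightens datumF dkF _ dkF_closed) => //.
- apply: (@bil_table datumF dkF (fun i k => nth 0 (nth [::] srootF_table i) k)
    gramF_entry srootF_E gramF_E).
  by vm_compute.
move=> i; apply/idP/idP => [/rootsF_odd|].
  by case: i => [[|[|[|[|//]]]] hi] //=; rewrite ?(rvZ, rvD, rvN) !e4E // inordK.
case: i => [[|[|[|[|//]]]] hi] // _.
(* The simple root $a_4$ is brought into the shape in which the list displays the odd root with
   signs $(-,-,-,+)$. *)
rewrite /Defs.par (_ : @sroot datumF _ = 2^-1 *: (-1 *: e4 0 + -1 *: e4 1 + -1 *: e4 2 + 1 *: e4 3)).
  by rewrite /= /rootsF /= !inE !eqxx !orbT.
by rewrite /= !scaleN1r scale1r [RHS](congr1 _ (addrC _ _)) !addrA.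
Qed.

Definition srootG_table : seq (seq rat) := [:: [:: 1; 0; 1]; [:: 0; 1; 0]; [:: -1; -2; 0]].
Definition gramG_table : seq (seq rat) := [:: [:: -2; 1; 0]; [:: 1; -2; 0]; [:: 0; 0; 2]].

Lemma srootG_E (i k : 'I_3) : @sroot datumG i 0 k = nth 0 (nth [::] srootG_table i) k.
Proof.
case: i k => [[|[|[|//]]] hi] [[|[|[|//]]] hk]; rewrite /= ?(rvZ, rvD, rvN) !e3E //=;
by apply/eqP; vm_compute.
Qed.

Lemma gramG_E (k l : 'I_3) : gram datumG k l = nth 0 (nth [::] gramG_table k) l.
Proof. by rewrite mxE. Qed.

(** Every odd root involves $\delta$, whereas the even simple roots $a_2$ and $a_3$ do not. *)
Lemma rootsG_odd v : (v, true) \in rootsG -> v 0 (inord 2) != 0.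
Proof.
have /allP H : all (fun p : 'rV[rat]_3 * bool => p.2 ==> (p.1 0 (inord 2) != 0)) rootsG.
  rewrite all_cat; apply/andP; split; first by apply/allP => p /flatten_mapP[x _ /mapP[y _ ->]].
  rewrite all_cat; apply/andP; split; first by apply/allP => p /allpairsP[[x t] [_ _ ->]].
  by rewrite /= ?(rvZ, rvD, rvN) !e3E // inordK.
by move=> /H.
Qed.

Lemma straightens_G : straightens datumG.
Proof.
apply: (@dk_straightens datumG dkG3 _ dkG3_closed) => //.
- apply: (@bil_table datumG dkG3 (fun i k => nth 0 (nth [::] srootG_table i) k)
    (fun k l => nth 0 (nth [::] gramG_table k) l) srootG_E gramG_E).
  by vm_compute.
move=> i; apply/idP/idP => [/rootsG_odd|].
  by case: i => [[|[|[|//]]] hi] //=; rewrite ?(rvZ, rvD, rvN) !e3E // inordK.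
case: i => [[|[|[|//]]] hi] // _.
rewrite /Defs.par (_ : @sroot datumG _ = 1 *: e3 0 + 1 *: e3 2); last by rewrite /= !scale1r addrC.
rewrite -[Defs.roots datumG]/rootsG mem_cat; apply/orP; right; rewrite mem_cat; apply/orP; right.
by rewrite /= !inE !eqxx ?orbT.
Qed.

Theorem mainTheorem14 (T : stype) (hT : valid T)
  (rho : 'S_(rank (datum_of T))) (i j : word (datum_of T)) :
  Lplus rho i -> Lplus rho j -> lexlt rho i j ->
  exists cs : seq (word (datum_of T) * K),
    (forall kc, kc \in cs ->
       dominant rho kc.1 /\ lexle rho (i ++ j) kc.1 /\ lexle rho kc.1 (j ++ i)) /\
    eqF (star (EL rho j) (EL rho i))
        (flatten [seq scaleF kc.2 (Ew rho kc.1) | kc <- cs]).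
Proof.
suff: straightens (datum_of T) by apply.
case: T hT {rho i j} => [m n s _|m n s _|n s hn|m n s hm|_|_].
- exact: straightens_A.
- exact: straightens_B.
- exact: straightens_C.
- exact: straightens_D.
- exact: straightens_F.
exact: straightens_G.
Qed.
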